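(* Let $2\le q<\infty$ and $2\le \sigma<\infty$. There exist constants $0<c\le C<\infty$ depending only on $q$ and $\sigma$ such that the following holds. Let $m,k\in\mathbb{N}$, $n\in\mathbb{Z}_+$, $n\le \frac{mk}{2}$. Let $A$ be a nonempty set, and for each $\alpha\in A$ let $p_\alpha\in[1,\infty]$, $\theta_\alpha\in[1,\infty]$, $\nu_\alpha>0$ be given, with $(p_\alpha,\theta_\alpha)\ne(p_\beta,\theta_\beta)$ for $\alpha\ne\beta$. Set $P=\{(p_\alpha,\theta_\alpha)\}_{\alpha\in A}$ and $$M=\bigcap_{\alpha\in A}\nu_\alpha B^{m,k}_{p_\alpha,\theta_\alpha}.$$ Then $$c\,\min_{0\le j\le 7}\Psi_j(P)\le d_n(M,\,l^{m,k}_{q,\sigma})\le C\,\min_{0\le j\le 7}\Psi_j(P),$$ where $\Psi_0(P),\dots,\Psi_7(P)$ are the quantities (depending on $P,q,\sigma,m,k,n$ and $\nu=(\nu_\alpha)_{\alpha\in A}$) defined in the context.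
   Context: **Spaces and widths.** Convention: $1/\infty=0$. For $N\in\mathbb{N}$, $1\le s\le\infty$, $\|\cdot\|_{l_s^N}$ is the usual $\ell_s$ norm on $\mathbb{R}^N$. For $m,k\in\mathbb{N}$, $1\le p,\theta\le\infty$, $l^{m,k}_{p,\theta}$ is $\mathbb{R}^{mk}=\{(x_{i,j})_{1\le i\le m,\,1\le j\le k}\}$ with norm $\|x\|_{l^{m,k}_{p,\theta}}=\bigl\|\bigl(\|(x_{i,j})_{i=1}^m\|_{l_p^m}\bigr)_{j=1}^k\bigr\|_{l_\theta^k}$; $B^{m,k}_{p,\theta}$ is its (closed) unit ball. For a normed space $X$, $M\subset X$, $n\in\mathbb{Z}_+=\{0,1,2,\dots\}$, the Kolmogorov $n$-width is $d_n(M,X)=\inf_{L}\sup_{x\in M}\inf_{y\in L}\|x-y\|$, the infimum over linear subspaces $L\subset X$ of dimension at most $n$. **The function $\Phi$.** For $1\le p\le q$ put $\omega_{p,q}=\min\left\{\frac{1/p-1/q}{1/2-1/q},1\right\}$ if $q>2$, and $\omega_{p,q}=1$ if $q=2$ (and likewise $\omega_{\theta,\sigma}$ for $1\le\theta\le\sigma$). For fixed $q,\sigma\in[2,\infty)$, $m,k,n$ with $n\le mk/2$, and $p,\theta\in[1,\infty]$, define $\Phi(p,\theta)=\Phi(p,\theta;q,\sigma,m,k,n)$ by (for $n=0$, terms containing $n^{-1/2}$ are read as $+\infty$, i.e. omitted from the minimum; the definitions agree where cases overlap): 1. if $p\ge q$, $\theta\ge\sigma$: $\Phi(p,\theta)=m^{1/q-1/p}k^{1/\sigma-1/\theta}$;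 2. if $p\ge q$, $\theta\le\sigma$: $\Phi(p,\theta)=\min\{m^{1/q-1/p},\ m^{1/q-1/p}(n^{-1/2}m^{1/2}k^{1/\sigma})^{\omega_{\theta,\sigma}}\}$; 3. if $\theta\ge\sigma$, $p\le q$: $\Phi(p,\theta)=\min\{k^{1/\sigma-1/\theta},\ k^{1/\sigma-1/\theta}(n^{-1/2}m^{1/q}k^{1/2})^{\omega_{p,q}}\}$; 4. if $2\le p\le q$, $1\le\theta\le\sigma$, $\omega_{p,q}\le\omega_{\theta,\sigma}$: $\Phi(p,\theta)=\min\{1,\ (n^{-1/2}m^{1/q}k^{1/\sigma})^{\omega_{p,q}},\ m^{1/q-1/p}(n^{-1/2}m^{1/2}k^{1/\sigma})^{\omega_{\theta,\sigma}}\}$; 5. if $2\le\theta\le\sigma$, $1\le p\le q$, $\omega_{\theta,\sigma}\le\omega_{p,q}$: $\Phi(p,\theta)=\min\{1,\ (n^{-1/2}m^{1/q}k^{1/\sigma})^{\omega_{\theta,\sigma}},\ k^{1/\sigma-1/\theta}(n^{-1/2}m^{1/q}k^{1/2})^{\omega_{p,q}}\}$; 6. if $1\le p\le2$, $1\le\theta\le2$: $\Phi(p,\theta)=\min\{1,\ n^{-1/2}m^{1/q}k^{1/\sigma}\}$. **The quantities $\Psi_j$.** For $\alpha,\beta,\gamma\in A$, write $\Delta_{\alpha,\beta,\gamma}\in\mathcal{R}$ if the points $(1/p_\alpha,1/\theta_\alpha)$, $(1/p_\beta,1/\theta_\beta)$, $(1/p_\gamma,1/\theta_\gamma)$ do not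 lie on one line. The infimum over the empty set is $+\infty$. Define the index sets (with the associated, uniquely determined, parameters): - $\mathcal{N}_1$: pairs $(\alpha,\beta)\in A^2$ with $p_\alpha\ne q$ such that there is $\hat\lambda_{\alpha,\beta}\in(0,1)$ with $\frac1q=\frac{1-\hat\lambda_{\alpha,\beta}}{p_\alpha}+\frac{\hat\lambda_{\alpha,\beta}}{p_\beta}$; put $\frac1{\hat\theta_{\alpha,\beta}}=\frac{1-\hat\lambda_{\alpha,\beta}}{\theta_\alpha}+\frac{\hat\lambda_{\alpha,\beta}}{\theta_\beta}$. - $\mathcal{N}_2$: pairs with $\theta_\alpha\ne\sigma$ such that there is $\hat\mu_{\alpha,\beta}\in(0,1)$ with $\frac1\sigma=\frac{1-\hat\mu_{\alpha,\beta}}{\theta_\alpha}+\frac{\hat\mu_{\alpha,\beta}}{\theta_\beta}$; put $\frac1{\hat p_{\alpha,\beta}}=\frac{1-\hat\mu_{\alpha,\beta}}{p_\alpha}+\frac{\hat\mu_{\alpha,\beta}}{p_\beta}$. - $\mathcal{N}_3$: pairs with $p_\alpha\ne2$ such that there is $\tilde\lambda_{\alpha,\beta}\in(0,1)$ with $\frac12=\frac{1-\tilde\lambda_{\alpha,\beta}}{p_\alpha}+\frac{\tilde\lambda_{\alpha,\beta}}{p_\beta}$; put $\frac1{\tilde\theta_{\alpha,\beta}}=\frac{1-\tilde\lambda_{\alpha,\beta}}{\theta_\alpha}+\frac{\tilde\lambda_{\alpha,\beta}}{\theta_\beta}$. - $\mathcal{N}_4$: pairs with $\theta_\alpha\ne2$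 such that there is $\tilde\mu_{\alpha,\beta}\in(0,1)$ with $\frac12=\frac{1-\tilde\mu_{\alpha,\beta}}{\theta_\alpha}+\frac{\tilde\mu_{\alpha,\beta}}{\theta_\beta}$; put $\frac1{\tilde p_{\alpha,\beta}}=\frac{1-\tilde\mu_{\alpha,\beta}}{p_\alpha}+\frac{\tilde\mu_{\alpha,\beta}}{p_\beta}$. - $\mathcal{N}_5$: pairs $(\alpha,\beta)\in A^2$ for which there are $\lambda_{\alpha,\beta}\in(0,1)$, $p_{\alpha,\beta}\in(2,q)$, $\theta_{\alpha,\beta}\in(2,\sigma)$ with $\frac1{p_{\alpha,\beta}}=\frac{1-\lambda_{\alpha,\beta}}{p_\alpha}+\frac{\lambda_{\alpha,\beta}}{p_\beta}$, $\frac1{\theta_{\alpha,\beta}}=\frac{1-\lambda_{\alpha,\beta}}{\theta_\alpha}+\frac{\lambda_{\alpha,\beta}}{\theta_\beta}$, $\frac{1/p_{\alpha,\beta}-1/q}{1/2-1/q}=\frac{1/\theta_{\alpha,\beta}-1/\sigma}{1/2-1/\sigma}$, and $\frac{1/p_\alpha-1/q}{1/2-1/q}\ne\frac{1/\theta_\alpha-1/\sigma}{1/2-1/\sigma}$ (so $\mathcal{N}_5=\varnothing$ if $q=2$ or $\sigma=2$). - $\mathcal{N}_6$: triples $(\alpha,\beta,\gamma)\in A^3$ with $\Delta_{\alpha,\beta,\gamma}\in\mathcal{R}$ for which there are $\tau_\alpha,\tau_\beta,\tau_\gamma>0$, $\tau_\alpha+\tau_\beta+\tau_\gamma=1$, with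 $\frac1q=\frac{\tau_\alpha}{p_\alpha}+\frac{\tau_\beta}{p_\beta}+\frac{\tau_\gamma}{p_\gamma}$ and $\frac1\sigma=\frac{\tau_\alpha}{\theta_\alpha}+\frac{\tau_\beta}{\theta_\beta}+\frac{\tau_\gamma}{\theta_\gamma}$. - $\mathcal{N}_7$: triples $(\alpha,\beta,\gamma)\in A^3$ with $\Delta_{\alpha,\beta,\gamma}\in\mathcal{R}$ for which there are $\overline\tau_\alpha,\overline\tau_\beta,\overline\tau_\gamma>0$, $\overline\tau_\alpha+\overline\tau_\beta+\overline\tau_\gamma=1$, with $\frac12=\frac{\overline\tau_\alpha}{p_\alpha}+\frac{\overline\tau_\beta}{p_\beta}+\frac{\overline\tau_\gamma}{p_\gamma}$ and $\frac12=\frac{\overline\tau_\alpha}{\theta_\alpha}+\frac{\overline\tau_\beta}{\theta_\beta}+\frac{\overline\tau_\gamma}{\theta_\gamma}$. Then $\Psi_0(P)=\inf_{\alpha\in A}\nu_\alpha\Phi(p_\alpha,\theta_\alpha)$; $\Psi_1(P)=\inf_{(\alpha,\beta)\in\mathcal{N}_1}\nu_\alpha^{1-\hat\lambda_{\alpha,\beta}}\nu_\beta^{\hat\lambda_{\alpha,\beta}}\Phi(q,\hat\theta_{\alpha,\beta})$; $\Psi_2(P)=\inf_{(\alpha,\beta)\in\mathcal{N}_2}\nu_\alpha^{1-\hat\mu_{\alpha,\beta}}\nu_\beta^{\hat\mu_{\alpha,\beta}}\Phi(\hat p_{\alpha,\beta},\sigma)$; $\Psi_3(P)=\inf_{(\alpha,\beta)\in\mathcal{N}_3}\nu_\alpha^{1-\tilde\lambda_{\alpha,\beta}}\nu_\beta^{\tilde\lambda_{\alpha,\beta}}\Phi(2,\tilde\theta_{\alpha,\beta})$;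 $\Psi_4(P)=\inf_{(\alpha,\beta)\in\mathcal{N}_4}\nu_\alpha^{1-\tilde\mu_{\alpha,\beta}}\nu_\beta^{\tilde\mu_{\alpha,\beta}}\Phi(\tilde p_{\alpha,\beta},2)$; $\Psi_5(P)=\inf_{(\alpha,\beta)\in\mathcal{N}_5}\nu_\alpha^{1-\lambda_{\alpha,\beta}}\nu_\beta^{\lambda_{\alpha,\beta}}\Phi(p_{\alpha,\beta},\theta_{\alpha,\beta})$; $\Psi_6(P)=\inf_{(\alpha,\beta,\gamma)\in\mathcal{N}_6}\nu_\alpha^{\tau_\alpha}\nu_\beta^{\tau_\beta}\nu_\gamma^{\tau_\gamma}\Phi(q,\sigma)$; $\Psi_7(P)=\inf_{(\alpha,\beta,\gamma)\in\mathcal{N}_7}\nu_\alpha^{\overline\tau_\alpha}\nu_\beta^{\overline\tau_\beta}\nu_\gamma^{\overline\tau_\gamma}\Phi(2,2)$. *)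

(* Defs.v *)
From HB Require Import structures.
From mathcomp Require Import all_boot all_order all_algebra.
From mathcomp Require Import all_classical all_reals all_analysis.
Set Implicit Arguments.
Unset Strict Implicit.
Unset Printing Implicit Defensive.
Import Order.TTheory GRing.Theory Num.Theory.
Local Open Scope classical_set_scope.
Local Open Scope ring_scope.

(* Exponents in [1, oo] are elements of \bar R bounded below by 1. *)

(* 1/p, with 1/oo = 0; conversely the exponent whose reciprocal is u : R is
   u%:E^-1, since 0^-1 = +oo in \bar R. *)
Definition rcp (R : realType) (p : \bar R) : R := fine (p^-1)%E.

(* The value at -oo is junk. *)
Definition lnorm (R : realType) (N : nat) (s : \bar R) (v : 'I_N -> R) : R :=
  match s with
  | r%:E => (\sum_(i < N) `|v i| `^ r) `^ r^-1
  | +oo%E => \big[Num.max/0]_(i < N) `|v i|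
  | -oo%E => 0
  end.

Definition lnorm2 (R : realType) (m k : nat) (p theta : \bar R)
    (x : 'M[R]_(m, k)) : R :=
  lnorm theta (fun j => lnorm p (fun i => x i j)).

Definition lball (R : realType) (m k : nat) (p theta : \bar R) :
    set 'M[R]_(m, k) :=
  [set x | lnorm2 p theta x <= 1].

Definition kolmogorov_width (R : realType) (X : vectType R) (norm : X -> R)
    (M : set X) (n : nat) : \bar R :=
  ereal_inf
    [set ereal_sup
      [set ereal_inf [set (norm (x - y))%:E | y in [set y | y \in L]]
      | x in M]
    | L in [set L : {vspace X} | (\dim L <= n)%N]].

Definition omega (R : realType) (q : R) (p : \bar R) : R :=
  if 2 < q then Num.min ((rcp p - q^-1) / (2^-1 - q^-1)) 1 else 1.

(* [minterms n a s] is the minimum of a and of the terms of s; it is used with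
   terms containing n^(-1/2), which are read as +oo, i.e. omitted, if n = 0. *)
Definition minterms (R : realType) (n : nat) (a : R) (s : seq R) : R :=
  if n == 0%N then a else \big[Num.min/a]_(t <- s) t.

(* The cases overlap and are tested in sequence; for 1 <= p, 1 <= theta,
   2 <= q, 2 <= sigma and 2n <= mk they are exhaustive and agree on overlaps
   (the last branch is the case p <= 2, theta <= 2). *)
Definition Phi (R : realType) (q sigma : R) (m k n : nat)
    (p theta : \bar R) : R :=
  let M : R := m%:R in
  let K : R := k%:R in
  let n' : R := n%:R `^ (- 2^-1) in
  let wp := omega q p in
  let wt := omega sigma theta in
  if (q%:E <= p)%E && (sigma%:E <= theta)%E then
    M `^ (q^-1 - rcp p) * K `^ (sigma^-1 - rcp theta)
  else if (q%:E <= p)%E && (theta <= sigma%:E)%E then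
    minterms n (M `^ (q^-1 - rcp p))
      [:: M `^ (q^-1 - rcp p) * (n' * M `^ 2^-1 * K `^ sigma^-1) `^ wt]
  else if (sigma%:E <= theta)%E && (p <= q%:E)%E then
    minterms n (K `^ (sigma^-1 - rcp theta))
      [:: K `^ (sigma^-1 - rcp theta) * (n' * M `^ q^-1 * K `^ 2^-1) `^ wp]
  else if [&& (2%:E <= p)%E, (p <= q%:E)%E, (theta <= sigma%:E)%E
            & wp <= wt] then
    minterms n 1
      [:: (n' * M `^ q^-1 * K `^ sigma^-1) `^ wp;
          M `^ (q^-1 - rcp p) * (n' * M `^ 2^-1 * K `^ sigma^-1) `^ wt]
  else if [&& (2%:E <= theta)%E, (theta <= sigma%:E)%E, (p <= q%:E)%E
            & wt <= wp] then
    minterms n 1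
      [:: (n' * M `^ q^-1 * K `^ sigma^-1) `^ wt;
          K `^ (sigma^-1 - rcp theta) * (n' * M `^ q^-1 * K `^ 2^-1) `^ wp]
  else
    minterms n 1 [:: n' * M `^ q^-1 * K `^ sigma^-1].

Definition mix2 (R : realType) (l x y : R) : R := (1 - l) * x + l * y.

Definition mix3 (R : realType) (t1 t2 t3 x y z : R) : R :=
  t1 * x + t2 * y + t3 * z.

Definition on_one_line (R : realType) (P1 P2 P3 : R * R) : Prop :=
  exists a b c : R, (a, b) <> (0, 0) /\
    [/\ a * P1.1 + b * P1.2 = c,
        a * P2.1 + b * P2.2 = c &
        a * P3.1 + b * P3.2 = c].

Definition in_general_position (R : realType) (A : Type)
    (p theta : A -> \bar R) (a b c : A) : Prop :=
  ~ on_one_line (rcp (p a), rcp (theta a)) (rcp (p b), rcp (theta b))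
      (rcp (p c), rcp (theta c)).

(* In each of the following index sets the weights are carried along as
   arguments; the conditions determine them uniquely from the indices. *)

(* Used with f the family p or theta and r = q, sigma or 2: this covers the
   first four index sets. *)
Definition crosses (R : realType) (A : Type) (f : A -> \bar R) (r : R)
    (a b : A) (l : R) : Prop :=
  [/\ f a <> r%:E, 0 < l < 1 & r^-1 = mix2 l (rcp (f a)) (rcp (f b))].

Definition crosses_diagonal (R : realType) (A : Type) (p theta : A -> \bar R)
    (q sigma : R) (a b : A) (l pab thetaab : R) : Prop :=
  [/\ [/\ 0 < l < 1, 2 < pab < q & 2 < thetaab < sigma],
      pab^-1 = mix2 l (rcp (p a)) (rcp (p b)),
      thetaab^-1 = mix2 l (rcp (theta a)) (rcp (theta b)),
      (pab^-1 - q^-1) / (2^-1 - q^-1)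
        = (thetaab^-1 - sigma^-1) / (2^-1 - sigma^-1) &
      (rcp (p a) - q^-1) / (2^-1 - q^-1)
        <> (rcp (theta a) - sigma^-1) / (2^-1 - sigma^-1)].

Definition surrounds (R : realType) (A : Type) (p theta : A -> \bar R)
    (r s : R) (a b c : A) (ta tb tc : R) : Prop :=
  [/\ in_general_position p theta a b c,
      [/\ 0 < ta, 0 < tb & 0 < tc],
      ta + tb + tc = 1,
      r^-1 = mix3 ta tb tc (rcp (p a)) (rcp (p b)) (rcp (p c)) &
      s^-1 = mix3 ta tb tc (rcp (theta a)) (rcp (theta b)) (rcp (theta c))].

Definition Psi (R : realType) (q sigma : R) (m k n : nat) (A : Type)
    (p theta : A -> \bar R) (nu : A -> R) (j : nat) : \bar R :=
  let F := Phi q sigma m k n in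
  let mixp l a b := ((mix2 l (rcp (p a)) (rcp (p b)))%:E^-1)%E in
  let mixt l a b := ((mix2 l (rcp (theta a)) (rcp (theta b)))%:E^-1)%E in
  let nu2 l a b := nu a `^ (1 - l) * nu b `^ l in
  let nu3 ta tb tc a b c := nu a `^ ta * nu b `^ tb * nu c `^ tc in
  match j with
  | 0 => ereal_inf [set y | exists a, y = (nu a * F (p a) (theta a))%:E]
  | 1 => ereal_inf [set y | exists a b l, crosses p q a b l /\
           y = (nu2 l a b * F q%:E (mixt l a b))%:E]
  | 2 => ereal_inf [set y | exists a b l, crosses theta sigma a b l /\
           y = (nu2 l a b * F (mixp l a b) sigma%:E)%:E]
  | 3 => ereal_inf [set y | exists a b l, crosses p 2 a b l /\
           y = (nu2 l a b * F 2%:E (mixt l a b))%:E]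
  | 4 => ereal_inf [set y | exists a b l, crosses theta 2 a b l /\
           y = (nu2 l a b * F (mixp l a b) 2%:E)%:E]
  | 5 => ereal_inf [set y | exists a b l pab thetaab,
           crosses_diagonal p theta q sigma a b l pab thetaab /\
           y = (nu2 l a b * F pab%:E thetaab%:E)%:E]
  | 6 => ereal_inf [set y | exists a b c ta tb tc,
           surrounds p theta q sigma a b c ta tb tc /\
           y = (nu3 ta tb tc a b c * F q%:E sigma%:E)%:E]
  | 7 => ereal_inf [set y | exists a b c ta tb tc,
           surrounds p theta 2 2 a b c ta tb tc /\
           y = (nu3 ta tb tc a b c * F 2%:E 2%:E)%:E]
  | _ => +oo%E
  end.

Definition minPsi (R : realType) (q sigma : R) (m k n : nat) (A : Type)
    (p theta : A -> \bar R) (nu : A -> R) : \bar R :=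
  \big[Order.min/+oo%E]_(j < 8) Psi q sigma m k n p theta nu j.

Definition ball_intersection (R : realType) (m k : nat) (A : Type)
    (p theta : A -> \bar R) (nu : A -> R) : set 'M[R]_(m, k) :=
  \bigcap_(a in [set: A]) [set nu a *: x | x in lball (p a) (theta a)].

(* Main.v *)
(* Write a = 1/q, b = 1/sigma, u = 1/p, v = 1/theta, t = ln (n^(-1/2) m^a k^b).
   A computation shows Phi (p, theta) = min over mu in [0, 1] of exp (phi mu),
   where phi mu = mu t + (ln m) (xi - u)_+ + (ln k) (eta - v)_+ and
   (xi, eta) = (1 - mu) (a, b) + mu (1/2, 1/2).

   Upper bound. By Hoelder, the intersection lies in a multiple of the ball whose
   reciprocal exponents are any given convex combination, so it suffices to bound the width of one ball by
   exp (phi mu) for each mu. By embeddings this reduces to exponents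
   (1/xi, 1/eta), and by interpolation between (q, sigma) and (2, 2), with a
   fixed approximating subspace, to the Euclidean ball. That case is a low
   M*-estimate: the span of n random sign vectors works, by symmetrisation, the
   contraction principle and Khintchine's inequality, combined with a
   duality argument in l_s, s even.

   Lower bound. For l <= m, r <= k there is a sign vector x supported on an
   l by r rectangle whose projection on a given n-dimensional subspace is no
   larger than average; this keeps x at distance at least
   1/4 min (l^a r^b, exp t (l r)^(1/2)) from the subspace. A multiple of x lies
   in the intersection, and one has to choose (ln l, ln r) in the box
   [0, ln m] x [0, ln k] so that this multiple is large. By linear programming
   duality the obstruction is a convex combination of the points
   (u_alpha, v_alpha); in a basic solution at most four weights and slacks
   are nonzero, and the possible patterns are exactly those of
   Psi_0, ..., Psi_7. *)

Require Import Defs.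
From HB Require Import structures.
From mathcomp Require Import all_boot all_order all_algebra.
From mathcomp Require Import all_classical all_reals all_analysis.
From mathcomp Require Import lra ring.
Set Implicit Arguments.
Unset Strict Implicit.
Unset Printing Implicit Defensive.
Import Order.TTheory GRing.Theory Num.Theory numFieldNormedType.Exports.
Local Open Scope ring_scope.

(** * Linear programming *)

(** The family may be infinite, so the cone of dual combinations need not be closed, and duality for
    finite programs does not apply to it directly. The point (X, Y) is found instead by extending a
    functional one coordinate at a time, as in the Hahn-Banach theorem; every value is a supremum,
    finite because the cone reaches both directions of each axis. An obstruction is one combination
    of finitely many points, and only to that one is the reduction to a basic solution applied. The
    Euclidean ball is approximated in l_s with s = p + 1 even because the s-th power of the norm is
    then a polynomial: the best approximation has a residual r with r^p orthogonal to the subspace,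
    and r^p acts as the norming functional in the duality argument. *)

Lemma lin_dep (R : fieldType) (I : finType) (d : nat) (B : I -> 'rV[R]_d)
    (S : {set I}) : (d < #|S|)%N ->
  exists delta : I -> R, [/\ exists i, delta i != 0,
    forall i, i \notin S -> delta i = 0 & \sum_i delta i *: B i = 0].
Proof.
move=> dS.
pose M := \matrix_(k < #|S|) B (enum_val k).
have : kermx M != 0.
  apply/negP => /eqP k0.
  have : row_free M by rewrite -kermx_eq0 k0.
  rewrite /row_free => /eqP rM.
  have := rank_leq_col M; rewrite rM => /leq_trans.
  by move/(_ _ (leqnn _)); rewrite leqNgt dS.
case/rowV0Pn => w /sub_kermxP wM w0.
have [/exists_inP[i0 i0S _]|] := boolP [exists i in S, true]; last first.
  rewrite negb_exists_in => /forall_inP S0.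
  have : (0 < #|S|)%N by apply: leq_ltn_trans dS.
  by case/card_gt0P => i /S0.
pose delta i := if i \in S then w 0 (enum_rank_in i0S i) else 0.
have dE k : delta (enum_val k) = w 0 k.
  by rewrite /delta enum_valP enum_valK_in.
exists delta; split.
- have [k wk] : exists k, w 0 k != 0.
    apply/existsP; apply: contraR w0; rewrite negb_exists => /forallP w0.
    apply/eqP/rowP => k; rewrite mxE; apply/eqP.
    by have := w0 k; rewrite negbK.
  by exists (enum_val k); rewrite dE.
- by move=> i /negbTE iS; rewrite /delta iS.
- rewrite (bigID [in S]) /= [X in _ + X]big1 ?addr0; last first.
    by move=> i /negbTE iS; rewrite /delta iS scale0r.
  rewrite (reindex_onto (@enum_val _ (mem S)) (enum_rank_in i0S)) /=; last first.
    by move=> i iS; rewrite enum_rankK_in.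
  rewrite (eq_bigl xpredT); last first.
    by move=> k; rewrite enum_valP enum_valK_in eqxx.
  rewrite -[RHS]wM mulmx_sum_row; apply: eq_bigr => k _.
  by rewrite dE rowK.
Qed.

(** Caratheodory reduction: while the support carries a linear relation, move along it without
    increasing the cost until a coordinate vanishes. The hypothesis on nonnegative relations ensures
    that such a move does hit the boundary. *)
Lemma basic_solution (R : realFieldType) (I : finType) (d : nat)
    (B : I -> 'rV[R]_d) (c x : I -> R) :
  (forall i, 0 <= x i) -> \sum_i c i * x i < 0 ->
  (forall delta : I -> R, (forall i, 0 <= delta i) ->
     \sum_i delta i *: B i = 0 -> 0 <= \sum_i c i * delta i) ->
  exists y : I -> R, [/\ forall i, 0 <= y i,
    \sum_i y i *: B i = \sum_i x i *: B i,
    \sum_i c i * y i < 0 &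
    forall delta : I -> R, (forall i, y i = 0 -> delta i = 0) ->
      \sum_i delta i *: B i = 0 -> forall i, delta i = 0].
Proof.
move=> + + cpos.
have [n] := ubnP #|[set i | x i != 0]%SET|.
elim: n x => // n IH x; rewrite ltnS => sx x0 cx.
have [ind|] := pselect (forall delta : I -> R,
    (forall i, x i = 0 -> delta i = 0) ->
      \sum_i delta i *: B i = 0 -> forall i, delta i = 0).
  by exists x.
move/existsNP => [de]; rewrite not_implyE => -[de1].
rewrite not_implyE => -[de2 /existsNP[i0 /eqP di0]].
(* One of [de] and [- de] works: a relation of negative cost cannot be nonnegative by [cpos], and if
   [de] itself is nonnegative its cost is too, so [- de] can be taken. *)
have [dl [dl1 dl2 dl3 [j dlj]]] : exists dl : I -> R,
    [/\ forall i, x i = 0 -> dl i = 0, \sum_i dl i *: B i = 0,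
      \sum_i c i * dl i <= 0 & exists j, dl j < 0].
  have Nde2 : \sum_i (- de i) *: B i = 0.
    by under eq_bigr do rewrite scaleNr; rewrite sumrN de2 oppr0.
  have Nc : \sum_i c i * - de i = - \sum_i c i * de i.
    by rewrite -sumrN; apply: eq_bigr => i _; rewrite mulrN.
  have aux (g : I -> R) : ~ (exists j, g j < 0) -> forall i, 0 <= g i.
    by move=> h i; rewrite leNgt; apply/negP => gi; apply: h; exists i.
  have [cd|cd] := leP (\sum_i c i * de i) 0; last first.
    exists (fun i => - de i); split => //.
    - by move=> i /de1 ->; rewrite oppr0.
    - by rewrite Nc oppr_le0 ltW.
    - apply: contrapT => /aux /cpos /(_ Nde2).
      by rewrite Nc oppr_ge0 leNgt cd.
  have [e|/aux de0] := pselect (exists j, de j < 0); first by exists de.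
  exists (fun i => - de i); split => //.
  - by move=> i /de1 ->; rewrite oppr0.
  - by rewrite Nc oppr_le0 cpos.
  - exists i0; rewrite oppr_lt0 lt_neqAle eq_sym di0 //=.
pose P := [pred i | dl i < 0].
pose f i := x i / - dl i.
have [i1 Pi1 i1min] : exists2 i, dl i < 0 & forall j, dl j < 0 -> f i <= f j.
  by case: (@arg_minP _ _ _ j P f dlj) => i Pi h; exists i => // j' /h.
(* The longest step along [dl] that keeps all coordinates nonnegative; it annihilates coordinate
   [i1]. *)
set r := f i1.
have r0 : 0 <= r by rewrite divr_ge0 ?x0 // oppr_ge0 ltW.
have xi1 : x i1 != 0.
  by apply/eqP => /dl1 d0; move: Pi1; rewrite d0 ltxx.
pose y i := x i + r * dl i.
have yi1 : y i1 = 0.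
  by rewrite /y /r /f invrN mulrN mulNr divfK ?subrr // lt_eqF.
have [|||z [z1 z2 z3 z4]] := IH y.
- apply: leq_trans sx; apply: proper_card; apply/properP; split.
    apply/fintype.subsetP => i; rewrite !inE; apply: contra => /eqP xi.
    by rewrite /y xi dl1 // mulr0 addr0.
  by exists i1; rewrite !inE ?yi1 ?eqxx.
- move=> i; rewrite /y; have [di|di] := leP 0 (dl i).
    by apply: addr_ge0 => //; apply: mulr_ge0.
  by rewrite -[dl i]opprK mulrN subr_ge0 -ler_pdivlMr ?oppr_gt0 // i1min.
- rewrite /y; under eq_bigr do rewrite mulrDr mulrCA.
  rewrite big_split /= -mulr_sumr.
  by rewrite -[ltRHS]addr0 ltr_leD // mulr_ge0_le0.
exists z; split => //; rewrite z2 /y.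
under eq_bigr do rewrite scalerDl -scalerA.
by rewrite big_split /= -scaler_sumr dl2 scaler0 addr0.
Qed.

(** Elements with c > 0 bound t from below by -d/c, those with c < 0 from above. Adding two
    multiples whose first coordinates cancel gives an element of the slice c = 0, so every lower
    bound is at most every upper bound, and the supremum of the lower bounds serves as t. *)
Lemma cone_elim1 (R : realType) (K : R -> R -> Prop) :
  (forall c d c' d', K c d -> K c' d' -> K (c + c') (d + d')) ->
  (forall l c d, 0 <= l -> K c d -> K (l * c) (l * d)) ->
  (exists c d, 0 < c /\ K c d) -> (exists c d, c < 0 /\ K c d) ->
  (forall d, K 0 d -> 0 <= d) ->
  exists t, forall c d, K c d -> 0 <= c * t + d.
Proof.
move=> KD KZ [cp [dp [cp0 Kp]]] [cn [dn [cn0 Kn]]] K0.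
pose Lw := [set z : R | exists c d, [/\ 0 < c, K c d & z = - d / c]]%classic.
have ub c d : K c d -> c < 0 -> ubound Lw (- d / c).
  move=> Kc c0 _ [c' [d' [c'0 Kc' ->]]].
  have h : 0 <= - c * d' + c' * d.
    apply: K0; have -> : 0 = - c * c' + c' * c :> R by ring.
    by apply: KD; apply: KZ => //; rewrite ?oppr_ge0 ltW.
  rewrite ler_pdivrMr //.
  have -> : - d / c * c' = c' * d / - c by rewrite invrN; ring.
  by rewrite ler_pdivlMr ?oppr_gt0 //; lra.
have hL : has_sup Lw.
  split; first by exists (- dp / cp), cp, dp.
  by exists (- dn / cn); apply: ub.
exists (sup Lw) => c d Kc.
have [c0|c0|c0] := ltgtP c 0.
- have := ge_sup (proj1 hL) (ub _ _ Kc c0).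
  by rewrite ler_ndivlMr //; lra.
- have : - d / c <= sup Lw by apply: ub_le_sup; [exact: hL.2|exists c, d].
  by rewrite ler_pdivrMr //; lra.
- by rewrite c0 mul0r add0r; apply: K0; rewrite -c0.
Qed.

(** A Farkas lemma for cones that need not be closed. Z is fixed on the slice x = y = 0 and absorbed
    into the constant, then Y on the slice x = 0, then X; the elements along both directions of each
    axis make each application of [cone_elim1] possible. *)
Lemma cone_elim3 (R : realType) (K : R -> R -> R -> R -> Prop) :
  (forall x y z d x' y' z' d', K x y z d -> K x' y' z' d' ->
     K (x + x') (y + y') (z + z') (d + d')) ->
  (forall l x y z d, 0 <= l -> K x y z d ->
     K (l * x) (l * y) (l * z) (l * d)) ->
  (exists d, K 0 0 1 d) -> (exists d, K 0 0 (-1) d) ->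
  (exists d, K 0 1 0 d) -> (exists d, K 0 (-1) 0 d) ->
  (exists d, K 1 0 0 d) -> (exists d, K (-1) 0 0 d) ->
  (forall d, K 0 0 0 d -> 0 <= d) ->
  exists X Y Z, forall x y z d, K x y z d -> 0 <= x * X + y * Y + z * Z + d.
Proof.
move=> KD KZ [zp Kzp] [zn Kzn] [yp Kyp] [yn Kyn] [xp Kxp] [xn Kxn] K0.
have [Z HZ] : exists Z, forall z d, K 0 0 z d -> 0 <= z * Z + d.
  apply: cone_elim1 => //.
  - by move=> c d c' d' h h'; have := KD _ _ _ _ _ _ _ _ h h'; rewrite !addr0.
  - by move=> l c d l0 h; have := KZ _ _ _ _ _ l0 h; rewrite !mulr0.
  - by exists 1, zp; rewrite ltr01.
  - by exists (-1), zn; rewrite oppr_lt0 ltr01.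
have [Y HY] : exists Y, forall y d, (exists z d', K 0 y z d' /\ d = z * Z + d') ->
    0 <= y * Y + d.
  apply: (@cone_elim1 _ (fun y d => exists z d', K 0 y z d' /\ d = z * Z + d')).
  - move=> c d c' d' [z [e [h ->]]] [z' [e' [h' ->]]].
    exists (z + z'), (e + e'); split; last ring.
    by have := KD _ _ _ _ _ _ _ _ h h'; rewrite !addr0.
  - move=> l c d l0 [z [e [h ->]]]; exists (l * z), (l * e); split; last ring.
    by have := KZ _ _ _ _ _ l0 h; rewrite !mulr0.
  - by exists 1, (0 * Z + yp); split; [rewrite ltr01|exists 0, yp].
  - by exists (-1), (0 * Z + yn); split; [rewrite oppr_lt0 ltr01|exists 0, yn].
  - by move=> d [z [e [h ->]]]; apply: HZ.
have [X HX] : exists X, forall x d,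
    (exists y z d', K x y z d' /\ d = y * Y + z * Z + d') -> 0 <= x * X + d.
  apply: (@cone_elim1 _ (fun x d =>
    exists y z d', K x y z d' /\ d = y * Y + z * Z + d')).
  - move=> c d c' d' [y [z [e [h ->]]]] [y' [z' [e' [h' ->]]]].
    exists (y + y'), (z + z'), (e + e'); split; last ring.
    exact: KD.
  - move=> l c d l0 [y [z [e [h ->]]]].
    exists (l * y), (l * z), (l * e); split; last ring.
    exact: KZ.
  - by exists 1, (0 * Y + 0 * Z + xp); split; [rewrite ltr01|exists 0, 0, xp].
  - exists (-1), (0 * Y + 0 * Z + xn); split; first by rewrite oppr_lt0 ltr01.
    by exists 0, 0, xn.
  - move=> d [y [z [e [h ->]]]]; rewrite -addrA; apply: HY.
    by exists z, e.
exists X, Y, Z => x y z d h.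
rewrite -!addrA; apply: HX; exists y, z, d; split => //; ring.
Qed.

Definition row4 (R : nzRingType) (x y z w : R) : 'rV[R]_4 :=
  \row_(j < 4) nth 0 [:: x; y; z; w] j.

Lemma sum_row4 (R : nzRingType) (I : finType) (d x y z w : I -> R) :
  \sum_i d i *: row4 (x i) (y i) (z i) (w i) =
  row4 (\sum_i d i * x i) (\sum_i d i * y i) (\sum_i d i * z i)
    (\sum_i d i * w i).
Proof.
apply/rowP => j; rewrite summxE mxE.
by case: j => [[|[|[|[|//]]]] hj] /=; apply: eq_bigr => i _; rewrite !mxE.
Qed.

Lemma row4_inj (R : nzRingType) (x y z w x' y' z' w' : R) :
  row4 x y z w = row4 x' y' z' w' -> [/\ x = x', y = y', z = z' & w = w'].
Proof.
move=> /rowP E; split.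
- by have := E 0; rewrite !mxE.
- by have := E (inord 1); rewrite !mxE !inordK.
- by have := E (inord 2); rewrite !mxE !inordK.
- by have := E (inord 3); rewrite !mxE !inordK.
Qed.

(* w, mu0, mu1 are the multipliers of the constraints attached to the points
   (u i, v i), to (a, b) and to (1/2, 1/2); s1, s2, t1, t2 are those of
   X <= lm, Y <= lk, 0 <= X, 0 <= Y. *)
Record dual_sol (R : realFieldType) (N : nat) (u v h : 'I_N -> R)
    (a b lm lk t : R) (w : 'I_N -> R) (mu0 mu1 s1 s2 t1 t2 : R) : Prop := {
  dual_w0 : forall i, 0 <= w i;
  dual_mu00 : 0 <= mu0; dual_mu10 : 0 <= mu1;
  dual_s10 : 0 <= s1; dual_s20 : 0 <= s2;
  dual_t10 : 0 <= t1; dual_t20 : 0 <= t2;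
  dual_w1 : \sum_i w i = 1;
  dual_mu1 : mu0 + mu1 = 1;
  dual_u : \sum_i w i * u i = mu0 * a + mu1 / 2 - s1 + t1;
  dual_v : \sum_i w i * v i = mu0 * b + mu1 / 2 - s2 + t2;
  dual_neg : \sum_i w i * h i + mu1 * t + lm * s1 + lk * s2 < 0 }.

(** The dual program has four equality constraints, and the slacks count as variables, hence at most
    four nonzero entries. The last clause is the independence of the columns in use; [no_dual] needs
    it to exclude degenerate configurations. *)
Lemma dual_basic (R : realFieldType) (N : nat) (u v h : 'I_N -> R)
    (a b lm lk t : R) (w : 'I_N -> R) (mu0 mu1 s1 s2 t1 t2 : R) :
  0 <= lm -> 0 <= lk ->
  dual_sol u v h a b lm lk t w mu0 mu1 s1 s2 t1 t2 ->
  exists w' m0 m1 p1 p2 r1 r2,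
    [/\ dual_sol u v h a b lm lk t w' m0 m1 p1 p2 r1 r2,
      (#|[set i | w' i != 0%R]%SET| + (m0 != 0%R) + (m1 != 0%R) + (p1 != 0%R)
         + (p2 != 0%R) + (r1 != 0%R) + (r2 != 0%R) <= 4)%N &
      forall (d : 'I_N -> R) e0 e1 f1 f2 g1 g2,
        (forall i, w' i = 0 -> d i = 0) ->
        (m0 = 0 -> e0 = 0) -> (m1 = 0 -> e1 = 0) ->
        (p1 = 0 -> f1 = 0) -> (p2 = 0 -> f2 = 0) ->
        (r1 = 0 -> g1 = 0) -> (r2 = 0 -> g2 = 0) ->
        \sum_i d i = 0 -> e0 + e1 = 0 ->
        \sum_i d i * u i = e0 * a + e1 / 2 - f1 + g1 ->
        \sum_i d i * v i = e0 * b + e1 / 2 - f2 + g2 ->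
        forall i, d i = 0].
Proof.
move=> lm0 lk0 [w0 mu00 mu10 s10 s20 t10 t20 w1 mu1E uE vE neg].
(* The six extra indices stand for [mu0], [mu1], [s1], [s2], [t1], [t2], in this order. *)
pose I : finType := ('I_N + 'I_6)%type.
pose arr (f : 'I_N -> R) (l : seq R) (e : I) : R :=
  match e with inl i => f i | inr k => l`_k end.
pose cx := arr u [:: - a; - 2^-1; 1; 0; -1; 0].
pose cy := arr v [:: - b; - 2^-1; 0; 1; 0; -1].
pose cz := arr (fun=> 1) [:: 0; 0; 0; 0; 0; 0].
pose cw := arr (fun=> 0) [:: 1; 1; 0; 0; 0; 0].
pose cc := arr h [:: 0; t; lm; lk; 0; 0].
pose B e := row4 (cx e) (cy e) (cz e) (cw e).
pose x := arr w [:: mu0; mu1; s1; s2; t1; t2].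
have sumI (F : I -> R) : \sum_e F e = \sum_i F (inl i) +
    (F (inr (inord 0)) + F (inr (inord 1)) + F (inr (inord 2)) +
     F (inr (inord 3)) + F (inr (inord 4)) + F (inr (inord 5))).
  rewrite big_sumType /=; congr (_ + _).
  rewrite !big_ord_recl big_ord0 addr0 !addrA.
  by do !congr (_ + _); congr (F (inr _)); apply/val_inj; rewrite /= inordK.
have ord6 (P : 'I_6 -> Prop) : P (inord 0) -> P (inord 1) -> P (inord 2) ->
    P (inord 3) -> P (inord 4) -> P (inord 5) -> forall k, P k.
  move=> P0 P1 P2 P3 P4 P5 k; rewrite -[k]inord_val.
  by case: k => [[|[|[|[|[|[|//]]]]]] hk].
have arrI f l j : (j < 6)%N -> arr f l (inr (inord j)) = l`_j.
  by move=> j6; rewrite /arr inordK.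
have Bx (d : I -> R) : \sum_e d e *: B e =
   row4 (\sum_i d (inl i) * u i - d (inr (inord 0)) * a
           - d (inr (inord 1)) / 2 + d (inr (inord 2)) - d (inr (inord 4)))
        (\sum_i d (inl i) * v i - d (inr (inord 0)) * b
           - d (inr (inord 1)) / 2 + d (inr (inord 3)) - d (inr (inord 5)))
        (\sum_i d (inl i))
        (d (inr (inord 0)) + d (inr (inord 1))).
  rewrite sum_row4 !sumI /cx /cy /cz /cw !arrI //=.
  have -> : \sum_i d (inl i) * 1 = \sum_i d (inl i).
    by apply: eq_bigr => i _; rewrite mulr1.
  have -> : \sum_(i < N) d (inl i) * 0 = 0.
    by rewrite big1 // => i _; rewrite mulr0.
  by congr row4; ring.
have cost (d : I -> R) : \sum_e cc e * d e = \sum_i d (inl i) * h i +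
    d (inr (inord 1)) * t + lm * d (inr (inord 2)) + lk * d (inr (inord 3)).
  rewrite sumI /cc !arrI //=; under eq_bigr do rewrite mulrC.
  by ring.
have row40 : row4 0 0 0 0 = 0 :> 'rV[R]_4.
  by apply/rowP => -[[|[|[|[|//]]]] hj]; rewrite !mxE.
have [|||y [y0 yB yc yind]] := @basic_solution R I 4 B cc x.
- case=> [i|k]; first exact: w0.
  by move: k; apply: ord6; rewrite /x arrI.
- by rewrite cost /x !arrI.
(* In a nonnegative relation the weights sum to zero and so do the two mu's, hence all of them
   vanish; only the slacks, whose cost is nonnegative, are left. *)
- move=> d d0; rewrite Bx -row40 => /row4_inj[_ _ d3 d4].
  have w_0 i : d (inl i) = 0.
    apply/eqP; move/eqP: d3; rewrite psumr_eq0 // => /allP /(_ i).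
    by rewrite mem_index_enum => /(_ isT).
  rewrite cost big1 ?add0r; last by move=> i _; rewrite w_0 mul0r.
  have -> : d (inr (inord 1)) = 0.
    by have := d0 (inr (inord 0)); have := d0 (inr (inord 1)); lra.
  by rewrite mul0r add0r addr_ge0 // mulr_ge0.
move: yB; rewrite !Bx /x !arrI //= => /row4_inj[e1 e2 e3 e4].
exists (y \o inl), (y (inr (inord 0))), (y (inr (inord 1))),
  (y (inr (inord 2))), (y (inr (inord 3))), (y (inr (inord 4))),
  (y (inr (inord 5))); split.
- split=> //=.
  + by rewrite e3.
  + by rewrite e4.
  + by lra.
  + by lra.
  + by move: yc; rewrite cost.
- have -> : (#|[set i | (y \o inl) i != 0%R]%SET| + (y (inr (inord 0)) != 0%R) +
      (y (inr (inord 1)) != 0%R) + (y (inr (inord 2)) != 0%R)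
         + (y (inr (inord 3)) != 0%R) + (y (inr (inord 4)) != 0%R)
         + (y (inr (inord 5)) != 0%R))%N = #|[set e | y e != 0]%SET|.
    have cE (J : finType) (P : pred J) :
        #|[set e | P e]%SET| = (\sum_e (P e : nat))%N.
      by rewrite -sum1dep_card big_mkcond; apply: eq_bigr => e _; case: (P e).
    rewrite !cE big_sumType /= !big_ord_recl big_ord0 addn0 -!addnA.
    do ![congr (_ + _)%N]; congr (nat_of_bool (y (inr _) != 0));
      by apply/val_inj; rewrite /= inordK.
  rewrite leqNgt; apply/negP => /(lin_dep B)[d [[i di] dS dB]].
  move: di; rewrite (yind d) ?eqxx // => j yj.
  by apply: dS; rewrite inE yj eqxx.
- move=> d d0 d1 f1 f2 g1 g2 hd hd0 hd1 hf1 hf2 hg1 hg2 E1 E2 E3 E4 i.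
  pose D := arr d [:: d0; d1; f1; f2; g1; g2].
  have := yind D _ _ (inl i); apply.
    case=> [j|k]; first exact: hd.
    by move: k; apply: ord6; rewrite /D arrI.
  rewrite Bx /D !arrI //= -row40 E1 E2 E3 E4; congr row4; ring.
Qed.

Definition phi (R : realFieldType) (a b lm lk t x y mu : R) : R :=
  mu * t + lm * Num.max 0 (a + mu * (2^-1 - a) - x)
         + lk * Num.max 0 (b + mu * (2^-1 - b) - y).

Lemma phi_le (R : realFieldType) (a b lm lk t x y mu s1 s2 : R) :
  0 <= lm -> 0 <= lk -> 0 <= s1 -> 0 <= s2 ->
  a + mu * (2^-1 - a) - x <= s1 -> b + mu * (2^-1 - b) - y <= s2 ->
  phi a b lm lk t x y mu <= mu * t + lm * s1 + lk * s2.
Proof.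
move=> lm0 lk0 s10 s20 h1 h2; rewrite /phi !lerD //.
  by rewrite ler_wpM2l // ge_max s10.
by rewrite ler_wpM2l // ge_max s20.
Qed.

Definition collinear (R : realFieldType) (x1 y1 x2 y2 x3 y3 : R) : Prop :=
  (x2 - x1) * (y3 - y1) = (x3 - x1) * (y2 - y1).

(** With h = ln nu - ln y this is the logarithmic form of y <= Psi_j for all j: [feas1] is j = 0,
    [feas2u] is j = 1 and 3, [feas2v] is j = 2 and 4, [feas2d] is j = 5, [feas3] is j = 6 and 7. Phi
    enters through [phi] at every mu, of which it is the minimum. *)
Record feasible (R : realFieldType) (A : Type) (u v h : A -> R)
    (a b lm lk t : R) : Prop := {
  feas1 : forall i mu, 0 <= mu <= 1 ->
    0 <= h i + phi a b lm lk t (u i) (v i) mu;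
  feas2u : forall i j l xi mu, 0 < l < 1 -> 0 <= mu <= 1 ->
    xi = a \/ xi = 2^-1 -> u i != xi -> (1 - l) * u i + l * u j = xi ->
    0 <= (1 - l) * h i + l * h j
         + phi a b lm lk t xi ((1 - l) * v i + l * v j) mu;
  feas2v : forall i j l eta mu, 0 < l < 1 -> 0 <= mu <= 1 ->
    eta = b \/ eta = 2^-1 -> v i != eta -> (1 - l) * v i + l * v j = eta ->
    0 <= (1 - l) * h i + l * h j
         + phi a b lm lk t ((1 - l) * u i + l * u j) eta mu;
  feas2d : forall i j l mu, 0 < l < 1 -> 0 < mu < 1 -> a < 2^-1 -> b < 2^-1 ->
    (1 - l) * u i + l * u j = a + mu * (2^-1 - a) ->
    (1 - l) * v i + l * v j = b + mu * (2^-1 - b) ->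
    (u i - a) * (2^-1 - b) != (v i - b) * (2^-1 - a) ->
    0 <= (1 - l) * h i + l * h j
         + phi a b lm lk t ((1 - l) * u i + l * u j)
             ((1 - l) * v i + l * v j) mu;
  feas3 : forall i j k x y z xi eta mu, 0 < x -> 0 < y -> 0 < z ->
    x + y + z = 1 -> 0 <= mu <= 1 ->
    (xi = a /\ eta = b) \/ (xi = 2^-1 /\ eta = 2^-1) ->
    ~ collinear (u i) (v i) (u j) (v j) (u k) (v k) ->
    x * u i + y * u j + z * u k = xi ->
    x * v i + y * v j + z * v k = eta ->
    0 <= x * h i + y * h j + z * h k + phi a b lm lk t xi eta mu }.

Lemma sum_delta (R : nzRingType) (N : nat) (i : 'I_N) (c : R) (f : 'I_N -> R) :
  \sum_l c * (l == i)%:R * f l = c * f i.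
Proof.
rewrite (bigD1 i) //= eqxx mulr1 big1 ?addr0 // => l /negbTE ->.
by rewrite mulr0 mul0r.
Qed.

(** Case analysis on the number of positive weights in a basic solution. In each pattern covered by
    [feasible] the weighted point has [phi] at most the negative dual cost, a contradiction; every
    other pattern violates the count of nonzero entries or the independence of the columns. *)
Lemma no_dual (R : realFieldType) (N : nat) (u v h : 'I_N -> R)
    (a b lm lk t : R) (w : 'I_N -> R) (mu0 mu1 s1 s2 t1 t2 : R) :
  a <= 2^-1 -> b <= 2^-1 ->
  0 <= lm -> 0 <= lk -> feasible u v h a b lm lk t ->
  ~ dual_sol u v h a b lm lk t w mu0 mu1 s1 s2 t1 t2.
Proof.
move=> ha hb lm0 lk0 F /dual_basic.
case/(_ lm0 lk0) => {}w [{}mu0 [{}mu1 [{}s1 [{}s2 [{}t1 [{}t2 []]]]]]].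
case=> w0 mu00 mu10 s10 s20 t10 t20 w1 muE uE vE neg.
set W := [set i | w i != 0]%SET => card ind.
have mu01 : 0 <= mu1 <= 1 by lra.
have wW i : i \in W -> 0 < w i by rewrite inE lt0r w0 andbT.
have sumW (f : 'I_N -> R) : \sum_i w i * f i = \sum_(i in W) w i * f i.
  rewrite (bigID (mem W)) /= [X in _ + X]big1 ?addr0 // => i.
  by rewrite inE negbK => /eqP ->; rewrite mul0r.
have w1W : \sum_(i in W) w i = 1.
  have := sumW (fun=> 1); under eq_bigr do rewrite mulr1; rewrite w1 => ->.
  by apply: eq_bigr => i _; rewrite mulr1.
move: uE vE neg; rewrite !sumW => uE vE neg.
(* At the weighted point the left alternative holds: since [t1] and [t2] are nonnegative, the dual
   constraints make [s1] and [s2] dominate the differences inside [phi]. *)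
have pls x y : phi a b lm lk t x y mu1 <= mu1 * t + lm * s1 + lk * s2 \/
    ~ (a + mu1 * (2^-1 - a) - x <= s1 /\ b + mu1 * (2^-1 - b) - y <= s2).
  have [[h1 h2]|] := pselect (a + mu1 * (2^-1 - a) - x <= s1
     /\ b + mu1 * (2^-1 - b) - y <= s2); last by right.
  by left; exact: phi_le.
have mu0E : mu0 = 1 - mu1 by lra.
rewrite mu0E in uE vE.
(* Independence for relations carried by at most three weights. The indicator form allows the
   indices to coincide, which covers two weights as well. *)
have ind3 (i j k : 'I_N) x y z e0 e1 f1 f2 g1 g2 :
    i \in W -> j \in W -> k \in W -> x + y + z = 0 ->
    (mu0 = 0 -> e0 = 0) -> (mu1 = 0 -> e1 = 0) ->
    (s1 = 0 -> f1 = 0) -> (s2 = 0 -> f2 = 0) ->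
    (t1 = 0 -> g1 = 0) -> (t2 = 0 -> g2 = 0) ->
    e0 + e1 = 0 ->
    x * u i + y * u j + z * u k = e0 * a + e1 / 2 - f1 + g1 ->
    x * v i + y * v j + z * v k = e0 * b + e1 / 2 - f2 + g2 ->
    forall l, x * (l == i)%:R + y * (l == j)%:R + z * (l == k)%:R = 0.
  move=> iW jW kW xyz k0 k1 k2 k3 k4 k5 e01 Eu Ev.
  have S3 (f : 'I_N -> R) :
      \sum_l (x * (l == i)%:R + y * (l == j)%:R + z * (l == k)%:R) * f l
      = x * f i + y * f j + z * f k.
    under eq_bigr do rewrite !mulrDl.
    by rewrite !big_split /= !sum_delta.
  apply: (ind _ e0 e1 f1 f2 g1 g2) => //.
  - move=> l wl.
    have nW m : m \in W -> (l == m) = false.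
      by move=> /wW; case: eqP => // <-; rewrite wl ltxx.
    by rewrite !nW // !mulr0 !addr0.
  - have := S3 (fun=> 1); under eq_bigr do rewrite mulr1.
    by move=> ->; rewrite !mulr1.
  - by rewrite S3.
  - by rewrite S3.
have [W0|Wge] := leqP #|W| 0.
  move: W0; rewrite leqn0 cards_eq0 => /eqP W0.
  by move: w1W; rewrite W0 big_set0 => /esym /eqP; rewrite oner_eq0.
have [W1|Wge2] := leqP #|W| 1.
  have /cards1P[i Wi] : #|W| == 1%N by rewrite eqn_leq W1 Wge.
  move: w1W uE vE neg; rewrite Wi !big_set1 => -> .
  rewrite !mul1r => uE vE neg.
  have pos := feas1 F i mu01.
  by have [?|[]] := pls (u i) (v i); [lra|split; lra].
have [W2|Wge3] := leqP #|W| 2.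
  have /cards2P[i [j [ij Wij]]] : #|W| == 2%N by rewrite eqn_leq W2 Wge2.
  have iW : i \in W by rewrite Wij !inE eqxx.
  have jW : j \in W by rewrite Wij !inE eqxx orbT.
  have S2 (f : 'I_N -> R) : \sum_(l in W) f l = f i + f j.
    by rewrite Wij big_setU1 ?inE //= big_set1.
  move: w1W uE vE neg; rewrite !S2 => wij uE vE neg.
  have wi := wW _ iW; have wj := wW _ jW.
  set l := w j in wij uE vE neg wj.
  have wiE : w i = 1 - l by lra.
  rewrite wiE in wij uE vE neg wi => {wiE}.
  have l01 : 0 < l < 1 by lra.
  have np : phi a b lm lk t ((1 - l) * u i + l * u j)
      ((1 - l) * v i + l * v j) mu1 <= mu1 * t + lm * s1 + lk * s2.
    by have [?|[]] := pls ((1 - l) * u i + l * u j) ((1 - l) * v i + l * v j);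
      [lra|split; lra].
  have ind2 e0 e1 f1 f2 g1 g2 : (mu0 = 0 -> e0 = 0) -> (mu1 = 0 -> e1 = 0) ->
    (s1 = 0 -> f1 = 0) -> (s2 = 0 -> f2 = 0) ->
    (t1 = 0 -> g1 = 0) -> (t2 = 0 -> g2 = 0) ->
    e0 + e1 = 0 ->
    u i - u j = e0 * a + e1 / 2 - f1 + g1 ->
    v i - v j = e0 * b + e1 / 2 - f2 + g2 -> False.
    move=> k0 k1 k2 k3 k4 k5 e01 Eu Ev.
    have E0 : 1 + -1 + 0 = 0 :> R by ring.
    have Eu' : 1 * u i + -1 * u j + 0 * u j = e0 * a + e1 / 2 - f1 + g1.
      by rewrite -Eu; ring.
    have Ev' : 1 * v i + -1 * v j + 0 * v j = e0 * b + e1 / 2 - f2 + g2.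
      by rewrite -Ev; ring.
    have := ind3 i j j 1 (-1) 0 e0 e1 f1 f2 g1 g2 iW jW jW E0 k0 k1 k2 k3 k4 k5
      e01 Eu' Ev' i.
    rewrite eqxx (negbTE ij) !mulr0 !addr0 mulr1 => /eqP.
    by rewrite oner_eq0.
  (* If the first coordinate of the weighted point is a or 1/2 and the u's differ, the pair belongs
     to the first or third index set and [feas2u] contradicts the negative cost. *)
  have Cu : (1 - l) * u i + l * u j = a \/ (1 - l) * u i + l * u j = 2^-1 ->
      u i = u j.
    move=> xiE; have [//|uij] := eqVneq (u i) (u j); exfalso.
    have ui : u i != (1 - l) * u i + l * u j.
      rewrite -subr_eq0.
      have -> : u i - ((1 - l) * u i + l * u j) = l * (u i - u j) by ring.
      by rewrite mulf_neq0 ?subr_eq0 // gt_eqF.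
    by have pos := feas2u F l01 mu01 xiE ui erefl; lra.
  have Cv : (1 - l) * v i + l * v j = b \/ (1 - l) * v i + l * v j = 2^-1 ->
      v i = v j.
    move=> xiE; have [//|uij] := eqVneq (v i) (v j); exfalso.
    have ui : v i != (1 - l) * v i + l * v j.
      rewrite -subr_eq0.
      have -> : v i - ((1 - l) * v i + l * v j) = l * (v i - v j) by ring.
      by rewrite mulf_neq0 ?subr_eq0 // gt_eqF.
    by have pos := feas2v F l01 mu01 xiE ui erefl; lra.
  have card' : ((mu0 != 0%R) + (mu1 != 0%R) + (s1 != 0%R)
     + (s2 != 0%R) + (t1 != 0%R) + (t2 != 0%R) <= 2)%N.
    by rewrite -(leq_add2l #|W|) !addnA (leq_trans card) // (leq_add2r 2 2).
  have [mx|mx] := pselect (0 < mu1 < 1).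
    have /andP[mx1 mx2] := mx.
    (* Two weights and two nonzero mu's already make four, so no slack is left and the weighted
       point lies on the segment from (a, b) to (1/2, 1/2). *)
    have [s1E s2E t1E t2E] : [/\ s1 = 0, s2 = 0, t1 = 0 & t2 = 0].
      move: card'.
      have -> : mu0 != 0 by rewrite mu0E subr_eq0 eq_sym lt_eqF.
      have -> : mu1 != 0 by rewrite gt_eqF.
      by case: eqP => // ->; case: eqP => // ->; case: eqP => // ->;
        case: eqP => // ->.
    have mu0n : mu0 != 0 by rewrite mu0E subr_eq0 eq_sym lt_eqF.
    have mu1n : mu1 != 0 by rewrite gt_eqF.
    have inddiag e : u i - u j = e * (a - 2^-1) ->
        v i - v j = e * (b - 2^-1) -> False.
      move=> Eu Ev; apply: (ind2 e (- e) 0 0 0 0) => //.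
      - by move=> E; rewrite E eqxx in mu0n.
      - by move=> E; rewrite E eqxx in mu1n.
      - by rewrite subrr.
      - by rewrite Eu; ring.
      - by rewrite Ev; ring.
    have uE' : (1 - l) * u i + l * u j = a + mu1 * (2^-1 - a).
      by rewrite uE s1E t1E; ring.
    have vE' : (1 - l) * v i + l * v j = b + mu1 * (2^-1 - b).
      by rewrite vE s2E t2E; ring.
    (* For a = 1/2 or b = 1/2 the segment is degenerate and [feas2d] does not apply, but the point
       then falls under [Cu] or [Cv]. *)
    have [a2|a2] := eqVneq a 2^-1.
      have uij : u i = u j by apply: Cu; right; rewrite uE' a2; ring.
      have [b2|b2] := eqVneq b 2^-1.
        have vij : v i = v j by apply: Cv; right; rewrite vE' b2; ring.
        by apply: (inddiag 0); rewrite ?uij ?vij; ring.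
      apply: (inddiag ((v i - v j) / (b - 2^-1))).
        by rewrite uij a2; ring.
      by rewrite divfK // subr_eq0.
    have [b2|b2] := eqVneq b 2^-1.
      have vij : v i = v j by apply: Cv; right; rewrite vE' b2; ring.
      apply: (inddiag ((u i - u j) / (a - 2^-1))).
        by rewrite divfK // subr_eq0.
      by rewrite vij b2; ring.
    have alt : a < 2^-1 by rewrite lt_neqAle a2.
    have blt : b < 2^-1 by rewrite lt_neqAle b2.
    (* Off the diagonal [feas2d] applies. Otherwise both points lie on the line of the segment, so
       their difference is a multiple of its direction, against independence. *)
    have [dg|dg] := eqVneq ((u i - a) * (2^-1 - b)) ((v i - b) * (2^-1 - a));
      last first.
      have := feas2d F l01 mx alt blt uE' vE' dg.
      move: np neg; clear; lra.
    pose e := (u i - u j) / (a - 2^-1).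
    have a0 : a - 2^-1 != 0 by rewrite subr_eq0.
    have eE : e * (a - 2^-1) = u i - u j by rewrite divfK.
    have l0 : l != 0 by rewrite gt_eqF.
    have uij : l * (u i - u j) = u i - a - mu1 * (2^-1 - a).
      by move: uE'; clear; lra.
    have vij : l * (v i - v j) = v i - b - mu1 * (2^-1 - b).
      by move: vE'; clear; lra.
    apply: (inddiag e) => //; apply: (mulfI l0); apply: (mulfI a0).
    have -> : (a - 2^-1) * (l * (e * (b - 2^-1))) =
        l * (e * (a - 2^-1)) * (b - 2^-1) by ring.
    by rewrite eE uij vij; move: dg; clear; lra.
  have mE : (mu0 = 1 /\ mu1 = 0) \/ (mu0 = 0 /\ mu1 = 1).
    have [m|m] := eqVneq mu1 0; first by left; rewrite mu0E m subr0.
    right; have [m'|m'] := eqVneq mu1 1; first by rewrite mu0E m' subrr.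
    exfalso; apply: mx; case/andP: mu01 => m1 m2.
    by rewrite !lt_neqAle m1 m2 m' eq_sym m.
  (* Two weights and one nonzero mu leave room for a single slack, so some coordinate has none. *)
  have cs : (s1 = 0 /\ t1 = 0) \/ (s2 = 0 /\ t2 = 0).
    move: card'; have -> : ((mu0 != 0%R) + (mu1 != 0%R) = 1)%N.
      by case: mE => -[-> ->]; rewrite eqxx oner_eq0.
    by case: eqP => s1E; case: eqP => s2E; case: eqP => t1E; case: eqP => t2E //;
      by [left|right].
  have xiE : s1 = 0 /\ t1 = 0 -> u i = u j.
    move=> [s1E t1E]; apply: Cu; rewrite uE s1E t1E.
    by case: mE => -[_ ->]; [left|right]; ring.
  have etaE : s2 = 0 /\ t2 = 0 -> v i = v j.
    move=> [s2E t2E]; apply: Cv; rewrite vE s2E t2E.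
    by case: mE => -[_ ->]; [left|right]; ring.
  (* A coordinate without slack has equal entries at i and j. The difference in the other coordinate
     is absorbed by its nonzero slack, or vanishes too; either way the columns are dependent. *)
  have [cu|ncu] := pselect (s1 = 0 /\ t1 = 0).
    have uij := xiE cu.
    have [cv|ncv] := pselect (s2 = 0 /\ t2 = 0).
      have vij := etaE cv.
      by apply: (ind2 0 0 0 0 0 0) => //; rewrite ?uij ?vij; ring.
    have [s2E|s2E] := eqVneq s2 0.
      apply: (ind2 0 0 0 0 0 (v i - v j)) => //; rewrite ?uij; try ring.
      by move=> t2E; exfalso; apply: ncv.
    apply: (ind2 0 0 0 (v j - v i) 0 0) => //; rewrite ?uij; try ring.
    by move=> E; rewrite E eqxx in s2E.
  case: cs => // cv; have vij := etaE cv.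
  have [s1E|s1E] := eqVneq s1 0.
    apply: (ind2 0 0 0 0 (u i - u j) 0) => //; rewrite ?vij; try ring.
    by move=> t1E; exfalso; apply: ncu.
  apply: (ind2 0 0 (u j - u i) 0 0 0) => //; rewrite ?vij; try ring.
  by move=> E; rewrite E eqxx in s1E.
have mun : ((mu0 != 0%R) + (mu1 != 0%R) >= 1)%N.
  have [m|//] := eqVneq mu0 0.
  have -> : mu1 != 0 by rewrite -(addKr mu0 mu1) muE m oppr0 add0r oner_eq0.
  by rewrite addn1.
have {}card : ((mu0 != 0%R) + (mu1 != 0%R) + ((s1 != 0%R)
     + (s2 != 0%R) + (t1 != 0%R) + (t2 != 0%R)) <= 4 - #|W|)%N.
  by rewrite leq_subRL ?addnA // (leq_trans _ card) // -!addnA leq_addr.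
have [W3|Wge4] := leqP #|W| 3; last first.
  have := leq_trans mun (leq_trans (leq_addr _ _) card).
  by rewrite subn_gt0 ltnNge Wge4.
have WE : #|W| = 3 by apply/eqP; rewrite eqn_leq W3 Wge3.
rewrite WE /= in card.
(* Three weights leave room for one more nonzero entry, and one of [mu0], [mu1] takes it. Hence no
   slack remains and [mu1] is 0 or 1. *)
have [s1E s2E t1E t2E] : [/\ s1 = 0, s2 = 0, t1 = 0 & t2 = 0].
  have := leq_trans (leq_add mun (leqnn _)) card.
  by case: eqP => // ->; case: eqP => // ->; case: eqP => // ->;
        case: eqP => // ->.
have mE : mu1 = 0 \/ mu1 = 1.
  move: card; rewrite s1E s2E t1E t2E eqxx mu0E subr_eq0.
  by case: eqP => [<-|?]; [right|case: eqP => // ->; left].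
have /card_gt0P[i iW] : (0 < #|W|)%N by [].
have /cards2P[j [k [jk Wjk]]] : #|W :\ i| == 2%N.
  by have := cardsD1 i W; rewrite iW WE add1n => -[<-].
have : j \in W :\ i by rewrite Wjk !inE eqxx.
rewrite in_setD1 => /andP[ji jW].
have : k \in W :\ i by rewrite Wjk !inE eqxx orbT.
rewrite in_setD1 => /andP[ki kW].
have S3 (f : 'I_N -> R) : \sum_(l in W) f l = f i + f j + f k.
  rewrite (big_setD1 i) //= Wjk big_setU1 ?inE //= big_set1.
  by rewrite addrA.
move: w1W uE vE neg; rewrite !S3 => wijk uE vE neg.
have np : phi a b lm lk t (w i * u i + w j * u j + w k * u k)
    (w i * v i + w j * v j + w k * v k) mu1 <= mu1 * t + lm * s1 + lk * s2.
  by have [?|[]] := pls (w i * u i + w j * u j + w k * u k)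
    (w i * v i + w j * v j + w k * v k); [lra|split; lra].
have [col|ncol] := pselect (collinear (u i) (v i) (u j) (v j) (u k) (v k));
  last first.
  have vtx : (w i * u i + w j * u j + w k * u k = a /\
       w i * v i + w j * v j + w k * v k = b) \/
      (w i * u i + w j * u j + w k * u k = 2^-1 /\
       w i * v i + w j * v j + w k * v k = 2^-1).
    rewrite uE vE s1E s2E t1E t2E.
    by case: mE => ->; [left|right]; split; ring.
  have := feas3 F (wW _ iW) (wW _ jW) (wW _ kW) wijk mu01 vtx ncol erefl erefl.
  by move: np neg; clear; lra.
rewrite /collinear in col.
have fin x y z : x + y + z = 0 -> x * u i + y * u j + z * u k = 0 ->
    x * v i + y * v j + z * v k = 0 -> [/\ x = 0, y = 0 & z = 0].
  move=> xyz E1 E2.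
  have E1' : x * u i + y * u j + z * u k = 0 * a + 0 / 2 - 0 + 0.
    by rewrite E1; ring.
  have E2' : x * v i + y * v j + z * v k = 0 * b + 0 / 2 - 0 + 0.
    by rewrite E2; ring.
  have H := @ind3 i j k x y z 0 0 0 0 0 0 iW jW kW xyz
    (fun=> erefl) (fun=> erefl) (fun=> erefl) (fun=> erefl) (fun=> erefl)
    (fun=> erefl) (addr0 0) E1' E2'.
  have := H k; have := H j; have := H i.
  rewrite !eqxx (eq_sym i j) (eq_sym i k) (eq_sym k j) (negbTE ji) (negbTE ki).
  by rewrite (negbTE jk) !mulr1 !mulr0 !add0r !addr0; split.
(* Collinear points satisfy an affine relation whose coefficients are differences of their
   coordinates; when points i and j coincide the relation 1, -1, 0 is used. Independence would make
   it trivial. *)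
have [uij|uij] := eqVneq (u i) (u j).
  have [vij|vij] := eqVneq (v i) (v j).
    have [|||] := fin 1 (-1) 0; rewrite ?uij ?vij; try ring.
    by move=> /eqP; rewrite oner_eq0.
  have [|||] := fin (v j - v k) (v k - v i) (v i - v j); try ring.
    by rewrite uij in col *; move: col; clear; lra.
  by move=> _ _ /eqP; rewrite subr_eq0 (negbTE vij).
have [|||] := fin (u j - u k) (u k - u i) (u i - u j); try ring.
  by move: col; clear; lra.
by move=> _ _ /eqP; rewrite subr_eq0 (negbTE uij).
Qed.

Lemma feasible_comp (R : realFieldType) (A B : Type) (g : B -> A)
    (u v h : A -> R) (a b lm lk t : R) :
  feasible u v h a b lm lk t ->
  feasible (u \o g) (v \o g) (h \o g) a b lm lk t.
Proof.
case=> F1 Fu Fv Fd F3; split=> /=.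
- by move=> i; exact: F1.
- by move=> i j; exact: Fu.
- by move=> i j; exact: Fv.
- by move=> i j; exact: Fd.
- by move=> i j k; exact: F3.
Qed.

(** Duality. [K] consists of the nonnegative combinations of the linear constraints on (X, Y, Z),
    where Z lies below both terms of the minimum. A combination with vanishing left side and
    negative constant normalises to a [dual_sol], which [no_dual] excludes. Lists keep the
    combinations finite for arbitrary A. *)
Lemma feasible_box_point (R : realType) (A : Type) (u v h : A -> R)
    (a b lm lk t : R) :
  inhabited A -> (forall i, 0 <= u i) -> (forall i, 0 <= v i) ->
  0 <= a <= 2^-1 -> 0 <= b <= 2^-1 -> 0 <= lm -> 0 <= lk ->
  feasible u v h a b lm lk t ->
  exists X Y, [/\ 0 <= X <= lm, 0 <= Y <= lk & forall i,
    0 <= h i - u i * X - v i * Y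
         + Num.min (a * X + b * Y) (t + X / 2 + Y / 2)].
Proof.
move=> [i0] u0 v0 /andP[a0 a2] /andP[b0 b2] lm0 lk0 F.
pose K x y z d := exists (s : seq (A * R)) mu0 mu1 s1 s2 t1 t2,
  [/\ all (fun e => 0 <= e.2) s,
      [/\ 0 <= mu0, 0 <= mu1, 0 <= s1, 0 <= s2 & 0 <= t1 /\ 0 <= t2],
      x = - (\sum_(e <- s) e.2 * u e.1) + mu0 * a + mu1 / 2 - s1 + t1,
      y = - (\sum_(e <- s) e.2 * v e.1) + mu0 * b + mu1 / 2 - s2 + t2 &
      z = \sum_(e <- s) e.2 - mu0 - mu1 /\
      d = \sum_(e <- s) e.2 * h e.1 + mu1 * t + s1 * lm + s2 * lk].
have KI s mu0 mu1 s1 s2 t1 t2 x y z d : all (fun e => 0 <= e.2) s ->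
   0 <= mu0 -> 0 <= mu1 -> 0 <= s1 -> 0 <= s2 -> 0 <= t1 -> 0 <= t2 ->
   x = - (\sum_(e <- s) e.2 * u e.1) + mu0 * a + mu1 / 2 - s1 + t1 ->
   y = - (\sum_(e <- s) e.2 * v e.1) + mu0 * b + mu1 / 2 - s2 + t2 ->
   z = \sum_(e <- s) e.2 - mu0 - mu1 ->
   d = \sum_(e <- s) e.2 * h e.1 + mu1 * t + s1 * lm + s2 * lk ->
   K x y z d.
  by move=> *; exists s, mu0, mu1, s1, s2, t1, t2.
have [|||||||||X [Y [Z HK]]] := @cone_elim3 R K.
- move=> x y z d x' y' z' d'.
  case=> s [m0 [m1 [s1 [s2 [t1 [t2 [hs [? ? ? ? [? ?]] -> -> [-> ->]]]]]]]].
  case=> s' [m0' [m1' [s1' [s2' [t1' [t2' [hs' [? ? ? ? [? ?]] -> -> [-> ->]]]]]]]].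
  apply: (KI (s ++ s') (m0 + m0') (m1 + m1') (s1 + s1') (s2 + s2') (t1 + t1')
    (t2 + t2')); rewrite ?addr_ge0 // ?big_cat /= ?all_cat ?hs //; by ring.
- move=> l x y z d l0.
  case=> s [m0 [m1 [s1 [s2 [t1 [t2 [hs [? ? ? ? [? ?]] -> -> [-> ->]]]]]]]].
  have sl (f : A -> R) : \sum_(e <- [seq (e.1, l * e.2) | e <- s]) e.2 * f e.1
      = l * \sum_(e <- s) e.2 * f e.1.
    by rewrite big_map mulr_sumr; apply: eq_bigr => e _; rewrite mulrA.
  apply: (KI [seq (e.1, l * e.2) | e <- s] (l * m0) (l * m1) (l * s1) (l * s2)
    (l * t1) (l * t2)); rewrite ?mulr_ge0 // ?sl; try ring.
    rewrite all_map; apply: sub_all hs => e /=; exact: mulr_ge0.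
  by rewrite big_map /= -mulr_sumr; ring.
(* The positive z-direction needs a point of the family; the slacks [u i0] and [v i0] cancel its
   other two coordinates. *)
- exists (h i0).
  apply: (KI [:: (i0, 1)] 0 0 0 0 (u i0) (v i0)) => //;
    rewrite ?big_seq1 /= ?ler01 //; by ring.
- exists (a * lm + b * lk).
  by apply: (KI [::] 1 0 a b 0 0) => //; rewrite ?big_nil //; ring.
- by exists 0; apply: (KI [::] 0 0 0 0 0 1) => //; rewrite ?big_nil //; ring.
- by exists lk; apply: (KI [::] 0 0 0 1 0 0) => //; rewrite ?big_nil //; ring.
- by exists 0; apply: (KI [::] 0 0 0 0 1 0) => //; rewrite ?big_nil //; ring.
- by exists lm; apply: (KI [::] 0 0 1 0 0 0) => //; rewrite ?big_nil //; ring.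
- move=> d [s [m0 [m1 [s1 [s2 [t1 [t2 [hs [m00 m10 s10 s20 [t10 t20]]]]]]]]]].
  move=> E1 E2 [E3 ->]; rewrite leNgt; apply/negP => neg.
  pose al (i : 'I_(size s)) := nth (i0, 0) s i.
  have als (f : A -> R) : \sum_(e <- s) e.2 * f e.1
      = \sum_i (al i).2 * f (al i).1.
    by rewrite (big_nth (i0, 0)) big_mkord.
  have als1 : \sum_(e <- s) e.2 = \sum_i (al i).2.
    by rewrite (big_nth (i0, 0)) big_mkord.
  have w0 i : 0 <= (al i).2 by have /all_nthP := hs; apply.
  set S := \sum_(e <- s) e.2 in als1 E3.
  have S0 : 0 <= S by rewrite als1 sumr_ge0.
  (* With total weight zero both mu's vanish and the cost comes from the slacks alone, so it is
     nonnegative. Otherwise dividing by [S] gives total weight one. *)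
  have [Sz|Sn] := eqVneq S 0.
    have m10' : m1 = 0 by move: E3 m00 m10; rewrite Sz; clear; lra.
    move: neg; rewrite m10' mul0r addr0 als big1 ?add0r; last first.
      move=> i _; suff -> : (al i).2 = 0 by rewrite mul0r.
      apply/eqP; move/eqP: (esym als1); rewrite Sz psumr_eq0 // => /allP /(_ i).
      by rewrite mem_index_enum => /(_ isT).
    by rewrite ltNge addr_ge0 // mulr_ge0.
  have Sp : 0 < S by rewrite lt0r Sn S0.
  have Si : 0 <= S^-1 by rewrite invr_ge0.
  apply: (@no_dual R (size s) (u \o (fun i => (al i).1)) (v \o (fun i => (al i).1))
    (h \o (fun i => (al i).1)) a b lm lk t (fun i => S^-1 * (al i).2)
    (S^-1 * m0) (S^-1 * m1) (S^-1 * s1) (S^-1 * s2) (S^-1 * t1) (S^-1 * t2)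
    a2 b2 lm0 lk0).
    exact: feasible_comp.
  have sc (f : A -> R) : \sum_i S^-1 * (al i).2 * f (al i).1
       = S^-1 * \sum_(e <- s) e.2 * f e.1.
    by rewrite als mulr_sumr; apply: eq_bigr => i _; rewrite mulrA.
  split; rewrite ?mulr_ge0 //.
  + by move=> i; rewrite mulr_ge0.
  + by rewrite -mulr_sumr -als1 mulVf.
  + have -> : m0 = S - m1 by move: E3; clear; lra.
    by rewrite -mulrDr subrK mulVf.
  + rewrite sc; have -> : \sum_(e <- s) e.2 * u e.1 =
      m0 * a + m1 / 2 - s1 + t1 by move: E1; clear; lra.
    by ring.
  + rewrite sc; have -> : \sum_(e <- s) e.2 * v e.1 =
      m0 * b + m1 / 2 - s2 + t2 by move: E2; clear; lra.
    by ring.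
  + rewrite sc.
    have -> : S^-1 * (\sum_(e <- s) e.2 * h e.1) + S^-1 * m1 * t
       + lm * (S^-1 * s1) + lk * (S^-1 * s2) = S^-1 *
       (\sum_(e <- s) e.2 * h e.1 + m1 * t + s1 * lm + s2 * lk) by ring.
    by rewrite pmulr_rlt0 ?invr_gt0.
exists X, Y.
have p1 : 0 <= 1 * X + 0 * Y + 0 * Z + 0.
  apply: HK; apply: (KI [::] 0 0 0 0 1 0) => //; rewrite ?big_nil //; ring.
have p2 : 0 <= -1 * X + 0 * Y + 0 * Z + lm.
  apply: HK; apply: (KI [::] 0 0 1 0 0 0) => //; rewrite ?big_nil //; ring.
have p3 : 0 <= 0 * X + 1 * Y + 0 * Z + 0.
  apply: HK; apply: (KI [::] 0 0 0 0 0 1) => //; rewrite ?big_nil //; ring.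
have p4 : 0 <= 0 * X + -1 * Y + 0 * Z + lk.
  apply: HK; apply: (KI [::] 0 0 0 1 0 0) => //; rewrite ?big_nil //; ring.
have p5 : 0 <= a * X + b * Y + -1 * Z + 0.
  apply: HK; apply: (KI [::] 1 0 0 0 0 0) => //; rewrite ?big_nil //; ring.
have p6 : 0 <= 2^-1 * X + 2^-1 * Y + -1 * Z + t.
  apply: HK; apply: (KI [::] 0 1 0 0 0 0) => //; rewrite ?big_nil //; ring.
split.
- by move: p1 p2; clear; lra.
- by move: p3 p4; clear; lra.
move=> i; have p7 : 0 <= - u i * X + - v i * Y + 1 * Z + h i.
  apply: HK; apply: (KI [:: (i, 1)] 0 0 0 0 0 0) => //;
    rewrite ?big_seq1 /= ?ler01 //; ring.
have : Z <= Num.min (a * X + b * Y) (t + X / 2 + Y / 2).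
  by rewrite le_min; apply/andP; split; move: p5 p6; clear; lra.
by move: p7; clear; lra.
Qed.

(** * Averages over signs *)

Definition avg (R : realFieldType) (W : finType) (f : W -> R) : R :=
  #|W|%:R^-1 * \sum_w f w.

Section Average.
Variables (R : realFieldType) (W : finType).
Implicit Types f g : W -> R.

Lemma avg_ext f g : f =1 g -> avg f = avg g.
Proof. by move=> fg; congr (_ * _); apply: eq_bigr. Qed.

Lemma avgD f g : avg (fun w => f w + g w) = avg f + avg g.
Proof. by rewrite /avg big_split mulrDr. Qed.

Lemma avgZ (c : R) f : avg (fun w => c * f w) = c * avg f.
Proof. by rewrite /avg -mulr_sumr mulrCA. Qed.

Lemma avg_le f g : (forall w, f w <= g w) -> avg f <= avg g.
Proof.
by move=> fg; rewrite ler_wpM2l ?invr_ge0 ?ler0n // ler_sum.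
Qed.

Lemma avg_sum (J : Type) (s : seq J) (F : J -> W -> R) :
  avg (fun w => \sum_(j <- s) F j w) = \sum_(j <- s) avg (F j).
Proof. by rewrite /avg exchange_big mulr_sumr. Qed.

Lemma avg_const (c : R) : W -> avg (fun _ : W => c) = c.
Proof.
move=> w.
have W0 : #|W|%:R != 0 :> R.
  by rewrite pnatr_eq0 -lt0n; apply/card_gt0P; exists w.
by apply: (mulfI W0); rewrite mulVKf // sumr_const mulr_natl.
Qed.

Lemma avg_reindex (s : W -> W) f : involutive s -> avg (f \o s) = avg f.
Proof.
move=> sK; congr (_ * _); rewrite [RHS](reindex_onto s s) //=.
by apply: eq_bigl => w; rewrite sK eqxx.
Qed.

Lemma avg_lt (w0 : W) f g : (forall w, f w < g w) -> avg f < avg g.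
Proof.
move=> fg; rewrite ltr_pM2l; last first.
  by rewrite invr_gt0 ltr0n; apply/card_gt0P; exists w0.
by apply: ltr_sum => //; apply/hasP; exists w0; rewrite ?mem_index_enum.
Qed.

End Average.

Lemma avg_pair (R : realFieldType) (W W' : finType) (f : W * W' -> R) :
  avg f = avg (fun w => avg (fun w' => f (w, w'))).
Proof.
rewrite /avg card_prod natrM invfM -mulrA mulr_sumr.
rewrite (eq_bigr (fun p => #|W'|%:R^-1 * f (p.1, p.2))); last by case.
rewrite -(pair_big xpredT xpredT (fun w w' => #|W'|%:R^-1 * f (w, w'))) /=.
by congr (_ * _); apply: eq_bigr => w _; rewrite mulr_sumr.
Qed.

Lemma avg_exch (R : realFieldType) (W W' : finType) (f : W -> W' -> R) :
  avg (fun w => avg (f w)) = avg (fun w' => avg (f ^~ w')).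
Proof.
rewrite /avg -!mulr_sumr mulrCA; congr (_ * (_ * _)); exact: exchange_big.
Qed.

Notation signs T := {ffun T -> bool}.

Definition sg (R : pzRingType) (b : bool) : R := (-1) ^+ b.

Lemma sgN (R : pzRingType) b : sg R (~~ b) = - sg R b.
Proof. by rewrite /sg signrN. Qed.

Lemma sg2 (R : pzRingType) b : sg R b * sg R b = 1.
Proof. by case: b; rewrite /sg ?mulrNN mulr1. Qed.

Definition dot (R : pzRingType) (T : finType) (w : signs T) (z : T -> R) : R :=
  \sum_i sg R (w i) * z i.

Definition flip (T : finType) (i : T) (w : signs T) : signs T :=
  [ffun j => if j == i then ~~ w j else w j].

Definition nega (T : finType) (w : signs T) : signs T := [ffun j => ~~ w j].

Lemma flipK (T : finType) (i : T) : involutive (flip i).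
Proof. by move=> w; apply/ffunP => j; rewrite !ffunE; case: eqP; rewrite ?negbK. Qed.

Lemma negaK (T : finType) : involutive (@nega T).
Proof. by move=> w; apply/ffunP => j; rewrite !ffunE negbK. Qed.

Lemma dotN (R : pzRingType) (T : finType) (w : signs T) (z : T -> R) :
  dot (nega w) z = - dot w z.
Proof.
by rewrite /dot -sumrN; apply: eq_bigr => i _; rewrite ffunE sgN mulNr.
Qed.

Section Moments.
Variables (R : realFieldType) (T : finType) (z : T -> R).

(** Partial sums over a list of coordinates allow induction on the list, each w being paired with
    its flip at the new coordinate. *)
Let D (s : seq T) (w : signs T) := \sum_(i <- s) sg R (w i) * z i.

Let D_flip i s w : i \notin s -> D s (flip i w) = D s w.
Proof.
move=> his; apply: eq_big_seq => j js; rewrite ffunE.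
by case: eqP => // ji; rewrite ji in js; rewrite js in his.
Qed.

Let avg_flip (i : T) (f : signs T -> R) :
  avg f = avg (fun w => 2^-1 * (f w + f (flip i w))).
Proof.
rewrite avgZ avgD -/(f \o flip i) (avg_reindex _ (@flipK T i)).
by set a := avg f; lra.
Qed.

Let avg_D2 s : uniq s -> avg (fun w => D s w ^+ 2) = \sum_(i <- s) z i ^+ 2.
Proof.
elim: s => [_|i s IH /= /andP[his us]].
  rewrite big_nil (@avg_ext _ _ _ (fun=> 0)); last first.
    by move=> w; rewrite /D big_nil expr0n.
  by rewrite avg_const //; exact: [ffun=> true].
rewrite big_cons -IH // (avg_flip i).
rewrite (@avg_ext _ _ _ (fun w => z i ^+ 2 + D s w ^+ 2)); last first.
  move=> w; rewrite /D !big_cons -!/(D _ _) D_flip // ffunE eqxx sgN.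
  have := sg2 R (w i); set e := sg R _ => e2.
  have -> : z i ^+ 2 = e * e * z i ^+ 2 by rewrite e2 mul1r.
  by field.
by rewrite avgD avg_const //; exact: [ffun=> true].
Qed.

(** Averaging over the sign at i leaves z^4 + 6 z^2 D^2 + D^4. With V the second moment of D this is
    at most z^4 + 6 z^2 V + 3 V^2 <= 3 (z^2 + V)^2, so the constant 3 survives the induction. *)
Let avg_D4 s : uniq s ->
  avg (fun w => D s w ^+ 4) <= 3 * (\sum_(i <- s) z i ^+ 2) ^+ 2.
Proof.
elim: s => [_|i s IH /= /andP[his us]].
  rewrite big_nil (@avg_ext _ _ _ (fun=> 0)); last first.
    by move=> w; rewrite /D big_nil expr0n.
  rewrite avg_const; last exact: [ffun=> true].
  by rewrite expr0n mulr0.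
rewrite big_cons (avg_flip i).
rewrite (@avg_ext _ _ _
    (fun w => z i ^+ 4 + ((6 * z i ^+ 2) * D s w ^+ 2 + D s w ^+ 4))); last first.
  move=> w; rewrite /D !big_cons -!/(D _ _) D_flip // ffunE eqxx sgN.
  have := sg2 R (w i); set e := sg R _ => e2.
  have -> : z i ^+ 2 = e * e * z i ^+ 2 by rewrite e2 mul1r.
  have -> : z i ^+ 4 = (e * e) * (e * e) * z i ^+ 4 by rewrite e2 !mul1r.
  by field.
rewrite avgD avgD avgZ avg_const; last exact: [ffun=> true].
rewrite avg_D2 //; have := IH us.
set V := \sum_(_ <- _) _; set M := avg _ => MV.
have := sqr_ge0 (z i ^+ 2).
by rewrite -!exprM /=; move: MV; set y := z i; nra.
Qed.

Lemma avg_dot2 : avg (fun w : signs T => dot w z ^+ 2) = \sum_i z i ^+ 2.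
Proof. by rewrite -[RHS]avg_D2 // index_enum_uniq. Qed.

Lemma avg_dot4 :
  avg (fun w : signs T => dot w z ^+ 4) <= 3 * (\sum_i z i ^+ 2) ^+ 2.
Proof. by apply: avg_D4; rewrite index_enum_uniq. Qed.

Lemma avg_coord (i : T) (f : bool -> R) :
  avg (fun w : signs T => f (w i)) = 2^-1 * (f true + f false).
Proof.
rewrite (avg_flip i) (@avg_ext _ _ _ (fun=> 2^-1 * (f true + f false))).
  by rewrite avg_const //; exact: [ffun=> true].
by move=> w; rewrite ffunE eqxx; case: (w i); rewrite //= addrC.
Qed.

End Moments.

(* |x| >= x^2 - 4/27 x^4, with equality at |x| = 3/2; compare second and fourth
   moments after scaling. *)
Lemma khintchine_lower (R : realType) (T : finType) (z : T -> R) :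
  5 / 9 * Num.sqrt (\sum_i z i ^+ 2) <= avg (fun w : signs T => `|dot w z|).
Proof.
set V := \sum_i z i ^+ 2.
have V0 : 0 <= V by rewrite sumr_ge0 // => i _; exact: sqr_ge0.
have [Vz|Vn] := eqVneq V 0.
  rewrite Vz sqrtr0 mulr0 -(@avg_const R (signs T) 0); last exact: [ffun=> true].
  by apply: avg_le => w.
set s := Num.sqrt V.
have s0 : 0 < s by rewrite sqrtr_gt0 lt0r Vn.
have sV : s ^+ 2 = V by rewrite sqr_sqrtr.
(* The pointwise inequality at scale s. Its average is at least s - (4/27) 3 s = (5/9) s, whence the
   constant 5/9. *)
pose f (w : signs T) := s^-1 * dot w z ^+ 2 + - (4 / 27 * s^-1 ^+ 3) * dot w z ^+ 4.
apply: (@le_trans _ _ (avg f)).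
  rewrite /f avgD !avgZ avg_dot2 -/V.
  have := avg_dot4 z; rewrite -/V -sV; set M := avg _ => hM.
  have -> : s^-1 * s ^+ 2 = s by rewrite expr2 mulKf // gt_eqF.
  have c0 : 0 <= 4 / 27 * s^-1 ^+ 3 by apply: mulr_ge0; [lra|rewrite exprn_ge0 // invr_ge0 ltW].
  have := ler_wpM2l c0 hM.
  have -> : 4 / 27 * s^-1 ^+ 3 * (3 * (s ^+ 2) ^+ 2) = 4 / 9 * s.
    by field; rewrite gt_eqF.
  by lra.
apply: avg_le => w; rewrite /f; set x := dot w z.
set y := `|x| / s.
have y0 : 0 <= y by rewrite divr_ge0 // ltW.
have xE : `|x| = y * s by rewrite divfK // gt_eqF.
have x2 : x ^+ 2 = (y * s) ^+ 2 by rewrite -xE real_normK ?num_real.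
have -> : x ^+ 4 = (y * s) ^+ 4 by rewrite (exprM x 2 2) x2 -exprM.
rewrite x2 xE -subr_ge0.
have -> : y * s - (s^-1 * (y * s) ^+ 2 + - (4 / 27 * s^-1 ^+ 3) * (y * s) ^+ 4)
  = s * y * ((1 - 2 / 3 * y) ^+ 2 * (1 + 3^-1 * y)).
  by field; rewrite gt_eqF.
by apply: mulr_ge0; apply: mulr_ge0; rewrite ?sqr_ge0 ?(ltW s0) //; lra.
Qed.

(** * Symmetrisation and contraction *)

Definition maxf (R : realFieldType) (I : finType) (i0 : I) (f : I -> R) : R :=
  f [arg max_(i > i0) f i]%O.

Lemma maxf_ge (R : realFieldType) (I : finType) (i0 : I) (f : I -> R) i :
  f i <= maxf i0 f.
Proof. by rewrite /maxf; case: arg_maxP => // j _; apply. Qed.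

Lemma maxf_le (R : realFieldType) (I : finType) (i0 : I) (f : I -> R) c :
  (forall i, f i <= c) -> maxf i0 f <= c.
Proof. exact. Qed.

Lemma maxf_ext (R : realFieldType) (I : finType) (i0 : I) (f g : I -> R) :
  f =1 g -> maxf i0 f = maxf i0 g.
Proof. by move=> /funext ->. Qed.

(** For i and j attaining the two maxima on the left, the sign of a i decides which of them is used
    in g + a and which in g - a on the right. *)
Lemma max_contract (R : realFieldType) (I : finType) (i0 : I) (g a : I -> R) :
  maxf i0 (fun i => g i + `|a i|) + maxf i0 (fun i => g i - `|a i|) <=
  maxf i0 (fun i => g i + a i) + maxf i0 (fun i => g i - a i).
Proof.
set p := fun i => g i + a i; set q := fun i => g i - a i.
rewrite -lerBrDr; apply: maxf_le => i; rewrite lerBrDr -lerBrDl.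
apply: maxf_le => j; rewrite lerBrDl.
have pi := maxf_ge i0 p i; have pj := maxf_ge i0 p j.
have qi := maxf_ge i0 q i; have qj := maxf_ge i0 q j.
move: pi pj qi qj; rewrite /p /q.
case: (ger0P (a i)) => ?; case: (ger0P (a j)) => ? ? ? ? ?;
  by have [?|?] := leP (a i) (a j); lra.
Qed.

Section Symmetrisation.
Variables (R : realType) (T I : finType) (i0 : I) (z : I -> T -> R).
Notation c := (fun i => avg (fun w : signs T => `|dot w (z i)|)).
Let w0 : signs T := [ffun=> true].

(* Replace c i by an average over an independent w', and split
   g = g/2 + g/2 between w and w'. *)
Lemma sym_step (g : I -> R) :
  avg (fun w : signs T => maxf i0 (fun i => g i + (c i - `|dot w (z i)|))) <=
  avg (fun w : signs T => maxf i0 (fun i => g i + 2 * dot w (z i))).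
Proof.
pose P w := maxf i0 (fun i => g i + 2 * `|dot w (z i)|).
pose Q w := maxf i0 (fun i => g i - 2 * `|dot w (z i)|).
apply: (@le_trans _ _ (avg (fun w => 2^-1 * Q w + avg (fun w' => 2^-1 * P w')))).
  apply: avg_le => w; apply: maxf_le => i.
  rewrite -(@avg_const _ (signs T) (2^-1 * Q w)) // -avgD.
  rewrite -(@avg_const _ (signs T) (g i)) // -[X in _ + (_ + X)]mulN1r.
  rewrite -(@avg_const _ (signs T) (-1 * _)) // -!avgD.
  apply: avg_le => w'.
  have := maxf_ge i0 (fun i => g i + 2 * `|dot w' (z i)|) i.
  have := maxf_ge i0 (fun i => g i - 2 * `|dot w (z i)|) i.
  rewrite -/(P w') -/(Q w) /=; lra.
rewrite avgD avg_const // -avgD.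
pose P' w := maxf i0 (fun i => g i + 2 * dot w (z i)).
pose Q' w := maxf i0 (fun i => g i - 2 * dot w (z i)).
apply: (@le_trans _ _ (avg (fun w => 2^-1 * Q' w + 2^-1 * P' w))).
  apply: avg_le => w /=; rewrite -!mulrDr ler_wpM2l ?invr_ge0 //.
  have -> : P w = maxf i0 (fun i => g i + `|2 * dot w (z i)|).
    by apply: maxf_ext => i; rewrite normrM ger0_norm.
  have -> : Q w = maxf i0 (fun i => g i - `|2 * dot w (z i)|).
    by apply: maxf_ext => i; rewrite normrM ger0_norm.
  by rewrite addrC [leRHS]addrC max_contract.
rewrite avgD !avgZ.
have -> : avg Q' = avg P'.
  rewrite -(avg_reindex P' (@negaK T)); apply: avg_ext => w.
  by apply: maxf_ext => i; rewrite /= dotN mulrN.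
by rewrite -mulrDr -[X in _ <= X]mul1r; set a := avg _; lra.
Qed.

(** An n-tuple of independent sign vectors, encoded as an iterated product so that [avg_pair] splits
    off one vector at a time. *)
Fixpoint rows (n : nat) : finType :=
  if n is n'.+1 then (signs T * rows n')%type : finType else unit.

Fixpoint rseq n : rows n -> seq (signs T) :=
  if n is n'.+1 then fun G => G.1 :: @rseq n' G.2 else fun=> [::].

Lemma size_rseq n (G : rows n) : size (rseq G) = n.
Proof. by elim: n G => //= n IH [w G]; rewrite IH. Qed.

(** [sym_step] is applied to one vector at a time, the terms of the other vectors being part of its
    arbitrary function [g]. *)
Lemma sym_iter n (g : I -> R) :
  avg (fun G : rows n => maxf i0 (fun i =>
    g i + \sum_(w <- rseq G) (c i - `|dot w (z i)|))) <=
  avg (fun G : rows n => maxf i0 (fun i =>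
    g i + \sum_(w <- rseq G) 2 * dot w (z i))).
Proof.
elim: n g => [|n IH] g.
  by apply: avg_le => G; apply: maxf_le => i; rewrite big_nil;
    have := maxf_ge i0 (fun i => g i + \sum_(w <- rseq G) 2 * dot w (z i)) i;
    rewrite big_nil.
rewrite !avg_pair avg_exch.
apply: (@le_trans _ _ (avg (fun G : rows n => avg (fun w : signs T =>
  maxf i0 (fun i => g i + \sum_(w <- rseq G) (c i - `|dot w (z i)|)
     + 2 * dot w (z i)))))).
  apply: avg_le => G.
  apply: le_trans (sym_step _); apply: avg_le => w.
  rewrite le_eqVlt; apply/orP; left; apply/eqP; apply: maxf_ext => i.
  by rewrite /= big_cons; ring.
rewrite avg_exch; apply: avg_le => w.
have := IH (fun i => g i + 2 * dot w (z i)).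
congr (_ <= _); apply: avg_ext => G; apply: maxf_ext => i.
  by ring.
by rewrite /= big_cons; ring.
Qed.

End Symmetrisation.

(** * Even moments of column sums *)

Lemma avg_exp_col (R : realType) (T : finType) (n : nat) (j : T) (l : R) :
  avg (fun G : rows T n => expR (l * \sum_(w <- rseq G) sg R (w j))) =
  (2^-1 * (expR (- l) + expR l)) ^+ n.
Proof.
elim: n => [|n IH].
  rewrite expr0 -[RHS](@avg_const R (rows T 0) 1 tt).
  by apply: avg_ext => G; rewrite big_nil mulr0 expR0.
rewrite avg_pair exprS -IH.
have -> : 2^-1 * (expR (- l) + expR l) =
    avg (fun w : signs T => expR (l * sg R (w j))).
  by rewrite (@avg_coord _ _ j (fun b => expR (l * sg R b))) /sg expr1 mulrN !mulr1.
rewrite mulrC -avgZ; apply: avg_ext => w; rewrite /= mulrC -avgZ.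
by apply: avg_ext => G; rewrite big_cons mulrDr expRD.
Qed.

(** With l = 1/(2 sqrt n) one has l^2 <= 1/4, so cosh l <= 1/(1 - l^2) <= 1 + (4/3) l^2 <= exp
    ((4/3) l^2), and n (4/3) l^2 = 1/3. *)
Lemma cosh_le (R : realType) (n : nat) : (0 < n)%N ->
  (2^-1 * (expR (- (2 * Num.sqrt n%:R)^-1) + expR (2 * Num.sqrt n%:R)^-1)) ^+ n
    <= expR (3^-1 : R).
Proof.
move=> n0; set s := Num.sqrt n%:R; set l := (2 * s)^-1.
have n1 : 1 <= n%:R :> R by rewrite ler1n.
have s2 : s ^+ 2 = n%:R by rewrite sqr_sqrtr // ler0n.
have s1 : 1 <= s by rewrite -[leLHS]sqrtr1 ler_wsqrtr.
have l2 : l ^+ 2 = (4 * n%:R)^-1.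
  by rewrite /l exprVn exprMn s2 -natrX.
have l0 : 0 < l by rewrite invr_gt0; lra.
have lh : l <= 2^-1 by rewrite lef_pV2 ?posrE; lra.
have e1 : expR l <= (1 - l)^-1.
  rewrite -[expR l]invrK lef_pV2 ?posrE ?invr_gt0 ?expR_gt0 //; last lra.
  by rewrite -expRN; have := expR_ge1Dx (- l).
have e2 : expR (- l) <= (1 + l)^-1.
  rewrite expRN lef_pV2 ?posrE ?expR_gt0 //; last lra.
  exact: expR_ge1Dx.
have -> : expR (3^-1 : R) = expR ((4 / 3) * l ^+ 2) ^+ n.
  rewrite -expRM_natl l2; congr expR; field; lra.
apply: lerXn2r; rewrite ?nnegrE ?expR_ge0 //.
apply: (@le_trans _ _ (1 - l ^+ 2)^-1).
  have -> : (1 - l ^+ 2)^-1 = 2^-1 * ((1 + l)^-1 + (1 - l)^-1).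
    by field; apply/and3P; split; apply/eqP; nra.
  by rewrite ler_wpM2l ?invr_ge0 // lerD.
have lq : l ^+ 2 <= 4^-1 by nra.
apply: (@le_trans _ _ (1 + 4 / 3 * l ^+ 2)); last exact: expR_ge1Dx.
have x0 := sqr_ge0 l; set x := l ^+ 2 in lq x0 *.
by rewrite -div1r ler_pdivrMr; nra.
Qed.

Definition colsum (R : pzRingType) (T : finType) (n : nat) (G : rows T n)
  (j : T) : R := \sum_(w <- rseq G) sg R (w j).

(** The constant in [avg_colsum]: (2s)^s comes from y^s <= (2s)^s exp (y/2), and 2 exp (1/3) from
    the exponential moments at plus and minus 1/(2 sqrt n). *)
Definition mom_const (R : realType) (s : nat) : R :=
  (2 * s%:R) ^+ s * (2 * expR 3^-1).

Lemma expn_le_expR (R : realType) (s : nat) (y : R) : (0 < s)%N -> 0 <= y ->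
  y ^+ s <= (2 * s%:R) ^+ s * expR (y / 2).
Proof.
move=> s0 y0; have sp : 0 < s%:R :> R by rewrite ltr0n.
have -> : expR (y / 2) = expR (y / (2 * s%:R)) ^+ s.
  by rewrite -expRM_natl; congr expR; field; rewrite gt_eqF.
rewrite -exprMn; apply: lerXn2r; rewrite ?nnegrE ?mulr_ge0 ?expR_ge0 //.
rewrite mulrC -ler_pdivrMr ?mulr_gt0 //.
by apply: le_trans (expR_ge1Dx _); rewrite lerDr.
Qed.

Lemma avg_colsum (R : realType) (T : finType) (n s : nat) (j : T) :
  (0 < n)%N -> (0 < s)%N -> ~~ odd s ->
  avg (fun G : rows T n => (colsum R G j) ^+ s) <=
  mom_const R s * Num.sqrt n%:R ^+ s.
Proof.
move=> n0 s0 es; set rn := Num.sqrt n%:R.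
have rn0 : 0 < rn by rewrite sqrtr_gt0 ltr0n.
pose l := (2 * rn)^-1.
have lp : (2^-1 * (expR (- l) + expR l)) ^+ n <= expR (3^-1 : R) by exact: cosh_le.
apply: (@le_trans _ _ (avg (fun G : rows T n => (rn ^+ s * (2 * s%:R) ^+ s) *
   (expR (l * colsum R G j) + expR (- l * colsum R G j))))); last first.
  rewrite avgZ avgD !avg_exp_col opprK [X in _ + (_ * X) ^+ _]addrC.
  have c0 : 0 <= rn ^+ s * (2 * s%:R) ^+ s.
    by rewrite mulr_ge0 // exprn_ge0 ?mulr_ge0 // ltW.
  have := ler_wpM2l c0 lp; rewrite /mom_const.
  set x := _ ^+ n; set A := rn ^+ s; set B := _ ^+ s; set E := expR _.
  by lra.
apply: avg_le => G; set S := colsum R G j.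
have -> : S ^+ s = rn ^+ s * (`|S| / rn) ^+ s.
  rewrite -exprMn mulrC divfK ?gt_eqF //.
  by rewrite -normrX ger0_norm // exprn_even_ge0.
rewrite -mulrA ler_wpM2l ?exprn_ge0 ?(ltW rn0) //.
apply: le_trans (expn_le_expR s0 _) _; first by rewrite divr_ge0 // ltW.
rewrite ler_wpM2l ?exprn_ge0 ?mulr_ge0 //.
have -> : `|S| / rn / 2 = l * `|S| by rewrite /l; field; rewrite gt_eqF.
by case: (ger0P S) => _; rewrite ?mulrN -?mulNr ?lerDl ?lerDr ?expR_ge0.
Qed.

(** If |S| <= K |r| the first term on the right suffices, otherwise |r| < |S|/K and the second does.
    As p is odd, p + 1 is even and both terms are nonnegative. *)
Lemma young_split (R : realType) (p : nat) (K S r : R) : 0 < K -> odd p ->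
  S * r ^+ p <= K * r ^+ p.+1 + K * (S / K) ^+ p.+1.
Proof.
move=> K0 op.
have en x : x ^+ p.+1 = `|x| ^+ p.+1 :> R.
  by rewrite -normrX ger0_norm // exprn_even_ge0 //= op.
rewrite [r ^+ p.+1]en [(S / K) ^+ p.+1]en normrM normfV (gtr0_norm K0).
apply: (@le_trans _ _ (`|S| * `|r| ^+ p)); first by rewrite -normrX -normrM ler_norm.
have [h|h] := leP `|S| (K * `|r|).
  apply: ler_wpDr; first by rewrite mulr_ge0 ?(ltW K0) // exprn_ge0 // divr_ge0 // ltW.
  by rewrite exprS mulrA ler_wpM2r // exprn_ge0.
apply: ler_wpDl; first by rewrite mulr_ge0 ?(ltW K0) // exprn_ge0.
have h' : `|r| <= `|S| / K by rewrite ler_pdivlMr // mulrC ltW.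
rewrite exprS mulrA [K * _]mulrC divfK ?gt_eqF //.
by rewrite ler_wpM2l // lerXn2r // nnegrE divr_ge0 // ltW.
Qed.

Lemma sum_dot_rseq (R : comPzRingType) (T : finType) (n : nat) (G : rows T n)
    (z : T -> R) :
  \sum_(w <- rseq G) dot w z = \sum_j colsum R G j * z j.
Proof.
rewrite /dot exchange_big /=; apply: eq_bigr => j _.
by rewrite /colsum mulr_suml.
Qed.

(* If every G had a bad r, these finitely many r, indexed by G, would contradict
   the symmetrised inequality sym_iter. *)
Lemma low_mstar (R : realType) (T : finType) (n p : nat) (kap : R) :
  (0 < n)%N -> (0 < #|T|)%N -> odd p -> 0 < kap -> kap ^+ p.+1 = #|T|%:R ->
  exists G : rows T n, forall r : T -> R, \sum_j r j ^+ p.+1 <= 1 ->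
    (forall w, w \in rseq G -> dot w (fun j => r j ^+ p) = 0) ->
    Num.sqrt (\sum_j (r j ^+ p) ^+ 2) <=
      18 / 5 * (1 + mom_const R p.+1) * kap / Num.sqrt n%:R.
Proof.
move=> n0 T0 op k0 kE; set rn := Num.sqrt n%:R.
have rn0 : 0 < rn by rewrite sqrtr_gt0 ltr0n.
have rn2 : rn ^+ 2 = n%:R by rewrite sqr_sqrtr // ler0n.
set rho := _ / rn; set C := mom_const R p.+1 in rho *.
apply: contrapT => /forallNP H.
have {H} : forall G : rows T n, exists r : T -> R, [/\ \sum_j r j ^+ p.+1 <= 1,
    forall w, w \in rseq G -> dot w (fun j => r j ^+ p) = 0 &
    rho < Num.sqrt (\sum_j (r j ^+ p) ^+ 2)].
  move=> G; have /existsNP[r] := H G.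
  rewrite not_implyE => -[r1]; rewrite not_implyE => -[r2 /negP].
  by rewrite -ltNge; exists r.
move=> /choice[rr Hr].
pose G0 : rows T n := (fix f n := match n return rows T n with
   0 => tt | n'.+1 => ([ffun=> true], f n') end) n.
pose z (G : rows T n) j := rr G j ^+ p.
have := sym_iter G0 z n (fun=> 0).
apply/negP; rewrite -ltNge.
(* This K balances the two terms of [young_split]: the first sums to at most K, and as kap^(p+1) is
   the cardinality of T, the moment bound makes the average of the second at most C K. *)
pose K := kap * rn.
have K0 : 0 < K by rewrite mulr_gt0.
apply: (@le_lt_trans _ _ (2 * (1 + C) * K)).
  apply: (@le_trans _ _ (avg (fun G : rows T n =>
     2 * K + 2 * K * (\sum_j K^-1 ^+ p.+1 * colsum R G j ^+ p.+1)))).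
    apply: avg_le => G; apply: maxf_le => i.
    rewrite add0r -mulr_sumr sum_dot_rseq.
    rewrite -mulrA -mulrDr ler_wpM2l //.
    apply: (@le_trans _ _ (\sum_j (K * rr i j ^+ p.+1 +
        K * (colsum R G j / K) ^+ p.+1))).
      by apply: ler_sum => j _; exact: young_split.
    rewrite big_split /= -!mulr_sumr lerD //.
      by rewrite -[leRHS]mulr1 ler_wpM2l ?(ltW K0) //; case: (Hr i).
    rewrite ler_wpM2l ?(ltW K0) // mulr_sumr ler_sum // => j _.
    by rewrite exprMn mulrC.
  rewrite avgD avg_const; last exact: G0.
  rewrite avgZ avg_sum.
  have : \sum_j avg (fun G : rows T n => K^-1 ^+ p.+1 * colsum R G j ^+ p.+1) <= C.
    apply: (@le_trans _ _ (\sum_(j : T) K^-1 ^+ p.+1 * (C * rn ^+ p.+1))).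
      apply: ler_sum => j _; rewrite avgZ ler_wpM2l //.
        by rewrite exprn_ge0 // invr_ge0 ltW.
      by apply: avg_colsum => //=; rewrite negbK.
    rewrite sumr_const -mulr_natl -kE /K exprVn exprMn invfM.
    rewrite le_eqVlt; apply/orP; left; apply/eqP.
    by field; rewrite !expf_neq0 // gt_eqF.
  move=> hC; have : 2 * K * \sum_j avg (fun G : rows T n =>
     K^-1 ^+ p.+1 * colsum R G j ^+ p.+1) <= 2 * K * C.
    by rewrite ler_wpM2l // mulr_ge0 // ltW.
  by set x := 2 * K * \sum_j _; lra.
rewrite -(@avg_const R (rows T n) (2 * (1 + C) * K)); last exact: G0.
apply: (avg_lt G0) => G.
(* At the index G itself all rows of G annihilate the vector, so each of the n summands is a full
   average of |dot|. By Khintchine the total exceeds n (5/9) rho = 2 (1 + C) K; this is the origin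
   of the factor 18/5. *)
apply: lt_le_trans (maxf_ge G0 _ G); rewrite add0r.
rewrite big_seq (eq_bigr (fun=> avg (fun w : signs T => `|dot w (z G)|))); last first.
  by move=> w wG; case: (Hr G) => _ h _; rewrite h // normr0 subr0.
rewrite -big_seq big_const_seq count_predT size_rseq iter_addr_0 -[ltRHS]mulr_natl.
case: (Hr G) => _ _ h.
apply: (@lt_le_trans _ _ (n%:R * (5 / 9 * Num.sqrt (\sum_j z G j ^+ 2)))).
  apply: (@le_lt_trans _ _ (n%:R * (5 / 9 * rho))).
    rewrite /rho /K -rn2 le_eqVlt; apply/orP; left; apply/eqP.
    by field; rewrite gt_eqF.
  by rewrite ltr_pM2l ?ltr0n // ltr_pM2l //; lra.
by rewrite ler_wpM2l ?ler0n //; exact: khintchine_lower.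
Qed.

(** * Approximation of the Euclidean ball *)

Lemma power_dist_continuous (R : realType) (n N s : nat) (M : 'M[R]_(n, N))
    (x : 'rV[R]_N) :
  continuous (fun c : 'rV[R]_n => \sum_j (x 0 j - (c *m M) 0 j) ^+ s).
Proof.
apply: continuous_big => [|j _]; first exact: add_continuous.
move=> c; apply: (@continuous_comp _ _ _ (fun c : 'rV[R]_n => x 0 j - (c *m M) 0 j)
  (fun y => y ^+ s)); last exact: exprn_continuous.
apply: continuousB; first exact: cst_continuous.
rewrite (_ : (fun d : 'rV_n => (d *m M) 0 j) =
   fun d : 'rV_n => \sum_t d 0 t * M t j); last by apply/funext => d; rewrite mxE.
move: c; apply: continuous_big => [|t _ c]; first exact: add_continuous.
apply: continuousM; [exact: coord_continuous|exact: cst_continuous].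
Qed.

(** Coefficients c with distance at most that of 0 may be unbounded if M has a kernel. Replacing c
    by c M P, with P a pseudo-inverse, keeps c M unchanged and moves c into a fixed compact box. *)
Lemma power_dist_min (R : realType) (n N s : nat) (M : 'M[R]_(n, N))
    (x : 'rV[R]_N) : (0 < s)%N -> ~~ odd s ->
  exists c : 'rV[R]_n, forall c' : 'rV[R]_n,
    \sum_j (x 0 j - (c *m M) 0 j) ^+ s <= \sum_j (x 0 j - (c' *m M) 0 j) ^+ s.
Proof.
move=> s0 es; pose f (c : 'rV[R]_n) := \sum_j (x 0 j - (c *m M) 0 j) ^+ s.
have t0 (c : 'rV[R]_n) j : 0 <= (x 0 j - (c *m M) 0 j) ^+ s.
  exact: exprn_even_ge0.
have f0 c : 0 <= f c by apply: sumr_ge0.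
pose P := pinvmx M.
pose Bd := \sum_j `|x 0 j| + 1 + f 0.
pose B := \sum_t \sum_j Bd * `|P j t|.
have Bd0 : 0 <= Bd by rewrite !addr_ge0 // sumr_ge0.
have big (y : 'rV[R]_n) j : f y <= f 0 -> `|(y *m M) 0 j| <= Bd.
  move=> fy; rewrite leNgt; apply/negP => yB.
  have h1 : 1 + f 0 < `|x 0 j - (y *m M) 0 j|.
    rewrite distrC; apply: lt_le_trans (lerB_dist _ _).
    rewrite ltrBrDr; apply: le_lt_trans yB.
    have xj : `|x 0 j| <= \sum_j `|x 0 j|.
      rewrite (bigD1 j) //= lerDl sumr_ge0 // => ? _; exact: normr_ge0.
    by rewrite /Bd; move: xj; clear; lra.
  have h2 : 1 + f 0 <= (x 0 j - (y *m M) 0 j) ^+ s.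
    rewrite -(ger0_norm (t0 y j)) normrX.
    apply: le_trans (ltW h1) _; rewrite -[leLHS]expr1.
    rewrite ler_weXn2l // (le_trans _ (ltW h1)) // lerDl.
    exact: f0.
  have : (x 0 j - (y *m M) 0 j) ^+ s <= f y.
    by rewrite /f (bigD1 j) //= lerDl sumr_ge0 // => ? _; exact: t0.
  by move: fy h2; lra.
have [|||c cB cmin] := @EVT_min_rV R n f
    [set v : 'rV[R]_n | forall i, `[- B, B]%classic (v ord0 i)]%classic.
- exists 0 => i /=; rewrite mxE in_itv /= oppr_le0.
  have -> : 0 <= B; last by [].
  by apply: sumr_ge0 => t _; apply: sumr_ge0 => j _; rewrite mulr_ge0.
- by apply: (@rV_compact R n (fun=> `[- B, B]%classic)) => i; exact: segment_compact.
- by apply: continuous_subspaceT; exact: power_dist_continuous.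
have redu (y : 'rV[R]_n) : f y <= f 0 -> exists2 y' : 'rV[R]_n,
    y' \in [set v : 'rV[R]_n | forall i, `[- B, B]%classic (v ord0 i)]%classic
    & f y' = f y.
  move=> fy; exists (y *m M *m P); last first.
    by rewrite /f /P mulmxKpV // submxMl.
  rewrite inE => t /=; rewrite in_itv /= -ler_norml mxE.
  apply: le_trans (ler_norm_sum _ _ _) _.
  rewrite /B (bigD1 t) //= -[leLHS]addr0 lerD //; last first.
    by apply: sumr_ge0 => i _; apply: sumr_ge0 => j _; rewrite mulr_ge0.
  by apply: ler_sum => j _; rewrite normrM ler_wpM2r // big.
exists c => c'; rewrite -/(f c) -/(f c').
have [y0 y0B y0E] := redu 0 (lexx _).
have [h|h] := leP (f c') (f 0).
  by have [y' y'B <-] := redu _ h; exact: cmin.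
by rewrite (le_trans _ (ltW h)) // -y0E cmin.
Qed.

(** First-order condition at the minimiser: moving c along the t-th coordinate makes the power sum a
    polynomial in the step, with derivative at 0 equal to -(p + 1) times the stated sum. *)
Lemma power_dist_perp (R : realType) (n N p : nat) (M : 'M[R]_(n, N))
    (x : 'rV[R]_N) : odd p ->
  exists c : 'rV[R]_n, forall t, \sum_j (x 0 j - (c *m M) 0 j) ^+ p * M t j = 0.
Proof.
move=> op; have [||c cmin] := @power_dist_min R n N p.+1 M x; rewrite //= ?op //.
exists c => t; set r := fun j => x 0 j - (c *m M) 0 j.
pose q : {poly R} := \sum_j ((r j)%:P - M t j *: 'X) ^+ p.+1.
have qE y : q.[y] = \sum_j (r j - y * M t j) ^+ p.+1.
  rewrite /q horner_sum; apply: eq_bigr => j _.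
  by rewrite !hornerE mulrC.
have dq : is_derive (0 : R) (1 : R) (horner q) 0.
  apply: (@derive1_at_min _ _ (-1) 1); rewrite ?in_itv /=.
  - by lra.
  - by move=> y _; exact: derivable_horner.
  - by lra.
  move=> y _; rewrite !qE.
  have -> : \sum_j (r j - 0 * M t j) ^+ p.+1 = \sum_j (x 0 j - (c *m M) 0 j) ^+ p.+1.
    by apply: eq_bigr => j _; rewrite mul0r subr0.
  apply: le_trans (cmin (c + y *: delta_mx 0 t)) _.
  rewrite le_eqVlt; apply/orP; left; apply/eqP; apply: eq_bigr => j _.
  rewrite /r mulmxDl -scalemxAl -rowE !mxE; congr (_ ^+ _); ring.
have : q^`().[0] = 0.
  by rewrite derivE derive1E; exact: derive_val.
rewrite /q raddf_sum horner_sum => H.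
have : - p.+1%:R * \sum_j r j ^+ p * M t j = 0.
  rewrite -[RHS]H mulr_sumr; apply: eq_bigr => j _.
  rewrite /= deriv_exp derivB derivC derivZ derivX sub0r hornerMn hornerM.
  rewrite horner_exp !hornerE /= ?mulr0 ?subr0 ?mulr1 -[RHS]mulr_natl.
  ring.
move/eqP; rewrite mulf_eq0 oppr_eq0 pnatr_eq0 /= => /eqP; exact.
Qed.

Lemma cauchy_schwarz (R : realType) (T : finType) (x y : T -> R) :
  \sum_i x i * y i <= Num.sqrt (\sum_i x i ^+ 2) * Num.sqrt (\sum_i y i ^+ 2).
Proof.
have sq0 (z : T -> R) : 0 <= \sum_i z i ^+ 2.
  by apply: sumr_ge0 => i _; exact: sqr_ge0.
have deg (z w : T -> R) : Num.sqrt (\sum_i z i ^+ 2) = 0 ->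
    \sum_i z i * w i = 0.
  move=> /eqP; rewrite sqrtr_eq0 => z0.
  have /eqP : \sum_i z i ^+ 2 = 0 by apply/eqP; rewrite eq_le z0 sq0.
  rewrite psumr_eq0; last by move=> i _; exact: sqr_ge0.
  move=> /allP zz; apply: big1 => i _.
  have := zz i (mem_index_enum i); rewrite /= sqrf_eq0 => /eqP ->.
  exact: mul0r.
set a := Num.sqrt _; set b := Num.sqrt _.
have [a0|an] := eqVneq a 0; first by rewrite deg // a0 mul0r.
have [b0|bn] := eqVneq b 0.
  by under eq_bigr do rewrite mulrC; rewrite deg // b0 mulr0.
have ap : 0 < a by rewrite lt0r an sqrtr_ge0.
have bp : 0 < b by rewrite lt0r bn sqrtr_ge0.
apply: (@le_trans _ _ (\sum_i (b / a / 2 * x i ^+ 2 + a / b / 2 * y i ^+ 2))).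
  apply: ler_sum => i _; rewrite -subr_ge0.
  have -> : b / a / 2 * x i ^+ 2 + a / b / 2 * y i ^+ 2 - x i * y i =
    (a * b)^-1 / 2 * (b * x i - a * y i) ^+ 2 by field; apply/andP.
  by rewrite mulr_ge0 ?sqr_ge0 // divr_ge0 // invr_ge0 mulr_ge0 // ltW.
rewrite big_split /= -!mulr_sumr -[\sum_i x i ^+ 2]sqr_sqrtr // -/a.
rewrite -[\sum_i y i ^+ 2]sqr_sqrtr // -/b le_eqVlt; apply/orP; left; apply/eqP.
by field; apply/andP.
Qed.

(** Duality: for the residual r of the best approximation by the rows of G, r^p is orthogonal to
    these rows, so the sum of r^(p+1) equals that of x r^p and is at most |x|_2 |r^p|_2.
    [low_mstar], applied to r divided by its norm d, bounds |r^p|_2 by rho d^p. *)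
Lemma width_euclid_power (R : realType) (n N p : nat) (kap : R) :
  (0 < n)%N -> (0 < N)%N -> odd p -> 0 < kap -> kap ^+ p.+1 = N%:R ->
  exists M : 'M[R]_(n, N), forall x : 'rV[R]_N, exists c : 'rV[R]_n,
    \sum_j (x 0 j - (c *m M) 0 j) ^+ p.+1 <=
      (18 / 5 * (1 + mom_const R p.+1) * kap / Num.sqrt n%:R
        * Num.sqrt (\sum_j x 0 j ^+ 2)) ^+ p.+1.
Proof.
move=> n0 N0 op k0 kE.
have T0 : (0 < #|'I_N|)%N by rewrite card_ord.
have kE' : kap ^+ p.+1 = #|'I_N|%:R by rewrite card_ord.
have [G HG] := low_mstar n0 T0 op k0 kE'.
set rho := _ / Num.sqrt n%:R in HG *.
pose M : 'M[R]_(n, N) := \matrix_(t, j) sg R (nth [ffun=> true] (rseq G) t j).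
exists M => x; have [c Hc] := power_dist_perp M x op.
exists c; set r := fun j => x 0 j - (c *m M) 0 j in Hc *.
set nx := Num.sqrt _.
have rho0 : 0 <= rho.
  apply: le_trans (HG (fun=> 0) _ _); first exact: sqrtr_ge0.
    by rewrite big1 // => j _; rewrite expr0n.
  move=> w _; rewrite /dot big1 // => j _.
  by rewrite expr0n; case: (p) op => // p' _; rewrite mulr0.
set D := \sum_j _.
have D0 : 0 <= D by apply: sumr_ge0 => j _; apply: exprn_even_ge0; rewrite /= op.
have [Dz|Dn] := eqVneq D 0.
  by rewrite Dz exprn_ge0 // mulr_ge0 // sqrtr_ge0.
pose d := D `^ (p.+1%:R^-1).
have Dp : 0 < D by rewrite lt0r Dn.
have d0 : 0 < d by apply: powR_gt0.
have dE : d ^+ p.+1 = D.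
  by rewrite -powR_mulrn ?(ltW d0) // -powRrM mulVf ?powRr1 // pnatr_eq0.
have orth w : w \in rseq G -> dot w (fun j => r j ^+ p) = 0.
  move=> /(nthP [ffun=> true])[t]; rewrite size_rseq => tn <-.
  rewrite -(Hc (Ordinal tn)); apply: eq_bigr => j _.
  by rewrite [X in _ = _ * X]mxE mulrC.
have h : Num.sqrt (\sum_j (r j ^+ p) ^+ 2) <= rho * d ^+ p.
  have := HG (fun j => r j / d).
  have -> : \sum_j (r j / d) ^+ p.+1 = 1.
    under eq_bigr do rewrite exprMn.
    by rewrite -mulr_suml -/D exprVn dE divff.
  move=> /(_ (lexx _)) H.
  have /H : forall w, w \in rseq G -> dot w (fun j => (r j / d) ^+ p) = 0.
    move=> w /orth; rewrite /dot => o.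
    under eq_bigr do rewrite exprMn mulrA.
    by rewrite -mulr_suml o mul0r.
  have -> : \sum_j ((r j / d) ^+ p) ^+ 2 =
      (\sum_j (r j ^+ p) ^+ 2) * ((d ^+ p)^-1) ^+ 2.
    by rewrite mulr_suml; apply: eq_bigr => j _; rewrite !exprMn !exprVn.
  rewrite sqrtrM ?sumr_ge0 // => [|j _]; last exact: sqr_ge0.
  rewrite sqrtr_sqr ger0_norm ?invr_ge0 ?exprn_ge0 ?(ltW d0) //.
  by rewrite ler_pdivrMr // exprn_gt0.
have DE : D = \sum_j x 0 j * r j ^+ p.
  have z : \sum_j (c *m M) 0 j * r j ^+ p = 0.
    transitivity (\sum_t c 0 t * \sum_j r j ^+ p * M t j).
      under eq_bigr do rewrite mxE mulr_suml.
      rewrite exchange_big; apply: eq_bigr => t _.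
      by rewrite mulr_sumr; apply: eq_bigr => j _; ring.
    by apply: big1 => t _; rewrite Hc mulr0.
  transitivity (\sum_j x 0 j * r j ^+ p - \sum_j (c *m M) 0 j * r j ^+ p).
    by rewrite -sumrB; apply: eq_bigr => j _; rewrite -mulrBl exprS.
  by rewrite z subr0.
have : d * d ^+ p <= rho * nx * d ^+ p.
  rewrite -exprS dE DE; apply: le_trans (cauchy_schwarz _ _) _.
  by rewrite -/nx [rho * nx]mulrC -mulrA ler_wpM2l // sqrtr_ge0.
rewrite ler_pM2r ?exprn_gt0 // => hd; rewrite -dE lerXn2r // nnegrE.
  exact: ltW.
by rewrite mulr_ge0 // sqrtr_ge0.
Qed.

(** * The norm as a function of the reciprocal exponent *)

Lemma young_weighted (R : realType) (al x y : R) : 0 < al < 1 ->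
  0 <= x -> 0 <= y -> x `^ al * y `^ (1 - al) <= al * x + (1 - al) * y.
Proof.
move=> /andP[a0 a1] x0 y0.
have b0 : 0 < 1 - al by rewrite subr_gt0.
have := @conjugate_powR _ (x `^ al) (y `^ (1 - al)) al^-1 (1 - al)^-1.
rewrite !powR_ge0 !invr_gt0 a0 b0 !invrK => /(_ isT isT isT isT).
rewrite -!powRrM !mulfV ?gt_eqF // !powRr1 // addrC subrK => /(_ erefl).
by move=> h; rewrite [al * x]mulrC [(1 - al) * y]mulrC.
Qed.

(** In the reciprocal exponent interpolation is affine; u = 0 is the maximum norm, and u > 1 gives a
    quasi-norm. *)
Definition nrm (R : realType) (N : nat) (u : R) (v : 'I_N -> R) : R :=
  lnorm (u%:E^-1)%E v.

Section Norms.
Variables (R : realType) (N : nat).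
Implicit Types (u c : R) (v w x y : 'I_N -> R).

Lemma nrm0E v : nrm 0 v = \big[Num.max/0]_(i < N) `|v i|.
Proof. by rewrite /nrm inve0. Qed.

Lemma nrmE u v : u != 0 -> nrm u v = (\sum_i `|v i| `^ u^-1) `^ u.
Proof. by move=> u0; rewrite /nrm /inve (negbTE u0) /= invrK. Qed.

Lemma nrm_ge0 u v : 0 <= nrm u v.
Proof.
have [->|u0] := eqVneq u 0; last by rewrite nrmE // powR_ge0.
by rewrite nrm0E; exact: bigmax_ge_id.
Qed.

Lemma nrm_ext u v w : v =1 w -> nrm u v = nrm u w.
Proof. by move=> /funext ->. Qed.

Let sum_ge0 u v : 0 <= \sum_i `|v i| `^ u.
Proof. by apply: sumr_ge0 => i _; exact: powR_ge0. Qed.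

Lemma nrm_coord u v i : 0 <= u -> `|v i| <= nrm u v.
Proof.
move=> u0; have [->|un] := eqVneq u 0.
  by rewrite nrm0E; apply: (le_bigmax _ (fun i => `|v i|)).
have up : 0 < u by rewrite lt0r un.
rewrite nrmE // -[leLHS]powRr1 // -(mulVf un) powRrM.
rewrite ge0_ler_powR ?nnegrE ?powR_ge0 // (bigD1 i) //= lerDl.
by apply: sumr_ge0 => j _; exact: powR_ge0.
Qed.

Lemma nrm_eq0 u v i : 0 <= u -> nrm u v = 0 -> v i = 0.
Proof.
by move=> u0 v0; have := nrm_coord v i u0; rewrite v0 normr_le0 => /eqP.
Qed.

(** Reduces norm bounds to termwise comparison of sums, without the outer power. *)
Lemma nrm_leP u v c : 0 < u -> 0 < c ->
  (nrm u v <= c) = (\sum_i (`|v i| / c) `^ u^-1 <= 1).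
Proof.
move=> u0 c0; have un : u != 0 by rewrite gt_eqF.
have -> : \sum_i (`|v i| / c) `^ u^-1 = (\sum_i `|v i| `^ u^-1) / (c `^ u^-1).
  rewrite mulr_suml; apply: eq_bigr => i _.
  rewrite powRM //; last by rewrite invr_ge0 ltW.
  by rewrite -(powR_inv1 (ltW c0)) -powRrM mulN1r powRN.
rewrite ler_pdivrMr ?powR_gt0 // mul1r nrmE //.
have E : (c `^ u^-1) `^ u = c by rewrite -powRrM mulVf // powRr1 // ltW.
apply/idP/idP => h.
  have : ((\sum_i `|v i| `^ u^-1) `^ u) `^ u^-1 <= c `^ u^-1.
    by rewrite ge0_ler_powR ?nnegrE ?powR_ge0 ?invr_ge0 ?(ltW u0) ?(ltW c0).
  by rewrite -powRrM mulfV // powRr1.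
by rewrite -E ge0_ler_powR ?nnegrE ?powR_ge0 ?(ltW u0).
Qed.

Lemma nrm0_leP v c : 0 <= c -> (forall i, `|v i| <= c) -> nrm 0 v <= c.
Proof. by move=> c0 h; rewrite nrm0E; apply: bigmax_le. Qed.

Lemma nrm_ball_sum u v : 0 < u -> 0 < nrm u v ->
  \sum_i (`|v i| / nrm u v) `^ u^-1 <= 1.
Proof. by move=> u0 v0; rewrite -nrm_leP. Qed.

Lemma nrm_zero u v : (forall i, v i = 0) -> nrm u v = 0.
Proof.
move=> v0; have [->|u0] := eqVneq u 0.
  by rewrite nrm0E big1_idem //= ?maxxx // => i _; rewrite v0 normr0.
rewrite nrmE // big1 ?powR0 // => i _.
by rewrite v0 normr0 powR0 // invr_eq0.
Qed.

Lemma nrmZ u c v : nrm u (fun i => c * v i) = `|c| * nrm u v.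
Proof.
have [->|u0] := eqVneq u 0.
  rewrite !nrm0E; under eq_bigr do rewrite normrM.
  rewrite (big_morph (fun r : R => `|c| * r) (id1 := 0) (op1 := Num.max)) ?mulr0 //.
  by move=> a b; rewrite maxr_pMr.
rewrite !nrmE //.
have -> : \sum_i `|c * v i| `^ u^-1 = `|c| `^ u^-1 * \sum_i `|v i| `^ u^-1.
  by rewrite mulr_sumr; apply: eq_bigr => i _; rewrite normrM powRM.
by rewrite powRM ?powR_ge0 // -powRrM mulVf // powRr1.
Qed.

Lemma nrm_mono u v w : 0 <= u -> (forall i, `|v i| <= `|w i|) ->
  nrm u v <= nrm u w.
Proof.
move=> u0 vw; have [->|un] := eqVneq u 0.
  by rewrite !nrm0E; apply: le_bigmax2.
rewrite (nrmE v un) (nrmE w un).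
apply: ge0_ler_powR; rewrite ?nnegrE ?sum_ge0 //.
apply: ler_sum => i _.
by rewrite ge0_ler_powR ?nnegrE // invr_ge0.
Qed.

Lemma nrm_gt0P u v : 0 <= u -> (forall i, v i = 0) \/ 0 < nrm u v.
Proof.
move=> u0; have [v0|vn] := eqVneq (nrm u v) 0.
  by left => i; exact: (nrm_eq0 i u0 v0).
by right; rewrite lt0r vn nrm_ge0.
Qed.

Lemma nrm_ratio u v i : 0 <= u -> 0 < nrm u v -> 0 <= `|v i| / nrm u v <= 1.
Proof.
move=> u0 v0; rewrite divr_ge0 ?nrm_ge0 //= ler_pdivrMr // mul1r.
exact: nrm_coord.
Qed.

Lemma nrm_hoelder u0 u1 l v x y : 0 <= u0 -> 0 <= u1 -> 0 < l < 1 ->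
  (forall i, `|v i| <= `|x i| `^ (1 - l) * `|y i| `^ l) ->
  nrm ((1 - l) * u0 + l * u1) v <= nrm u0 x `^ (1 - l) * nrm u1 y `^ l.
Proof.
move=> u00 u10 /andP[l0 l1] vxy.
have m0 : 0 < 1 - l by rewrite subr_gt0.
set u := (1 - l) * u0 + l * u1.
have u_ge0 : 0 <= u by rewrite addr_ge0 // mulr_ge0 // ltW.
have triv : (forall i, v i = 0) ->
    nrm u v <= nrm u0 x `^ (1 - l) * nrm u1 y `^ l.
  by move=> /(nrm_zero u) ->; rewrite mulr_ge0 // powR_ge0.
have [x0|X0] := nrm_gt0P x u00.
  apply: triv => i; have := vxy i; rewrite x0 normr0 powR0 ?gt_eqF //.
  by rewrite mul0r normr_le0 => /eqP.
have [y0|Y0] := nrm_gt0P y u10.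
  apply: triv => i; have := vxy i; rewrite y0 normr0 powR0 ?gt_eqF //.
  by rewrite mulr0 normr_le0 => /eqP.
set X := nrm u0 x in X0 *; set Y := nrm u1 y in Y0 *.
have [uz|un] := eqVneq u 0.
  rewrite uz; apply: nrm0_leP => [|i]; first by rewrite mulr_ge0 // powR_ge0.
  apply: le_trans (vxy i) _; apply: ler_pM; rewrite ?powR_ge0 //.
    by rewrite ge0_ler_powR ?nnegrE ?nrm_ge0 ?(ltW m0) // nrm_coord.
  by rewrite ge0_ler_powR ?nnegrE ?nrm_ge0 ?(ltW l0) // nrm_coord.
have up : 0 < u by rewrite lt0r un.
rewrite nrm_leP ?mulr_gt0 ?powR_gt0 //.
pose A i := `|x i| / X; pose B i := `|y i| / Y.
have A01 i : 0 <= A i <= 1 by exact: nrm_ratio.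
have B01 i : 0 <= B i <= 1 by exact: nrm_ratio.
apply: (@le_trans _ _ (\sum_i A i `^ ((1 - l) / u) * B i `^ (l / u))).
  apply: ler_sum => i _; rewrite ![_ `^ (_ / u)]powRrM -powRM ?powR_ge0 //.
  apply: ge0_ler_powR; rewrite ?nnegrE.
  - by rewrite invr_ge0 ltW.
  - by rewrite divr_ge0 // mulr_ge0 // powR_ge0.
  - by rewrite mulr_ge0 // powR_ge0.
  have Xi : 0 <= X^-1 by rewrite invr_ge0 ltW.
  have Yi : 0 <= Y^-1 by rewrite invr_ge0 ltW.
  rewrite /A /B (powRM _ _ Xi) // (powRM _ _ Yi) //.
  rewrite -(powR_inv1 (ltW X0)) -(powR_inv1 (ltW Y0)) -!powRrM !mulN1r !powRN.
  by rewrite invfM mulrACA ler_wpM2r // mulr_ge0 // invr_ge0 powR_ge0.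
have [u0z|u0n] := eqVneq u0 0.
  have u1n : u1 != 0 by apply: contraNneq un => u1z; rewrite /u u0z u1z !mulr0 addr0.
  apply: le_trans (nrm_ball_sum _ Y0); last by rewrite lt0r u1n.
  apply: ler_sum => i _; have /andP[Ai Ai1] := A01 i.
  have -> : l / u = u1^-1.
    by rewrite /u u0z; field; rewrite u1n gt_eqF.
  rewrite -[leRHS]mul1r ler_wpM2r ?powR_ge0 // -[leRHS](powRr0 (A i)).
  have [->|An] := eqVneq (A i) 0.
    by rewrite powR0 ?powRr0 // mulf_neq0 ?invr_eq0 // gt_eqF.
  by apply: ger_powR; [rewrite lt0r An Ai|apply: divr_ge0; apply: ltW].
have [u1z|u1n] := eqVneq u1 0.
  apply: le_trans (nrm_ball_sum _ X0); last by rewrite lt0r u0n.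
  apply: ler_sum => i _; have /andP[Bi Bi1] := B01 i.
  have -> : (1 - l) / u = u0^-1.
    by rewrite /u u1z; field; rewrite u0n gt_eqF.
  rewrite -[leRHS]mulr1 ler_wpM2l ?powR_ge0 // -[leRHS](powRr0 (B i)).
  have [->|Bn] := eqVneq (B i) 0.
    by rewrite powR0 ?powRr0 // mulf_neq0 ?invr_eq0 // gt_eqF.
  by apply: ger_powR; [rewrite lt0r Bn Bi|apply: divr_ge0; apply: ltW].
have u0p : 0 < u0 by rewrite lt0r u0n.
have u1p : 0 < u1 by rewrite lt0r u1n.
pose al := (1 - l) * u0 / u.
have al1 : 1 - al = l * u1 / u.
  have -> : 1 = u / u by rewrite mulfV.
  by rewrite /al -mulrBl /u addrAC subrr add0r.
have al01 : 0 < al < 1.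
  apply/andP; split; first by rewrite divr_gt0 ?mulr_gt0.
  by rewrite -subr_gt0 al1 divr_gt0 ?mulr_gt0.
apply: (@le_trans _ _ (\sum_i (al * A i `^ u0^-1 + (1 - al) * B i `^ u1^-1))).
  apply: ler_sum => i _.
  have -> : A i `^ ((1 - l) / u) = (A i `^ u0^-1) `^ al.
    by rewrite -powRrM /al; congr (_ `^ _); field; apply/andP.
  have -> : B i `^ (l / u) = (B i `^ u1^-1) `^ (1 - al).
    by rewrite -powRrM al1; congr (_ `^ _); field; apply/andP.
  by apply: young_weighted; rewrite ?powR_ge0.
rewrite big_split /= -!mulr_sumr.
have ha : al * \sum_i A i `^ u0^-1 <= al * 1.
  by rewrite ler_wpM2l ?nrm_ball_sum //; case/andP: al01 => /ltW.
have hb : (1 - al) * \sum_i B i `^ u1^-1 <= (1 - al) * 1.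
  by rewrite ler_wpM2l ?nrm_ball_sum //; case/andP: al01 => _ /ltW; rewrite subr_ge0.
by apply: le_trans (lerD ha hb) _; rewrite !mulr1 addrC subrK.
Qed.

Lemma nrm_dec u1 u2 v : 0 <= u2 -> u2 <= u1 -> nrm u2 v <= nrm u1 v.
Proof.
move=> u20 u21; have u10 := le_trans u20 u21.
have [v0|V0] := nrm_gt0P v u10; first by rewrite nrm_zero // nrm_ge0.
have [->|u2n] := eqVneq u2 0.
  by apply: nrm0_leP => [|i]; [exact: nrm_ge0|exact: nrm_coord].
have u2p : 0 < u2 by rewrite lt0r u2n.
have u1p := lt_le_trans u2p u21.
rewrite nrm_leP //; apply: le_trans (nrm_ball_sum u1p V0).
apply: ler_sum => i _; have /andP[A0 A1] := nrm_ratio i u10 V0.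
have [->|An] := eqVneq (`|v i| / nrm u1 v) 0.
  by rewrite !powR0 // invr_eq0 // gt_eqF.
by apply: ger_powR; [rewrite lt0r An A0|rewrite lef_pV2].
Qed.

(** Hoelder's inequality against the indicator of S: Young's inequality is applied with 1/#|S| as
    second factor, and these sum to one over S. *)
Lemma nrm_inc (S : {set 'I_N}) u1 u2 v : 0 <= u1 -> u1 <= u2 ->
  (forall i, i \notin S -> v i = 0) ->
  nrm u2 v <= #|S|%:R `^ (u2 - u1) * nrm u1 v.
Proof.
move=> u10 u12 vS; have [->|un] := eqVneq u1 u2.
  by rewrite subrr powRr0 mul1r.
have u1lt : u1 < u2 by rewrite lt_neqAle un.
have u2p : 0 < u2 := le_lt_trans u10 u1lt.
have d0 : 0 < u2 - u1 by rewrite subr_gt0.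
have [v0|V0] := nrm_gt0P v u10.
  by rewrite nrm_zero // mulr_ge0 ?powR_ge0 ?nrm_ge0.
have S0 : 0 < #|S|%:R :> R.
  rewrite ltr0n lt0n; apply/negP => /eqP /cards0_eq Se.
  have v0 i : v i = 0 by apply: vS; rewrite Se inE.
  by rewrite nrm_zero // ltxx in V0.
set V := nrm u1 v in V0 *; set c := #|S|%:R in S0 *.
rewrite nrm_leP ?mulr_gt0 ?powR_gt0 //.
pose A i := `|v i| / V.
have AE i : (`|v i| / (c `^ (u2 - u1) * V)) `^ u2^-1 =
    A i `^ u2^-1 * c^-1 `^ (1 - u1 / u2).
  rewrite invfM [_^-1 * V^-1]mulrC mulrA -/(A i).
  have A0 : 0 <= A i by rewrite divr_ge0 // ltW.
  rewrite powRM ?invr_ge0 ?powR_ge0 //; congr (_ * _).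
  rewrite -(powR_inv1 (ltW S0)) -powRN -!powRrM; congr (_ `^ _).
  by field; rewrite gt_eqF.
have sumS (F : 'I_N -> R) : (forall i, i \notin S -> F i = 0) ->
    \sum_i F i = \sum_(i in S) F i.
  move=> F0; rewrite (bigID (mem S)) /= [X in _ + X]big1 ?addr0 //.
have A0S i : i \notin S -> (`|v i| / (c `^ (u2 - u1) * V)) `^ u2^-1 = 0.
  move=> iS; rewrite AE /A vS // normr0 mul0r powR0 ?mul0r //.
  by rewrite invr_eq0 gt_eqF.
rewrite sumS //.
have [u1z|u1n] := eqVneq u1 0.
  apply: (@le_trans _ _ (\sum_(i in S) c^-1)); last first.
    by rewrite sumr_const -mulr_natl mulfV // gt_eqF.
  apply: ler_sum => i _; rewrite AE u1z mul0r subr0 powRr1 ?invr_ge0 ?(ltW S0) //.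
  rewrite -[leRHS]mul1r ler_wpM2r ?invr_ge0 ?(ltW S0) //.
  have /andP[A0 A1] := nrm_ratio i u10 V0.
  apply: (@le_trans _ _ (1 `^ u2^-1)); last by rewrite powR1.
  by apply: ge0_ler_powR; rewrite ?nnegrE ?invr_ge0 ?(ltW u2p).
have u1p : 0 < u1 by rewrite lt0r u1n.
pose al := u1 / u2.
have al01 : 0 < al < 1 by rewrite divr_gt0 //= ltr_pdivrMr // mul1r.
apply: (@le_trans _ _ (\sum_(i in S) (al * A i `^ u1^-1 + (1 - al) * c^-1))).
  apply: ler_sum => i _; rewrite AE.
  have -> : A i `^ u2^-1 = (A i `^ u1^-1) `^ al.
    by rewrite -powRrM /al mulrA mulVf ?mul1r // gt_eqF.
  by apply: young_weighted; rewrite ?powR_ge0 ?invr_ge0 ?(ltW S0).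
rewrite big_split /= -mulr_sumr sumr_const -[X in _ + X]mulr_natl -/c.
rewrite mulrCA mulfV ?gt_eqF // mulr1 -sumS; last first.
  move=> i iS; rewrite /A vS // normr0 mul0r powR0 // invr_eq0 gt_eqF //.
have /andP[/ltW al0 _] := al01.
have := ler_wpM2l al0 (nrm_ball_sum u1p V0); rewrite -/V => h.
by apply: le_trans (lerD h (lexx (1 - al))) _; rewrite mulr1 addrC subrK.
Qed.

Lemma nrm_embed u1 u2 v : 0 <= u1 -> 0 <= u2 ->
  nrm u2 v <= N%:R `^ (Num.max 0 (u2 - u1)) * nrm u1 v.
Proof.
move=> u10 u20; have [h|h] := leP u2 u1.
  have -> : Num.max 0 (u2 - u1) = 0 by rewrite max_l // subr_le0.
  by rewrite powRr0 mul1r nrm_dec.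
have -> : Num.max 0 (u2 - u1) = u2 - u1 by rewrite max_r // subr_ge0 ltW.
have := @nrm_inc [set: 'I_N] u1 u2 v u10 (ltW h).
by rewrite cardsT card_ord; apply => i; rewrite inE.
Qed.

Lemma nrm_indic (S : {set 'I_N}) u c v : 0 <= u -> (0 < #|S|)%N ->
  (forall i, `|v i| = if i \in S then `|c| else 0) ->
  nrm u v = `|c| * #|S|%:R `^ u.
Proof.
move=> u0 S0 vS; have [->|un] := eqVneq u 0.
  rewrite powRr0 mulr1; apply/eqP; rewrite eq_le; apply/andP; split.
    by apply: nrm0_leP => // i; rewrite vS; case: ifP.
  by have /card_gt0P[i iS] := S0; have := nrm_coord v i (lexx 0); rewrite vS iS.
rewrite nrmE // (bigID (mem S)) /= [X in _ + X]big1 ?addr0; last first.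
  by move=> i /negbTE iS; rewrite vS iS powR0 // invr_eq0.
rewrite (eq_bigr (fun=> `|c| `^ u^-1)); last by move=> i iS; rewrite vS iS.
rewrite sumr_const -[X in X `^ u = _]mulr_natl powRM ?powR_ge0 // -powRrM mulVf // powRr1 //.
by rewrite mulrC.
Qed.

(** A crude substitute for Minkowski's inequality. Of two entries the larger controls the sum, (a +
    b)/(4c) <= (1/2) max(a, b)/c, and the power 1/u >= 1 keeps the factor 1/2 for averaging the two
    sums. *)
Lemma nrm_quasi u v w c : 0 < u <= 1 -> 0 < c ->
  nrm u v <= c -> nrm u w <= c -> nrm u (fun i => v i + w i) <= 4 * c.
Proof.
move=> /andP[u0 u1] c0; rewrite !nrm_leP ?mulr_gt0 // => hv hw.
apply: (@le_trans _ _ (\sum_i 2^-1 * ((`|v i| / c) `^ u^-1 + (`|w i| / c) `^ u^-1))).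
  apply: ler_sum => i _.
  have key (a b : R) : 0 <= a -> 0 <= b -> a <= b ->
     ((a + b) / (4 * c)) `^ u^-1 <= 2^-1 * ((a / c) `^ u^-1 + (b / c) `^ u^-1).
    move=> a0 b0 ab.
    apply: (@le_trans _ _ (2^-1 * (b / c) `^ u^-1)); last first.
      by rewrite ler_wpM2l ?invr_ge0 // lerDr powR_ge0.
    apply: (@le_trans _ _ ((2^-1 * (b / c)) `^ u^-1)).
      rewrite ge0_ler_powR ?nnegrE ?invr_ge0 ?(ltW u0) //.
      - by rewrite divr_ge0 ?addr_ge0 ?mulr_ge0 // ltW.
      - by rewrite mulr_ge0 ?invr_ge0 // divr_ge0 // ltW.
      rewrite ler_pdivrMr ?mulr_gt0 //.
      have -> : 2^-1 * (b / c) * (4 * c) = 2 * b by field; rewrite gt_eqF.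
      by lra.
    have h0 : 0 <= 2^-1 :> R by rewrite invr_ge0.
    have bc : 0 <= b / c by rewrite divr_ge0 // ltW.
    rewrite (powRM _ h0 bc) ler_wpM2r ?powR_ge0 //.
    apply: ge1r_powR; first by apply/andP; split; lra.
    by rewrite -[leLHS]invr1 lef_pV2 ?posrE.
  have nD : (`|v i + w i| / (4 * c)) `^ u^-1 <= ((`|v i| + `|w i|) / (4 * c)) `^ u^-1.
    rewrite ge0_ler_powR ?nnegrE ?invr_ge0 ?(ltW u0) //.
    - by rewrite divr_ge0 // mulr_ge0 // ltW.
    - by rewrite divr_ge0 ?addr_ge0 // mulr_ge0 // ltW.
    by rewrite ler_wpM2r ?ler_normD // invr_ge0 mulr_ge0 // ltW.
  apply: le_trans nD _; have [vw|/ltW vw] := leP `|v i| `|w i|.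
    exact: key.
  by rewrite [`|v i| + _]addrC [X in _ <= 2^-1 * X]addrC; exact: key.
rewrite -mulr_sumr big_split /=; set a := \sum_i _; set b := \sum_i _.
by move: hv hw; rewrite -/a -/b; clear; lra.
Qed.

(** The converse of Hoelder's inequality: both factors are powers of the normalised v, with
    exponents u0/u and u1/u, rescaled by the norm of v. *)
Lemma nrm_factor u0 u1 l v : 0 < u0 -> 0 < u1 -> 0 < l < 1 ->
  (forall i, 0 <= v i) ->
  exists x y, [/\ forall i, 0 <= x i, forall i, 0 <= y i,
    forall i, v i = x i `^ (1 - l) * y i `^ l,
    nrm u0 x <= nrm ((1 - l) * u0 + l * u1) v &
    nrm u1 y <= nrm ((1 - l) * u0 + l * u1) v].
Proof.
move=> u0p u1p /andP[l0 l1] v0.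
have m0 : 0 < 1 - l by rewrite subr_gt0.
set u := (1 - l) * u0 + l * u1.
have up : 0 < u by rewrite addr_gt0 // mulr_gt0.
have [vz|V0] := nrm_gt0P v (ltW up).
  exists (fun=> 0), (fun=> 0); split => //.
  - by move=> i; rewrite vz powR0 ?mul0r // gt_eqF.
  - by rewrite nrm_zero // nrm_ge0.
  - by rewrite nrm_zero // nrm_ge0.
set V := nrm u v in V0 *.
have A0 i : 0 <= v i / V by rewrite divr_ge0 // ltW.
have nb u' : 0 < u' -> nrm u' (fun i => V * (v i / V) `^ (u' / u)) <= V.
  move=> u'p; rewrite nrm_leP //.
  apply: le_trans (nrm_ball_sum up V0); apply: ler_sum => i _.
  rewrite ger0_norm ?mulr_ge0 ?powR_ge0 ?(ltW V0) // mulrC mulKf ?gt_eqF //.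
  rewrite -powRrM (ger0_norm (v0 i)) mulrAC mulfV ?mul1r // gt_eqF //.
exists (fun i => V * (v i / V) `^ (u0 / u)), (fun i => V * (v i / V) `^ (u1 / u)).
split.
- by move=> i; rewrite mulr_ge0 ?powR_ge0 // ltW.
- by move=> i; rewrite mulr_ge0 ?powR_ge0 // ltW.
- move=> i; rewrite (powRM _ (ltW V0) (powR_ge0 _ _)) (powRM _ (ltW V0) (powR_ge0 _ _)).
  rewrite mulrACA -!powRrM.
  have -> : V `^ (1 - l) * V `^ l = V.
    by rewrite -powRD ?(lt0r_neq0 V0) ?implybT // subrK powRr1 // ltW.
  have [vi|vi] := eqVneq (v i) 0.
    rewrite vi mul0r powR0 ?mul0r ?mulr0 //.
    by rewrite !mulf_neq0 ?invr_eq0 // gt_eqF.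
  have vn : v i / V != 0 by rewrite mulf_neq0 // invr_eq0 gt_eqF.
  rewrite -powRD ?vn ?implybT //.
  have -> : u0 / u * (1 - l) + u1 / u * l = 1.
    rewrite -[RHS](mulfV (lt0r_neq0 up)) -[X in _ = X / _]/((1 - l) * u0 + l * u1).
    by ring.
  by rewrite powRr1 // mulrC divfK // gt_eqF.
- exact: nb.
- exact: nb.
Qed.

End Norms.

(** * Mixed norms *)

Definition nrm2 (R : realType) (m k : nat) (u v : R) (x : 'I_m -> 'I_k -> R) : R :=
  nrm v (fun j => nrm u (fun i => x i j)).

Section MixedNorm.
Variables (R : realType) (m k : nat).
Implicit Types (u v c : R) (x y z : 'I_m -> 'I_k -> R).

Lemma nrm2_ge0 u v x : 0 <= nrm2 u v x.
Proof. exact: nrm_ge0. Qed.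

Lemma nrm2_mono u v x y : 0 <= u -> 0 <= v ->
  (forall i j, `|x i j| <= `|y i j|) -> nrm2 u v x <= nrm2 u v y.
Proof.
move=> u0 v0 xy; apply: nrm_mono => // j.
by rewrite !ger0_norm ?nrm_ge0 //; apply: nrm_mono.
Qed.

Lemma nrm2Z u v c x : nrm2 u v (fun i j => c * x i j) = `|c| * nrm2 u v x.
Proof.
rewrite /nrm2 (nrm_ext _ (w := fun j => `|c| * nrm u (fun i => x i j))).
  by rewrite nrmZ normr_id.
by move=> j; rewrite nrmZ.
Qed.

Lemma nrm2_coord u v x i j : 0 <= u -> 0 <= v -> `|x i j| <= nrm2 u v x.
Proof.
move=> u0 v0; apply: le_trans (nrm_coord (fun i => x i j) i u0) _.
have := nrm_coord (fun j => nrm u (fun i => x i j)) j v0.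
by rewrite ger0_norm ?nrm_ge0.
Qed.

Lemma nrm2_gt0P u v x : 0 <= u -> 0 <= v ->
  (forall i j, x i j = 0) \/ 0 < nrm2 u v x.
Proof.
move=> u0 v0; have [V0|Vn] := eqVneq (nrm2 u v x) 0.
  left => i j; have := @nrm2_coord u v x i j u0 v0.
  by rewrite V0 normr_le0 => /eqP.
by right; rewrite lt0r Vn nrm2_ge0.
Qed.

Lemma nrm2_zero u v x : (forall i j, x i j = 0) -> nrm2 u v x = 0.
Proof. by move=> x0; apply: nrm_zero => j; apply: nrm_zero => i. Qed.

Lemma nrm2_hoelder u0 v0 u1 v1 l z x y :
  0 <= u0 -> 0 <= u1 -> 0 <= v0 -> 0 <= v1 -> 0 < l < 1 ->
  (forall i j, `|z i j| <= `|x i j| `^ (1 - l) * `|y i j| `^ l) ->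
  nrm2 ((1 - l) * u0 + l * u1) ((1 - l) * v0 + l * v1) z <=
  nrm2 u0 v0 x `^ (1 - l) * nrm2 u1 v1 y `^ l.
Proof.
move=> u00 u10 v00 v10 l01 zxy; apply: nrm_hoelder => // j.
by rewrite !ger0_norm ?nrm_ge0 //; apply: nrm_hoelder.
Qed.

Lemma nrm2_interp u0 v0 u1 v1 l x :
  0 <= u0 -> 0 <= u1 -> 0 <= v0 -> 0 <= v1 -> 0 < l < 1 ->
  nrm2 ((1 - l) * u0 + l * u1) ((1 - l) * v0 + l * v1) x <=
  nrm2 u0 v0 x `^ (1 - l) * nrm2 u1 v1 x `^ l.
Proof.
move=> u00 u10 v00 v10 /[dup] l01 /andP[l0 l1]; apply: nrm2_hoelder => // i j.
have [->|xn] := eqVneq `|x i j| 0.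
  by rewrite mulr_ge0 // powR_ge0.
by rewrite -powRD ?xn ?implybT // subrK powRr1.
Qed.

Lemma nrm2_embed u1 v1 u2 v2 x :
  0 <= u1 -> 0 <= u2 -> 0 <= v1 -> 0 <= v2 ->
  nrm2 u2 v2 x <=
  m%:R `^ Num.max 0 (u2 - u1) * k%:R `^ Num.max 0 (v2 - v1) * nrm2 u1 v1 x.
Proof.
move=> u10 u20 v10 v20.
apply: (@le_trans _ _ (nrm v2 (fun j => m%:R `^ Num.max 0 (u2 - u1) *
    nrm u1 (fun i => x i j)))).
  apply: nrm_mono => // j.
  rewrite !ger0_norm ?nrm_ge0 // ?mulr_ge0 ?powR_ge0 ?nrm_ge0 //.
  exact: nrm_embed.
rewrite nrmZ ger0_norm ?powR_ge0 // -mulrA ler_wpM2l ?powR_ge0 //.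
exact: nrm_embed.
Qed.

(** The factor 4 of [nrm_quasi] is paid once in each index. *)
Lemma nrm2_quasi u v x y c : 0 < u <= 1 -> 0 < v <= 1 -> 0 < c ->
  nrm2 u v x <= c -> nrm2 u v y <= c ->
  nrm2 u v (fun i j => x i j + y i j) <= 16 * c.
Proof.
move=> /[dup] u01 /andP[/ltW u0 _] /[dup] v01 /andP[/ltW v0 _] c0 hx hy.
pose X j := nrm u (fun i => x i j); pose Y j := nrm u (fun i => y i j).
have XY : nrm v (fun j => X j + Y j) <= 4 * c by exact: nrm_quasi.
apply: (@le_trans _ _ (nrm v (fun j => 4 * (X j + Y j)))); last first.
  by rewrite nrmZ ger0_norm //; move: XY; lra.
apply: nrm_mono => // j.
have X0 : 0 <= X j by exact: nrm_ge0.
have Y0 : 0 <= Y j by exact: nrm_ge0.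
rewrite !ger0_norm ?nrm_ge0 ?mulr_ge0 ?addr_ge0 //.
have [XY0|XYp] := eqVneq (X j + Y j) 0.
  have Xz : X j = 0 by move: X0 Y0 XY0; clear; lra.
  have Yz : Y j = 0 by move: X0 Y0 XY0; clear; lra.
  rewrite XY0 mulr0 nrm_zero // => i.
  by rewrite (nrm_eq0 i u0 Xz) (nrm_eq0 i u0 Yz) addr0.
apply: nrm_quasi => //.
- by rewrite lt0r XYp addr_ge0.
- by rewrite -/(X j) lerDl.
- by rewrite -/(Y j) lerDr.
Qed.

(** The vector of column norms and each normalised column are factored separately and multiplied; a
    zero column factors as zero. *)
Lemma nrm2_factor u0 v0 u1 v1 l x :
  0 < u0 -> 0 < u1 -> 0 < v0 -> 0 < v1 -> 0 < l < 1 ->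
  exists y z, [/\ forall i j, 0 <= y i j, forall i j, 0 <= z i j,
    forall i j, `|x i j| = y i j `^ (1 - l) * z i j `^ l,
    nrm2 u0 v0 y <= nrm2 ((1 - l) * u0 + l * u1) ((1 - l) * v0 + l * v1) x &
    nrm2 u1 v1 z <= nrm2 ((1 - l) * u0 + l * u1) ((1 - l) * v0 + l * v1) x].
Proof.
move=> u0p u1p v0p v1p l01; have /andP[l0 l1] := l01.
set u := (1 - l) * u0 + l * u1.
have up : 0 < u by rewrite addr_gt0 // mulr_gt0 // subr_gt0.
pose cn j := nrm u (fun i => x i j).
have [Y [Z [Y0 Z0 YZ nY nZ]]] := nrm_factor (v := cn) v0p v1p l01
  (fun j => nrm_ge0 _ _).
have /choice[f Hf] : forall j, exists yz : ('I_m -> R) * ('I_m -> R),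
   [/\ forall i, 0 <= yz.1 i, forall i, 0 <= yz.2 i,
     forall i, `|x i j| = (Y j * yz.1 i) `^ (1 - l) * (Z j * yz.2 i) `^ l,
     nrm u0 yz.1 <= 1 & nrm u1 yz.2 <= 1].
  move=> j; have [cz|cnz] := eqVneq (cn j) 0.
    exists (fun=> 0, fun=> 0); split => //= [i||].
    - rewrite (nrm_eq0 i (ltW up) cz) normr0 mulr0 powR0 ?mul0r //.
      by rewrite subr_eq0 gt_eqF.
    - by rewrite nrm_zero.
    - by rewrite nrm_zero.
  have cp : 0 < cn j by rewrite lt0r cnz nrm_ge0.
  have [y [z [y0 z0 yz ny nz]]] := nrm_factor (v := fun i => `|x i j| / cn j)
    u0p u1p l01 (fun i => divr_ge0 (normr_ge0 _) (ltW cp)).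
  have n1 : nrm u (fun i => `|x i j| / cn j) = 1.
    rewrite (nrm_ext _ (w := fun i => (cn j)^-1 * `|x i j|)); last first.
      by move=> i; rewrite mulrC.
    rewrite nrmZ ger0_norm ?invr_ge0 ?(ltW cp) //.
    rewrite (_ : nrm u (fun i => `|x i j|) = cn j) ?mulVf //.
    apply/eqP; rewrite eq_le /cn; apply/andP; split;
      by apply: nrm_mono => [|i]; rewrite ?normr_id // ltW.
  rewrite n1 in ny nz; exists (y, z); split => //= i.
  rewrite (powRM _ (Y0 j) (y0 i)) (powRM _ (Z0 j) (z0 i)) mulrACA -YZ -yz.
  by rewrite mulrC divfK.
have aux (w : R) (W : 'I_k -> R) (g : 'I_k -> 'I_m -> R) (vv : R) : 0 <= vv ->
    (forall j, 0 <= W j) -> (forall j, nrm w (g j) <= 1) ->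
    nrm2 w vv (fun i j => W j * g j i) <= nrm vv W.
  move=> vv0 W0 g1; apply: nrm_mono => // j.
  rewrite nrmZ !ger0_norm // ?mulr_ge0 ?nrm_ge0 // ler_piMr //.
exists (fun i j => Y j * (f j).1 i), (fun i j => Z j * (f j).2 i); split.
- by move=> i j; have [h _ _ _ _] := Hf j; rewrite mulr_ge0.
- by move=> i j; have [_ h _ _ _] := Hf j; rewrite mulr_ge0.
- by move=> i j; have [_ _ h _ _] := Hf j.
- apply: le_trans nY; apply: aux => // [|j]; first exact: ltW.
  by have [] := Hf j.
- apply: le_trans nZ; apply: aux => // [|j]; first exact: ltW.
  by have [] := Hf j.
Qed.

Lemma nrm2_diag (s : nat) x : (0 < s)%N -> ~~ odd s ->
  nrm2 s%:R^-1 s%:R^-1 x = (\sum_i \sum_j x i j ^+ s) `^ s%:R^-1.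
Proof.
move=> s0 es; have sn : s%:R^-1 != 0 :> R by rewrite invr_eq0 pnatr_eq0 -lt0n.
rewrite /nrm2 nrmE //; congr (_ `^ _); rewrite exchange_big /=.
apply: eq_bigr => j _; rewrite ger0_norm ?nrm_ge0 // nrmE // -powRrM mulfV //.
have S0 : 0 <= \sum_i `|x i j| `^ s%:R^-1^-1.
  by apply: sumr_ge0 => i _; exact: powR_ge0.
rewrite powRr1 //; apply: eq_bigr => i _.
by rewrite invrK powR_mulrn // -normrX ger0_norm // exprn_even_ge0.
Qed.

End MixedNorm.

Lemma sum_mxvec (R : realType) (m k : nat) (F : R -> R) (x : 'M[R]_(m, k)) :
  \sum_l F (mxvec x 0 l) = \sum_i \sum_j F (x i j).
Proof.
rewrite pair_bigA /= (reindex _ (curry_mxvec_bij m k)) /=.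
by apply: eq_bigr => -[i j] _; rewrite /= mxvecE.
Qed.

(** * Upper bound for the width of a single ball *)

(* n^(-1/2) m^a k^b, replaced by 1 when n = 0: there the width of the (2,2)
   ball is of order 1. *)
Definition base (R : realType) (a b : R) (m k n : nat) : R :=
  if n == 0%N then 1 else n%:R `^ (- 2^-1) * m%:R `^ a * k%:R `^ b.

Lemma base_gt0 (R : realType) (a b : R) (m k n : nat) :
  (0 < m)%N -> (0 < k)%N -> 0 < base a b m k n.
Proof.
move=> m0 k0; rewrite /base; case: eqP => [//|/eqP n0].
by rewrite !mulr_gt0 // powR_gt0 // ltr0n // lt0n.
Qed.

(** Approximation takes place in l_s for an even s. Passing from l_s to the (1/a, 1/b) norm costs
    m^(a - 1/s) k^(b - 1/s), and the factor (m k)^(1/s) of [width_euclid_power] completes this to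
    m^a k^b. *)
Lemma width_22 (R : realType) (a b : R) : 0 < a <= 2^-1 -> 0 < b <= 2^-1 ->
  exists C : R, 1 <= C /\ forall m k n, (0 < m)%N -> (0 < k)%N ->
    exists L : {vspace 'M[R]_(m, k)}, (\dim L <= n)%N /\
      forall x : 'M[R]_(m, k), exists2 y, y \in L &
        nrm2 a b (x - y) <= C * base a b m k n * nrm2 2^-1 2^-1 x.
Proof.
move=> /andP[a0 a2] /andP[b0 b2].
(* Then s = p + 1 is even and at least max (1/a, 1/b); it depends on a and b only, hence so does
   C. *)
pose p := (Num.truncn (Num.max a^-1 b^-1)).*2.+1.
have op : odd p by rewrite /p /= odd_double.
have sl : Num.max a^-1 b^-1 <= p.+1%:R.
  have := truncnS_gt (Num.max a^-1 b^-1); move/ltW/le_trans; apply.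
  by rewrite ler_nat /p -addnn ltnS -addnS leq_addr.
have sp : 0 < p.+1%:R :> R by rewrite ltr0n.
have sa : p.+1%:R^-1 <= a.
  by rewrite -[leRHS]invrK lef_pV2 ?posrE ?invr_gt0 // (le_trans _ sl) // le_max lexx.
have sb : p.+1%:R^-1 <= b.
  by rewrite -[leRHS]invrK lef_pV2 ?posrE ?invr_gt0 // (le_trans _ sl) // le_max lexx orbT.
have s0 : 0 <= p.+1%:R^-1 :> R by rewrite invr_ge0 ltW.
pose C : R := 18 / 5 * (1 + mom_const R p.+1).
have C1 : 1 <= C.
  have : 0 <= mom_const R p.+1.
    by rewrite /mom_const mulr_ge0 ?exprn_ge0 ?mulr_ge0 // ?expR_ge0 // ltW.
  by rewrite /C; lra.
have h2 : 0 <= 2^-1 :> R by rewrite invr_ge0.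
exists C; split => // m k n m0 k0.
have [->|n0] := posnP n.
  exists 0%VS; split; first by rewrite dimv0.
  move=> x; exists 0; first exact: mem0v.
  rewrite subr0 /base eqxx mulr1.
  have := nrm2_embed x h2 (ltW a0) h2 (ltW b0).
  have -> : Num.max 0 (a - 2^-1) = 0 by rewrite max_l // subr_le0.
  have -> : Num.max 0 (b - 2^-1) = 0 by rewrite max_l // subr_le0.
  rewrite !powRr0 !mul1r => /le_trans; apply.
  by rewrite ler_peMl // nrm2_ge0.
have N0 : (0 < m * k)%N by rewrite muln_gt0 m0.
have NR0 : 0 < (m * k)%:R :> R by rewrite ltr0n.
pose kap : R := (m * k)%:R `^ p.+1%:R^-1.
have kap0 : 0 < kap by rewrite powR_gt0.
have kE : kap ^+ p.+1 = (m * k)%:R.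
  by rewrite -powR_mulrn ?(ltW kap0) // -powRrM mulVf ?powRr1 ?(ltW NR0) ?gt_eqF.
have [M HM] := width_euclid_power n0 N0 op kap0 kE.
rewrite -/C in HM.
pose L : {vspace 'M[R]_(m, k)} := <<[seq vec_mx (row t M) | t <- enum 'I_n]>>%VS.
exists L; split.
  by apply: leq_trans (dim_span _) _; rewrite size_map size_enum_ord.
move=> x; have [c Hc] := HM (mxvec x).
exists (vec_mx (c *m M)).
  rewrite mulmx_sum_row linear_sum /=; apply: memv_suml => t _.
  rewrite linearZ /= memvZ // memv_span //; apply/mapP; exists t => //.
  by rewrite mem_enum.
set z := x - vec_mx (c *m M).
have zE l : mxvec x 0 l - (c *m M) 0 l = mxvec z 0 l.
  by rewrite /z linearB /= vec_mxK !mxE.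
have xE : Num.sqrt (\sum_j mxvec x 0 j ^+ 2) = nrm2 2^-1 2^-1 x.
  rewrite (sum_mxvec (fun r => r ^+ 2)) (@nrm2_diag _ _ _ 2) // powR12_sqrt //.
  by apply: sumr_ge0 => i _; apply: sumr_ge0 => j _; exact: sqr_ge0.
move: Hc; under eq_bigr do rewrite zE.
rewrite (sum_mxvec (fun r => r ^+ p.+1)) xE => Hc.
have nx0 : 0 <= nrm2 2^-1 2^-1 x by exact: nrm2_ge0.
set rho := _ / _ in Hc.
have rho0 : 0 <= rho.
  by rewrite divr_ge0 ?sqrtr_ge0 // mulr_ge0 ?(ltW kap0) // (le_trans _ C1).
have zs : nrm2 p.+1%:R^-1 p.+1%:R^-1 z <= rho * nrm2 2^-1 2^-1 x.
  have es : ~~ odd p.+1 by rewrite /= odd_double.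
  rewrite (nrm2_diag z (ltn0Sn p) es).
  have r0 : 0 <= rho * nrm2 2^-1 2^-1 x by rewrite mulr_ge0.
  have E : rho * nrm2 2^-1 2^-1 x =
      ((rho * nrm2 2^-1 2^-1 x) ^+ p.+1) `^ p.+1%:R^-1.
    by rewrite -powR_mulrn // -powRrM mulfV ?powRr1 // gt_eqF.
  rewrite [leRHS]E.
  apply: ge0_ler_powR; rewrite ?nnegrE //; last by rewrite exprn_ge0.
  apply: sumr_ge0 => i _; apply: sumr_ge0 => j _; apply: exprn_even_ge0.
  by rewrite es.
apply: le_trans (nrm2_embed z s0 (ltW a0) s0 (ltW b0)) _.
have -> : Num.max 0 (a - p.+1%:R^-1) = a - p.+1%:R^-1.
  by rewrite max_r // subr_ge0.
have -> : Num.max 0 (b - p.+1%:R^-1) = b - p.+1%:R^-1.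
  by rewrite max_r // subr_ge0.
apply: (@le_trans _ _ (m%:R `^ (a - p.+1%:R^-1) * k%:R `^ (b - p.+1%:R^-1) *
  (rho * nrm2 2^-1 2^-1 x))).
  by rewrite ler_wpM2l // mulr_ge0 // powR_ge0.
rewrite le_eqVlt; apply/orP; left; apply/eqP; rewrite mulrA; congr (_ * _).
rewrite /base gtn_eqF // /rho /kap natrM powRM ?ler0n //.
have mR : m%:R != 0 :> R by rewrite pnatr_eq0 -lt0n.
have kR : k%:R != 0 :> R by rewrite pnatr_eq0 -lt0n.
rewrite !powRB ?mR ?kR ?implybT // powRN powR12_sqrt ?ler0n //.
have nR : Num.sqrt n%:R != 0 :> R by rewrite gt_eqF // sqrtr_gt0 ltr0n.
field; rewrite nR !powR_eq0 /=.
by rewrite (negbTE mR) (negbTE kR).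
Qed.

(* Factor |x| = x0^(1 - mu) x1^mu with x0, x1 in the (q, sigma) and (2, 2)
   balls; then |x| <= max (A x0, B x1) whenever A^(1 - mu) B^mu = 1, and only
   the entries dominated by B x1 are approximated. *)
Lemma width_interp (R : realType) (a b : R) : 0 < a <= 2^-1 -> 0 < b <= 2^-1 ->
  exists C : R, 1 <= C /\ forall m k n, (0 < m)%N -> (0 < k)%N ->
    exists L : {vspace 'M[R]_(m, k)}, (\dim L <= n)%N /\
      forall mu (x : 'M[R]_(m, k)), 0 <= mu <= 1 -> exists2 y, y \in L &
        nrm2 a b (x - y) <= C * base a b m k n `^ mu *
          nrm2 (a + mu * (2^-1 - a)) (b + mu * (2^-1 - b)) x.
Proof.
move=> ha hb; have /andP[a0 a2] := ha; have /andP[b0 b2] := hb.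
have [C [C1 HC]] := width_22 ha hb.
exists (16 * C); split; first lra.
move=> m k n m0 k0; have [L [dL HL]] := HC m k n m0 k0.
exists L; split => // mu x /andP[mu0 mu1].
have T0 := base_gt0 a b n m0 k0; set T := base a b m k n in T0 HL *.
have [muz|mun] := eqVneq mu 0.
  exists 0; first exact: mem0v.
  rewrite subr0 muz !mul0r !addr0 powRr0 mulr1 ler_peMl ?nrm2_ge0 //; lra.
have [mu1'|mun1] := eqVneq mu 1.
  have [y yL hy] := HL x; exists y => //; apply: le_trans hy _.
  rewrite mu1' powRr1 ?(ltW T0) // !mul1r.
  have -> : a + (2^-1 - a) = 2^-1 by ring.
  have -> : b + (2^-1 - b) = 2^-1 by ring.
  rewrite ler_wpM2r ?nrm2_ge0 // ler_wpM2r ?(ltW T0) //; lra.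
have mup : 0 < mu by rewrite lt0r mun.
have mu1p : mu < 1 by rewrite lt_neqAle mun1.
have -> : a + mu * (2^-1 - a) = (1 - mu) * a + mu * 2^-1 by ring.
have -> : b + mu * (2^-1 - b) = (1 - mu) * b + mu * 2^-1 by ring.
have h2 : 0 < 2^-1 :> R by rewrite invr_gt0.
have xi0 : 0 <= (1 - mu) * a + mu * 2^-1.
  by rewrite addr_ge0 // mulr_ge0 // ?subr_ge0 ltW.
have eta0 : 0 <= (1 - mu) * b + mu * 2^-1.
  by rewrite addr_ge0 // mulr_ge0 // ?subr_ge0 ltW.
set V := nrm2 _ _ x.
have V0 : 0 <= V by exact: nrm2_ge0.
have [xz|Vp] := nrm2_gt0P x xi0 eta0.
  exists 0; first exact: mem0v.
  rewrite subr0 nrm2_zero // mulr_ge0 // mulr_ge0 ?powR_ge0 //; lra.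
have mu01 : 0 < mu < 1 by rewrite mup.
have [x0 [x1 [x00 x10 x01 n0 n1]]] :=
  nrm2_factor x a0 h2 b0 h2 mu01.
rewrite -/V in n0 n1 Vp *.
pose D := C * T; have D0 : 0 < D by rewrite mulr_gt0 //; lra.
(* Chosen so that D B = A and A^(1 - mu) B^mu = 1: the approximated part and the discarded part then
   have the same error bound A V. *)
pose A := D `^ mu; pose B := D `^ (mu - 1).
have A0 : 0 < A by apply: powR_gt0.
have B0 : 0 < B by apply: powR_gt0.
have DB : D * B = A.
  have -> : A = D `^ (1 + (mu - 1)) by rewrite addrC subrK.
  by rewrite powRD ?(lt0r_neq0 D0) ?implybT // powRr1 // ltW.
have AB : A `^ (1 - mu) * B `^ mu = 1.
  rewrite -!powRrM -powRD ?(lt0r_neq0 D0) ?implybT //.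
  have -> : mu * (1 - mu) + (mu - 1) * mu = 0 by ring.
  exact: powRr0.
have xmax i j : `|x i j| <= A * x0 i j \/ `|x i j| <= B * x1 i j.
  have [h|/ltW h] := leP (B * x1 i j) (A * x0 i j); [left|right].
    apply: (@le_trans _ _ ((A * x0 i j) `^ (1 - mu) * (A * x0 i j) `^ mu)); last first.
      have [->|nz] := eqVneq (A * x0 i j) 0.
        by rewrite powR0 ?mul0r // subr_eq0 eq_sym.
      by rewrite -powRD ?nz ?implybT // subrK powRr1 // mulr_ge0 // ltW.
    apply: (@le_trans _ _ ((A * x0 i j) `^ (1 - mu) * (B * x1 i j) `^ mu)); last first.
      rewrite ler_wpM2l ?powR_ge0 //.
      by apply: ge0_ler_powR; rewrite ?nnegrE // mulr_ge0 // ltW.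
    rewrite (powRM _ (ltW A0) (x00 _ _)) (powRM _ (ltW B0) (x10 _ _)).
    by rewrite mulrACA AB mul1r x01.
  apply: (@le_trans _ _ ((B * x1 i j) `^ (1 - mu) * (B * x1 i j) `^ mu)); last first.
    have [->|nz] := eqVneq (B * x1 i j) 0.
      by rewrite powR0 ?mul0r // subr_eq0 eq_sym.
    by rewrite -powRD ?nz ?implybT // subrK powRr1 // mulr_ge0 // ltW.
  apply: (@le_trans _ _ ((A * x0 i j) `^ (1 - mu) * (B * x1 i j) `^ mu)); last first.
    rewrite ler_wpM2r ?powR_ge0 //.
    by apply: ge0_ler_powR; rewrite ?nnegrE ?subr_ge0 // mulr_ge0 // ltW.
  rewrite (powRM _ (ltW A0) (x00 _ _)) (powRM _ (ltW B0) (x10 _ _)).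
  by rewrite mulrACA AB mul1r x01.
pose x' : 'M[R]_(m, k) :=
  \matrix_(i, j) if `|x i j| <= B * x1 i j then x i j else 0.
have [y yL hy] := HL x'.
exists y => //.
have AV : 0 < A * V by rewrite mulr_gt0.
have h1 : nrm2 a b (x' - y) <= A * V.
  apply: le_trans hy _; rewrite -/D -DB -mulrA ler_wpM2l ?(ltW D0) //.
  apply: (@le_trans _ _ (B * nrm2 2^-1 2^-1 x1)); last first.
    by rewrite ler_wpM2l ?(ltW B0).
  rewrite -[B in leRHS]gtr0_norm // -nrm2Z.
  apply: nrm2_mono; rewrite ?(ltW h2) // => i j; rewrite mxE.
  rewrite [leRHS]ger0_norm ?mulr_ge0 ?(ltW B0) //.
  by case: ifP => // _; rewrite normr0 mulr_ge0 // ltW.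
have h3 : nrm2 a b (x - x') <= A * V.
  apply: (@le_trans _ _ (A * nrm2 a b x0)); last first.
    by rewrite ler_wpM2l ?(ltW A0).
  rewrite -[A in leRHS]gtr0_norm // -nrm2Z.
  apply: nrm2_mono; rewrite ?(ltW a0) ?(ltW b0) // => i j; rewrite !mxE.
  rewrite [leRHS]ger0_norm ?mulr_ge0 ?(ltW A0) //.
  case: ifP => [_|h]; first by rewrite subrr normr0 mulr_ge0 // ltW.
  by rewrite subr0; case: (xmax i j) => //; rewrite h.
have half1 : 2^-1 <= 1 :> R by rewrite invf_le1 // ler1n.
have a1 : 0 < a <= 1 by rewrite a0 (le_trans a2).
have b1 : 0 < b <= 1 by rewrite b0 (le_trans b2).
have := nrm2_quasi a1 b1 AV h1 h3.
have -> : nrm2 a b (fun i j => (x' - y) i j + (x - x') i j) = nrm2 a b (x - y).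
  by congr nrm2; apply/funext => i; apply/funext => j; rewrite !mxE; ring.
move=> /le_trans; apply; rewrite mulrA ler_wpM2r // -mulrA ler_wpM2l //.
have Cge0 : 0 <= C := le_trans ler01 C1.
rewrite /A /D (powRM _ Cge0 (ltW T0)).
by rewrite ler_wpM2r ?powR_ge0 // ler1_powR.
Qed.

Lemma powR_expR (R : realType) (x y : R) : 0 < x -> x `^ y = expR (y * ln x).
Proof. by move=> x0; rewrite /powR gt_eqF. Qed.

Lemma width_ball (R : realType) (a b : R) : 0 < a <= 2^-1 -> 0 < b <= 2^-1 ->
  exists C : R, 1 <= C /\ forall m k n, (0 < m)%N -> (0 < k)%N ->
    exists L : {vspace 'M[R]_(m, k)}, (\dim L <= n)%N /\
      forall u v mu (x : 'M[R]_(m, k)), 0 <= u -> 0 <= v -> 0 <= mu <= 1 ->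
      exists2 y, y \in L &
        nrm2 a b (x - y) <= C *
          expR (phi a b (ln m%:R) (ln k%:R) (ln (base a b m k n)) u v mu)
          * nrm2 u v x.
Proof.
move=> ha hb; have /andP[a0 a2] := ha; have /andP[b0 b2] := hb.
have [C [C1 HC]] := width_interp ha hb.
exists C; split => // m k n m0 k0; have [L [dL HL]] := HC m k n m0 k0.
exists L; split => // u v mu x u0 v0 /[dup] hmu /andP[mu0 mu1].
have [y yL hy] := HL mu x hmu; exists y => //.
apply: le_trans hy _.
have T0 := base_gt0 a b n m0 k0; set T := base a b m k n in T0 *.
have mR : 0 < m%:R :> R by rewrite ltr0n.
have kR : 0 < k%:R :> R by rewrite ltr0n.
have xi0 : 0 <= a + mu * (2^-1 - a).
  by rewrite addr_ge0 ?(ltW a0) // mulr_ge0 // subr_ge0.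
have eta0 : 0 <= b + mu * (2^-1 - b).
  by rewrite addr_ge0 ?(ltW b0) // mulr_ge0 // subr_ge0.
apply: (@le_trans _ _ (C * T `^ mu * (m%:R `^ Num.max 0 (a + mu * (2^-1 - a) - u)
  * k%:R `^ Num.max 0 (b + mu * (2^-1 - b) - v) * nrm2 u v x))).
  rewrite ler_wpM2l ?nrm2_embed // mulr_ge0 ?powR_ge0 //.
  by rewrite (le_trans _ C1).
rewrite /phi !expRD !powR_expR // mulrA le_eqVlt; apply/orP; left; apply/eqP.
by rewrite ![_ * ln _]mulrC; ring.
Qed.

(** * Lower bound for one rectangle *)

Lemma dot_rV (R : comPzRingType) (N : nat) (x y : 'rV[R]_N) :
  (x *m y^T) 0 0 = \sum_l x 0 l * y 0 l.
Proof. by rewrite mxE; apply: eq_bigr => l _; rewrite mxE. Qed.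

Lemma gram_unit (R : realFieldType) (d N : nat) (B : 'M[R]_(d, N)) :
  row_free B -> B *m B^T \in unitmx.
Proof.
move=> Bf; rewrite -row_free_unit -kermx_eq0; apply/eqP/row_matrixP => i.
rewrite row0; set w := row i _.
have w0 : w *m (B *m B^T) = 0.
  by rewrite /w -row_mul mulmx_ker row0.
have wB : w *m B = 0.
  apply/rowP => j; rewrite [RHS]mxE; apply/eqP; rewrite -sqrf_eq0.
  have : \sum_l (w *m B) 0 l ^+ 2 = 0.
    have := dot_rV (w *m B) (w *m B); rewrite trmx_mul mulmxA -(mulmxA w) w0 mul0mx.
    by rewrite [X in X = _ -> _]mxE => E; rewrite [RHS]E; apply: eq_bigr.
  move/eqP; rewrite psumr_eq0; last by move=> l _; exact: sqr_ge0.
  by move/allP => /(_ j (mem_index_enum j)).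
by apply: (row_free_inj Bf); rewrite wB mul0mx.
Qed.

Lemma orth_proj (R : realFieldType) (d N : nat) (M : 'M[R]_(d, N)) :
  exists P : 'M[R]_N, [/\ P^T = P, P *m P = P, M *m P = M & \tr P <= d%:R].
Proof.
have [r' [B [Bf MB rd]]] : exists r' (B : 'M[R]_(r', N)),
    [/\ row_free B, (M <= B)%MS & (r' <= d)%N].
  exists (\rank M), (row_base M); split; first exact: row_base_free.
    by rewrite eq_row_base.
  exact: rank_leq_row.
have Gu := gram_unit Bf; set G := B *m B^T in Gu.
have GT : G^T = G by rewrite /G trmx_mul trmxK.
exists (B^T *m invmx G *m B); split.
- by rewrite !trmx_mul trmxK trmx_inv GT mulmxA.
- by rewrite !mulmxA -(mulmxA _ B B^T) -/G -(mulmxA _ (invmx G) G) mulVmx // mulmx1.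
- have /submxP[D ->] := MB.
  by rewrite -!mulmxA (mulmxA B B^T) -/G mulKVmx.
- by rewrite -mulmxA mxtrace_mulC -mulmxA -/G mulVmx // mxtrace1 ler_nat.
Qed.

(** On average over signs the cross terms cancel, and P P^T = P turns the mean of |x P|^2 into the
    right side; some sign vector does no worse than the mean. *)
Lemma signed_proj (R : realType) (N : nat) (P : 'M[R]_N) (s : 'I_N -> R) :
  P^T = P -> P *m P = P -> exists w : signs 'I_N,
    \sum_j ((\row_l (sg R (w l) * s l)) *m P) 0 j ^+ 2 <= \sum_l s l ^+ 2 * P l l.
Proof.
move=> PT PP; set c := \sum_l _.
pose F (w : signs 'I_N) := \sum_j ((\row_l (sg R (w l) * s l)) *m P) 0 j ^+ 2.
have FE w : F w = \sum_j dot w (fun l => s l * P l j) ^+ 2.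
  apply: eq_bigr => j _; rewrite mxE; congr (_ ^+ 2).
  by apply: eq_bigr => l _; rewrite mxE mulrA.
apply: contrapT => /forallNP H.
have : avg (fun _ : signs 'I_N => c) < avg F.
  apply: (avg_lt [ffun=> true]) => w; rewrite ltNge; apply/negP => h.
  exact: (H w).
rewrite avg_const; last exact: [ffun=> true].
rewrite (avg_ext FE) avg_sum.
under eq_bigr do rewrite avg_dot2.
rewrite exchange_big /= => h; move: (h).
suff -> : \sum_l \sum_j (s l * P l j) ^+ 2 = c by rewrite ltxx.
apply: eq_bigr => l _; under eq_bigr do rewrite exprMn.
rewrite -mulr_sumr; congr (_ * _).
rewrite -[in RHS]PP mxE; apply: eq_bigr => j _.
by rewrite -{3}PT mxE.
Qed.

(** A cyclic interval of length l starting at [al], subtraction being modulo m' + 1. The translates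
    cover every index equally often, so they replace the family of all subsets of size l in
    averages. *)
Definition arc (m' l : nat) (al : 'I_m'.+1) : {set 'I_m'.+1} :=
  [set i | ((i - al)%R < l)%N]%SET.

Lemma sum_ltn_ord (m l : nat) : (l <= m)%N -> (\sum_(i < m) (i < l)%N = l)%N.
Proof.
move=> lm; rewrite -[RHS]card_ord -sum1_card (big_ord_widen m (fun=> 1%N) lm).
by rewrite [RHS]big_mkcond /=; apply: eq_bigr => i _; case: ltnP.
Qed.

Lemma card_arc (m' l : nat) (al : 'I_m'.+1) : (l <= m'.+1)%N -> #|arc l al| = l.
Proof.
move=> lm; rewrite -[RHS](sum_ltn_ord lm) -sum1dep_card big_mkcond.
rewrite (reindex_inj (addIr al)); apply: eq_bigr => i _.
have -> : ((i + al) - al)%R = i by rewrite addrK.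
by case: ltnP.
Qed.

Lemma sum_arc (m' l : nat) (i : 'I_m'.+1) : (l <= m'.+1)%N ->
  (\sum_al (i \in arc l al) = l)%N.
Proof.
move=> lm; rewrite -[RHS](sum_ltn_ord lm).
rewrite (reindex_inj (inj_comp (addrI i) oppr_inj)).
apply: eq_bigr => j _; rewrite inE.
by have -> : (i - (i + - j))%R = j by rewrite opprD addrA subrr add0r opprK.
Qed.

(** Averaging over the m k cyclic translates of an l by r rectangle: each entry is covered l r
    times, so the mean of the trace of P over the rectangle is l r tr P / (m k). *)
Lemma rect_proj (R : realType) (m k n l r : nat) (P : 'M[R]_(m * k)) :
  (0 < m)%N -> (0 < k)%N -> (0 < l <= m)%N -> (0 < r <= k)%N ->
  P^T = P -> P *m P = P -> \tr P <= n%:R ->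
  exists (S1 : {set 'I_m}) (S2 : {set 'I_k}) (x : 'M[R]_(m, k)),
    [/\ #|S1| = l, #|S2| = r,
      forall i j, `|x i j| = ((i \in S1) && (j \in S2))%:R &
      \sum_j (mxvec x *m P) 0 j ^+ 2 <= (l * r)%:R * n%:R / (m * k)%:R].
Proof.
case: m P => // m' P; case: k P => // k' P _ _ /andP[l0 lm] /andP[r0 rk] PT PP trP.
set m := m'.+1 in P lm PT PP trP *; set k := k'.+1 in P rk PT PP trP *.
pose ind (al : 'I_m * 'I_k) i j : R := ((i \in arc l al.1) && (j \in arc r al.2))%:R.
pose pd i j := P (mxvec_index i j) (mxvec_index i j).
pose val al := \sum_i \sum_j ind al i j * pd i j.
have Pd0 q : 0 <= P q q.
  rewrite -PP mxE; apply: sumr_ge0 => q' _.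
  by rewrite -{2}PT mxE -expr2 sqr_ge0.
have [al hal] : exists al, val al <= (l * r)%:R * n%:R / (m * k)%:R.
  apply: contrapT => /forallNP H.
  pose al0 : 'I_m * 'I_k := (0, 0).
  have : avg (fun _ : 'I_m * 'I_k => (l * r)%:R * n%:R / (m * k)%:R) < avg val.
    by apply: (avg_lt al0) => al; rewrite ltNge; apply/negP => h; exact: (H al).
  rewrite avg_const //; apply/negP; rewrite -leNgt.
  have -> : avg val = (l * r)%:R / (m * k)%:R * \tr P.
    rewrite /avg card_prod !card_ord /val.
    under eq_bigr do rewrite pair_bigA.
    rewrite exchange_big /=.
    rewrite (eq_bigr (fun p => (l * r)%:R * pd p.1 p.2)); last first.
      move=> [i j] _; rewrite -mulr_suml; congr (_ * _) => /=.
      rewrite -(pair_big xpredT xpredT (fun x1 x2 => ind (x1, x2) i j)) /=.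
      rewrite (eq_bigr (fun x1 => (i \in arc l x1)%:R * r%:R)); last first.
        move=> x1 _; rewrite -(sum_arc j rk) natr_sum mulr_sumr.
        by apply: eq_bigr => x2 _; rewrite /ind /= -natrM mulnb.
      by rewrite -mulr_suml -natr_sum sum_arc // natrM.
    rewrite -mulr_sumr mulrA [_^-1 * _]mulrC; congr (_ * _).
    rewrite /mxtrace (reindex _ (curry_mxvec_bij m k)) /=.
    by apply: eq_bigr => -[i j] _.
  by rewrite mulrAC ler_pM2r ?invr_gt0 ?ltr0n ?muln_gt0 // ler_wpM2l.
have [w hw] := signed_proj (fun q => mxvec (\matrix_(i, j) ind al i j) 0 q) PT PP.
exists (arc l al.1), (arc r al.2),
  (\matrix_(i, j) (sg R (w (mxvec_index i j)) * ind al i j)); split.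
- exact: card_arc.
- exact: card_arc.
- move=> i j; rewrite mxE normrM /ind.
  have -> : `|sg R (w (mxvec_index i j))| = 1 by rewrite /sg normr_sign.
  by rewrite mul1r ger0_norm.
apply: le_trans hal; apply: le_trans (le_trans hw _).
  rewrite le_eqVlt; apply/orP; left; apply/eqP; apply: eq_bigr => q _.
  congr (_ ^+ 2); congr ((_ *m P) 0 q); apply/rowP => q'.
  case: (mxvec_indexP q') => i j; by rewrite [RHS]mxE !mxvecE !mxE.
rewrite /val pair_bigA /= (reindex _ (curry_mxvec_bij m k)) /=.
rewrite le_eqVlt; apply/orP; left; apply/eqP; apply: eq_bigr => -[i j] _ /=.
by rewrite mxvecE mxE /pd /ind; case: andP; rewrite ?expr1n ?expr0n.
Qed.

Lemma vspace_proj (R : realType) (m k : nat) (L : {vspace 'M[R]_(m, k)}) :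
  exists P : 'M[R]_(m * k), [/\ P^T = P, P *m P = P,
    forall y, y \in L -> mxvec y *m P = mxvec y & \tr P <= (\dim L)%:R].
Proof.
pose M : 'M[R]_(\dim L, m * k) := \matrix_(t < \dim L) mxvec (vbasis L)`_t.
have [P [PT PP MP tP]] := orth_proj M.
exists P; split => // y yL.
have -> : mxvec y = (\row_t coord (vbasis L) t y) *m M.
  rewrite {1}(coord_vbasis yL) linear_sum mulmx_sum_row.
  by apply: eq_bigr => t _; rewrite linearZ /= rowK mxE.
by rewrite -mulmxA MP.
Qed.

Section RectNorm.
Variables (R : realType) (m k : nat) (S1 : {set 'I_m}) (S2 : {set 'I_k}).
Variable x : 'I_m -> 'I_k -> R.
Hypothesis xS : forall i j, `|x i j| = ((i \in S1) && (j \in S2))%:R.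
Hypotheses (S10 : (0 < #|S1|)%N) (S20 : (0 < #|S2|)%N).

Lemma nrm2_rect u v : 0 <= u -> 0 <= v ->
  nrm2 u v x = #|S1|%:R `^ u * #|S2|%:R `^ v.
Proof.
move=> u0 v0; set c := #|S1|%:R `^ u.
have c0 : 0 <= c by exact: powR_ge0.
rewrite /nrm2 (nrm_indic (S := S2) (c := c)) ?ger0_norm // => j.
rewrite ger0_norm ?nrm_ge0 //; case: ifP => jS.
  rewrite (nrm_indic (S := S1) (c := 1)) ?normr1 ?mul1r ?ger0_norm // => i.
  by rewrite xS jS andbT; case: ifP.
by apply: nrm_zero => i; apply/eqP; rewrite -normr_eq0 xS jS andbF.
Qed.

(** The l_1 norm of the entrywise product, supported on the rectangle, is compared with the mixed
    norm by [nrm_inc] in each index. *)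
Lemma dot_rect_le a b (z : 'I_m -> 'I_k -> R) : 0 <= a <= 1 -> 0 <= b <= 1 ->
  \sum_i \sum_j x i j * z i j <=
  #|S1|%:R `^ (1 - a) * #|S2|%:R `^ (1 - b) * nrm2 a b z.
Proof.
move=> /andP[a0 a1] /andP[b0 b1].
have n1 N (v : 'I_N -> R) : nrm 1 v = \sum_i `|v i|.
  rewrite nrmE ?oner_eq0 // invr1 powRr1.
    by apply: eq_bigr => i _; rewrite powRr1.
  by apply: sumr_ge0 => i _; exact: powR_ge0.
pose zz i j := x i j * z i j.
apply: (@le_trans _ _ (nrm2 1 1 zz)).
  rewrite /nrm2 n1 exchange_big /=; apply: ler_sum => j _.
  rewrite ger0_norm ?nrm_ge0 // n1; apply: ler_sum => i _; exact: ler_norm.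
have zzle i j : `|zz i j| <= `|z i j|.
  by rewrite normrM xS; case: andP; rewrite ?mul1r ?mul0r.
have zz1 i j : i \notin S1 -> zz i j = 0.
  move=> /negbTE iS; apply/eqP; rewrite -normr_eq0 normrM xS iS.
  by rewrite mul0r.
have zz2 i j : j \notin S2 -> zz i j = 0.
  move=> /negbTE jS; apply/eqP; rewrite -normr_eq0 normrM xS jS andbF.
  by rewrite mul0r.
apply: (@le_trans _ _ (#|S1|%:R `^ (1 - a) * nrm2 a 1 zz)).
  rewrite -[X in X * _]ger0_norm ?powR_ge0 // -nrmZ.
  apply: nrm_mono => // j.
  rewrite !ger0_norm ?mulr_ge0 ?powR_ge0 ?nrm_ge0 //.
  by apply: nrm_inc => // i iS; rewrite zz1.
rewrite -mulrA ler_wpM2l ?powR_ge0 //.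
apply: (@le_trans _ _ (#|S2|%:R `^ (1 - b) * nrm2 a b zz)).
  apply: nrm_inc => // j jS; apply: nrm_zero => i; exact: zz2.
by rewrite ler_wpM2l ?powR_ge0 // nrm2_mono.
Qed.

End RectNorm.

(** The error z = x - y is tested against x - x P, which is orthogonal to the subspace; the product
    is |x|^2 - |x P|^2 >= l r / 2. Hoelder on the rectangle bounds the part from x by e l r / U, and
    Cauchy-Schwarz the part from x P by e l r / W, so e is at least min (U, W) / 4. *)
Lemma width_lower_rect (R : realType) (a b : R) (m k n l r : nat)
    (L : {vspace 'M[R]_(m, k)}) :
  0 < a <= 2^-1 -> 0 < b <= 2^-1 -> (0 < m)%N -> (0 < k)%N ->
  (0 < l <= m)%N -> (0 < r <= k)%N -> n%:R <= (m * k)%:R / 2 :> R ->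
  (\dim L <= n)%N ->
  exists x : 'M[R]_(m, k),
    (forall u v, 0 <= u -> 0 <= v -> nrm2 u v x = l%:R `^ u * r%:R `^ v) /\
    forall y, y \in L ->
      4^-1 * Num.min (l%:R `^ a * r%:R `^ b)
                     (base a b m k n * l%:R `^ 2^-1 * r%:R `^ 2^-1)
      <= nrm2 a b (x - y).
Proof.
move=> /andP[a0 a2] /andP[b0 b2] m0 k0 hl hr hn dL.
have [P [PT PP PL tP]] := vspace_proj L.
have tPn : \tr P <= n%:R by apply: le_trans tP _; rewrite ler_nat.
have [S1 [S2 [x [c1 c2 xS xP]]]] := rect_proj m0 k0 hl hr PT PP tPn.
have l0 : (0 < l)%N by case/andP: hl.
have r0 : (0 < r)%N by case/andP: hr.
have S10 : (0 < #|S1|)%N by rewrite c1.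
have S20 : (0 < #|S2|)%N by rewrite c2.
exists x; split.
  by move=> u v u0 v0; rewrite (nrm2_rect xS) // c1 c2.
move=> y yL; set z := x - y; set e := nrm2 a b z.
have e0 : 0 <= e by exact: nrm2_ge0.
have lR : 0 < l%:R :> R by rewrite ltr0n.
have rR : 0 < r%:R :> R by rewrite ltr0n.
have mR : 0 < m%:R :> R by rewrite ltr0n.
have kR : 0 < k%:R :> R by rewrite ltr0n.
pose X := mxvec x; pose Z := mxvec z; pose Y := mxvec y.
have XX : \sum_q X 0 q ^+ 2 = l%:R * r%:R.
  rewrite (sum_mxvec (fun t => t ^+ 2)).
  have S0 : 0 <= \sum_i \sum_j x i j ^+ 2.
    by apply: sumr_ge0 => i _; apply: sumr_ge0 => j _; exact: sqr_ge0.
  have h2 : 0 <= 2^-1 :> R by rewrite invr_ge0.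
  have := @nrm2_diag R m k 2 x isT isT; rewrite (nrm2_rect xS) // c1 c2.
  rewrite -powRM ?(ltW lR) ?(ltW rR) // => /(congr1 (fun t => t `^ 2)).
  rewrite -!powRrM mulVf ?pnatr_eq0 // (powRr1 S0) powRr1 => [<- //|].
  by rewrite mulr_ge0 // ltW.
have dots : (X *m Z^T) 0 0 - (X *m P *m Z^T) 0 0 =
    \sum_q X 0 q ^+ 2 - \sum_q (X *m P) 0 q ^+ 2.
  have ZE : Z = X - Y by rewrite /Z /z linearB.
  have YP : Y^T = P *m Y^T by rewrite -[in RHS]PT -trmx_mul /Y PL.
  have -> : \sum_q X 0 q ^+ 2 = (X *m X^T) 0 0 by rewrite dot_rV.
  have -> : \sum_q (X *m P) 0 q ^+ 2 = (X *m P *m X^T) 0 0.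
    have -> : X *m P *m X^T = (X *m P) *m (X *m P)^T.
      by rewrite trmx_mul PT mulmxA -(mulmxA X P P) PP.
    by rewrite dot_rV.
  rewrite ZE linearB /= !mulmxBr -[X *m P *m Y^T]mulmxA -YP !mxE.
  by ring.
have lrR : 0 < l%:R * r%:R :> R by rewrite mulr_gt0.
have low : l%:R * r%:R / 2 <= \sum_q X 0 q ^+ 2 - \sum_q (X *m P) 0 q ^+ 2.
  have : l%:R * r%:R * n%:R / (m * k)%:R <= l%:R * r%:R / 2 :> R.
    rewrite -!mulrA !ler_pM2l // ler_pdivrMr ?natrM ?mulr_gt0 //.
    by move: hn; rewrite natrM; lra.
  by move: xP; rewrite XX -/X natrM; lra.
have up1 : (X *m Z^T) 0 0 <= l%:R `^ (1 - a) * r%:R `^ (1 - b) * e.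
  have -> : (X *m Z^T) 0 0 = \sum_i \sum_j x i j * z i j.
    rewrite dot_rV pair_bigA /= (reindex _ (curry_mxvec_bij m k)) /=.
    by apply: eq_bigr => -[i j] _; rewrite /X /Z !mxvecE.
  have := @dot_rect_le R m k S1 S2 x xS a b z; rewrite c1 c2; apply.
    by rewrite (ltW a0); move: a2; lra.
  by rewrite (ltW b0); move: b2; lra.
have sZ : Num.sqrt (\sum_q Z 0 q ^+ 2) <=
    m%:R `^ (2^-1 - a) * k%:R `^ (2^-1 - b) * e.
  have -> : Num.sqrt (\sum_q Z 0 q ^+ 2) = nrm2 2^-1 2^-1 z.
    rewrite (sum_mxvec (fun t => t ^+ 2)) (@nrm2_diag _ _ _ 2) // powR12_sqrt //.
    by apply: sumr_ge0 => i _; apply: sumr_ge0 => j _; exact: sqr_ge0.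
  have h2 : 0 <= 2^-1 :> R by rewrite invr_ge0.
  have := nrm2_embed z (ltW a0) h2 (ltW b0) h2.
  by rewrite !max_r ?subr_ge0.
have up2 : - (X *m P *m Z^T) 0 0 <=
    Num.sqrt (l%:R * r%:R * n%:R / (m * k)%:R) *
      (m%:R `^ (2^-1 - a) * k%:R `^ (2^-1 - b) * e).
  have -> : - (X *m P *m Z^T) 0 0 = \sum_q (- (X *m P) 0 q) * Z 0 q.
    by rewrite dot_rV -sumrN; apply: eq_bigr => q _; rewrite mulNr.
  apply: le_trans (cauchy_schwarz _ _) _; apply: ler_pM; rewrite ?sqrtr_ge0 //.
  apply: ler_wsqrtr; under eq_bigr do rewrite sqrrN.
  by move: xP; rewrite natrM.
set U := l%:R `^ a * r%:R `^ b.
set W := base a b m k n * l%:R `^ 2^-1 * r%:R `^ 2^-1.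
have U0 : 0 < U by rewrite mulr_gt0 ?powR_gt0.
have W0 : 0 < W by rewrite !mulr_gt0 ?powR_gt0 // base_gt0.
have E1 : l%:R `^ (1 - a) * r%:R `^ (1 - b) = l%:R * r%:R / U.
  rewrite !powRB ?(gt_eqF lR) ?(gt_eqF rR) ?implybT // !powRr1 ?(ltW lR) ?(ltW rR) //.
  by rewrite /U; field; rewrite !gt_eqF ?powR_gt0.
(* An equality for n > 0; for n = 0 the left side is zero while [base] is 1. *)
have E2 : Num.sqrt (l%:R * r%:R * n%:R / (m * k)%:R) *
      (m%:R `^ (2^-1 - a) * k%:R `^ (2^-1 - b)) <= l%:R * r%:R / W.
  have [n0|n0] := posnP n.
    have -> : n%:R = 0 :> R by rewrite n0.
    rewrite mulr0 mul0r sqrtr0 mul0r.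
    exact: (divr_ge0 (ltW lrR) (ltW W0)).
  rewrite /W /base (gtn_eqF n0).
  have nR : 0 < n%:R :> R by rewrite ltr0n.
  rewrite le_eqVlt; apply/orP; left; apply/eqP.
  rewrite !powRB ?(gt_eqF mR) ?(gt_eqF kR) ?implybT // powRN.
  rewrite !powR12_sqrt ?ler0n // natrM.
  have sq (t : R) : 0 < t -> 0 < Num.sqrt t /\ t = Num.sqrt t ^+ 2.
    by move=> t0; rewrite sqrtr_gt0 sqr_sqrtr // ltW.
  have [sl0 slE] := sq _ lR; have [sr0 srE] := sq _ rR.
  have [sm0 smE] := sq _ mR; have [sk0 skE] := sq _ kR.
  have [sn0 snE] := sq _ nR.
  set sl := Num.sqrt l%:R in sl0 slE *; set sr := Num.sqrt r%:R in sr0 srE *.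
  set sm := Num.sqrt m%:R in sm0 smE *; set sk := Num.sqrt k%:R in sk0 skE *.
  set sn := Num.sqrt n%:R in sn0 snE *.
  have -> : l%:R * r%:R * n%:R / (m%:R * k%:R) = (sl * sr * sn / (sm * sk)) ^+ 2.
    by rewrite slE srE snE smE skE; field; rewrite !gt_eqF.
  rewrite sqrtr_sqr ger0_norm; last first.
    by rewrite divr_ge0 // !mulr_ge0 // ltW.
  rewrite slE srE; field; rewrite !gt_eqF ?powR_gt0 //.
have main : l%:R * r%:R / 2 <= e * (l%:R * r%:R / U + l%:R * r%:R / W).
  apply: le_trans low _; rewrite -dots.
  apply: le_trans (lerD up1 up2) _; rewrite E1 mulrDr mulrC.
  rewrite lerD2l mulrA -[leLHS]mulrC.
  exact: ler_wpM2l.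
set mn := Num.min U W.
have mn0 : 0 < mn by rewrite lt_min U0 W0.
have hU : U^-1 <= mn^-1 by rewrite lef_pV2 ?posrE // ge_min lexx.
have hW : W^-1 <= mn^-1 by rewrite lef_pV2 ?posrE // ge_min lexx orbT.
have : 2^-1 <= e * (2 * mn^-1).
  rewrite -(ler_pM2l lrR); apply: le_trans main _.
  rewrite -mulrDr mulrCA ler_wpM2l ?(ltW lrR) // ler_wpM2l //.
  by move: hU hW; lra.
rewrite [e * _]mulrC -mulrA [mn^-1 * _]mulrC mulrA ler_pdivlMr // => h.
by move: h; lra.
Qed.

(** * The function Phi as a minimum *)

Section Reciprocal.
Variable R : realType.
Implicit Type p : \bar R.

Lemma rcp_itv p : (1 <= p)%E -> 0 <= rcp p <= 1.
Proof.
case: p => [r| |] //; rewrite /rcp ?lee_fin => r1.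
  have r0 : 0 < r by apply: lt_le_trans r1.
  by rewrite inver gt_eqF //= invr_ge0 (ltW r0) invf_le1.
by rewrite invey /= lexx ler01.
Qed.

Lemma rcp_fin (r : R) : r != 0 -> rcp r%:E = r^-1.
Proof. by move=> r0; rewrite /rcp inver (negbTE r0). Qed.

Lemma rcpK p : (1 <= p)%E -> ((rcp p)%:E^-1)%E = p.
Proof.
case: p => [r| |] //; rewrite ?lee_fin => r1.
  have r0 : r != 0 by rewrite gt_eqF // (lt_le_trans _ r1).
  by rewrite rcp_fin // inver invr_eq0 (negbTE r0) invrK.
by rewrite /rcp invey /= inve0.
Qed.

Lemma rcp_inve (u : R) : 0 <= u -> rcp (u%:E^-1)%E = u.
Proof.
move=> u0; have [->|un] := eqVneq u 0; first by rewrite /rcp inve0 invey.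
have -> : (u%:E^-1)%E = (u^-1)%:E by rewrite inver (negbTE un).
by rewrite rcp_fin ?invr_eq0 // invrK.
Qed.

Lemma inve_ge1 (u : R) : 0 <= u <= 1 -> (1 <= u%:E^-1)%E.
Proof.
move=> /andP[u0 u1]; rewrite inver; have [_|un] := eqVneq u 0; first exact: leey.
have up : 0 < u by rewrite lt0r un u0.
by rewrite lee_fin -[leLHS]invr1 lef_pV2 ?posrE.
Qed.

Lemma lee_rcp (r : R) p : 0 < r -> (1 <= p)%E -> (r%:E <= p)%E = (rcp p <= r^-1).
Proof.
case: p => [s| |] // r0 s1; last by rewrite /rcp invey /= invr_ge0 (ltW r0) leey.
have s0 : 0 < s by move: s1; rewrite lee_fin; exact: lt_le_trans.
by rewrite rcp_fin ?gt_eqF // lee_fin lef_pV2 ?posrE.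
Qed.

Lemma rcp_lee (r : R) p : 0 < r -> (1 <= p)%E -> (p <= r%:E)%E = (r^-1 <= rcp p).
Proof.
case: p => [s| |] // r0 s1; last first.
  by rewrite /rcp invey /= leye_eq /= leNgt invr_gt0 r0.
have s0 : 0 < s by move: s1; rewrite lee_fin; exact: lt_le_trans.
by rewrite rcp_fin ?gt_eqF // lee_fin lef_pV2 ?posrE.
Qed.

(** [omega] is where the positive part in [phi] starts to grow, with slope 1/2 - 1/q. For q = 2 the
    slope is zero and the value 1 is consistent with this. *)
Lemma omega_spec (q : R) p : 2 <= q -> q^-1 <= rcp p ->
  [/\ 0 <= omega q p <= 1,
    forall mu, mu <= 1 -> Num.max 0 (q^-1 + mu * (2^-1 - q^-1) - rcp p) =
      (2^-1 - q^-1) * Num.max 0 (mu - omega q p),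
    rcp p <= 2^-1 -> rcp p - q^-1 = (2^-1 - q^-1) * omega q p &
    2^-1 <= rcp p -> omega q p = 1].
Proof.
rewrite /omega; set a := q^-1; set u := rcp p.
move=> q2 au; have q0 : 0 < q by apply: lt_le_trans q2.
have a2 : a <= 2^-1 by rewrite lef_pV2 ?posrE.
case: ltP => [q2'|q2'].
  have a2' : 0 < 2^-1 - a by rewrite subr_gt0 ltf_pV2 ?posrE.
  set o := (u - a) / (2^-1 - a).
  have oE : o * (2^-1 - a) = u - a by rewrite divfK // gt_eqF.
  have o0 : 0 <= o by rewrite divr_ge0 ?(ltW a2') // subr_ge0.
  split.
  - by rewrite le_min o0 ler01 ge_min lexx orbT.
  - move=> mu mu1.
    have -> : a + mu * (2^-1 - a) - u = (2^-1 - a) * (mu - o).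
      have -> : (2^-1 - a) * (mu - o) = (2^-1 - a) * mu - o * (2^-1 - a) by ring.
      by rewrite oE; ring.
    rewrite -{1}(mulr0 (2^-1 - a)) -maxr_pMr ?(ltW a2') //; congr (_ * _).
    have [h1|h1] := leP o 1; first by [].
    by rewrite !max_l //; rewrite subr_le0 // (le_trans mu1) // ltW.
  - move=> u2; rewrite min_l; first by rewrite mulrC oE.
    by rewrite ler_pdivrMr // mul1r lerD2r.
  - move=> u2; rewrite min_r // ler_pdivlMr // mul1r lerD2r //.
have aE : a = 2^-1 by congr (_^-1); apply/eqP; rewrite eq_le q2 q2'.
split => //.
- by rewrite ler01 lexx.
- move=> mu mu1; rewrite aE subrr mulr0 addr0 mul0r max_l // subr_le0 -aE //.
- by move=> u2; rewrite aE subrr mul0r; move: au; rewrite aE; lra.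
Qed.

End Reciprocal.

Section PhiMin.
Variables (R : realType) (q sigma : R) (m k n : nat).
Hypotheses (q2 : 2 <= q) (s2 : 2 <= sigma) (m0 : (0 < m)%N) (k0 : (0 < k)%N).
Hypothesis hn : n%:R <= (m * k)%:R / 2 :> R.
Let a := q^-1.
Let b := sigma^-1.
Let lm : R := ln m%:R.
Let lk : R := ln k%:R.
Let t : R := ln (base a b m k n).
Let A := lm * (2^-1 - a).
Let B := lk * (2^-1 - b).

Let q0 : 0 < q. Proof. exact: lt_le_trans q2. Qed.
Let s0 : 0 < sigma. Proof. exact: lt_le_trans s2. Qed.
Let mR : 0 < m%:R :> R. Proof. by rewrite ltr0n. Qed.
Let kR : 0 < k%:R :> R. Proof. by rewrite ltr0n. Qed.
Let a2 : a <= 2^-1. Proof. by rewrite lef_pV2 ?posrE. Qed.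
Let b2 : b <= 2^-1. Proof. by rewrite lef_pV2 ?posrE. Qed.
Let lm0 : 0 <= lm. Proof. by apply: ln_ge0; rewrite ler1n. Qed.
Let lk0 : 0 <= lk. Proof. by apply: ln_ge0; rewrite ler1n. Qed.
Let A0 : 0 <= A. Proof. by rewrite mulr_ge0 // subr_ge0. Qed.
Let B0 : 0 <= B. Proof. by rewrite mulr_ge0 // subr_ge0. Qed.

Let t0E : n = 0%N -> t = 0.
Proof. by move=> n0; rewrite /t /base n0 eqxx ln1. Qed.

Let tE : (0 < n)%N -> t = - 2^-1 * ln n%:R + a * lm + b * lk.
Proof.
move=> n0; have nR : 0 < n%:R :> R by rewrite ltr0n.
by rewrite /t /base (gtn_eqF n0) !powR_expR // -!expRD expRK.
Qed.

(** For n > 0 the sum is (ln (m k) - ln n)/2. It is the slope of [phi] beyond all kinks, so the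
    minimum never lies past the last kink. *)
Let tAB : 0 <= t + A + B.
Proof.
have [n0|n0] := posnP n; first by rewrite (t0E n0) add0r addr_ge0.
have nR : 0 < n%:R :> R by rewrite ltr0n.
have : ln n%:R <= ln m%:R + ln k%:R :> R.
  rewrite -lnM ?posrE // ler_ln ?posrE ?mulr_gt0 // -natrM.
  have : 0 < (m * k)%:R :> R by rewrite ltr0n muln_gt0 m0.
  by move: hn; lra.
by rewrite (tE n0) /A /B -/lm -/lk; lra.
Qed.


Definition phi_min (F : R -> R) (P : R) : Prop :=
  (exists2 mu, 0 <= mu <= 1 & P = expR (F mu)) /\
  forall mu, 0 <= mu <= 1 -> P <= expR (F mu).

Let nE : (0 < n)%N -> n%:R `^ (- 2^-1) = expR (t - a * lm - b * lk).
Proof.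
move=> n0; have nR : 0 < n%:R :> R by rewrite ltr0n.
by rewrite powR_expR // (tE n0); congr expR; ring.
Qed.

Let mE x : m%:R `^ x = expR (x * lm). Proof. exact: powR_expR. Qed.
Let kE x : k%:R `^ x = expR (x * lk). Proof. exact: powR_expR. Qed.

Let expP (x y : R) : expR x `^ y = expR (y * x).
Proof. by rewrite powR_expR ?expR_gt0 // expRK. Qed.

Let max0_le (u : R) mu : 0 <= mu -> u <= a ->
  Num.max 0 (a + mu * (2^-1 - a) - u) = a - u + mu * (2^-1 - a).
Proof.
move=> mu0 ua; rewrite max_r; first by ring.
by rewrite -addrA [_ - u]addrC addrA addr_ge0 ?subr_ge0 // mulr_ge0 // subr_ge0.
Qed.

Let max0_le' (v : R) mu : 0 <= mu -> v <= b ->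
  Num.max 0 (b + mu * (2^-1 - b) - v) = b - v + mu * (2^-1 - b).
Proof.
move=> mu0 vb; rewrite max_r; first by ring.
by rewrite -addrA [_ - v]addrC addrA addr_ge0 ?subr_ge0 // mulr_ge0 // subr_ge0.
Qed.

(** A convex piecewise linear function with slopes s and then s + D >= 0 is minimal at 0 or at the
    kink w. *)
Let phi_min_kink (f w s D : R) : 0 <= w <= 1 -> 0 <= D -> 0 <= s + D ->
  (0 < n)%N -> phi_min (fun mu => f + mu * s + D * Num.max 0 (mu - w))
    (minterms n (expR f) [:: expR (f + w * s)]).
Proof.
move=> /andP[w0 w1] D0 sD n0; rewrite /minterms (gtn_eqF n0) big_cons big_nil; split.
  have [h|h] := leP (expR (f + w * s)) (expR f).
    by exists w; [rewrite w0|rewrite subrr maxxx mulr0 addr0].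
  exists 0; first by rewrite lexx ler01.
  by rewrite mul0r addr0 max_l ?mulr0 ?addr0 // sub0r oppr_le0.
move=> mu /andP[mu0 mu1]; rewrite ge_min !ler_expR.
have [h|/ltW h] := leP mu w.
  rewrite max_l ?subr_le0 // mulr0 addr0 lerD2l lerDl.
  have [s0'|/ltW s0'] := leP 0 s; first by rewrite mulr_ge0 ?orbT.
  by rewrite ler_wnM2r.
rewrite max_r ?subr_ge0 //; apply/orP; left.
have : 0 <= (mu - w) * (s + D) by rewrite mulr_ge0 // subr_ge0.
by lra.
Qed.

Lemma phi_ext_min (F G : R -> R) P : (forall mu, 0 <= mu <= 1 -> F mu = G mu) ->
  phi_min G P -> phi_min F P.
Proof.
move=> FG [[mu hmu ->] h]; split; first by exists mu => //; rewrite FG.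
by move=> nu hnu; rewrite FG // h.
Qed.

(** With two kinks and a nonnegative last slope the minimum is at 0, w1 or w2: these are the three
    terms in the fourth and fifth branches of [Phi]. *)
Let phi_min_kinks (w1 w2 D1 D2 : R) : 0 <= w1 -> w1 <= w2 -> w2 <= 1 -> 0 <= D1 -> 0 <= D2 ->
  0 <= t + D1 + D2 -> (0 < n)%N ->
  phi_min (fun mu => mu * t + D1 * Num.max 0 (mu - w1) + D2 * Num.max 0 (mu - w2))
    (minterms n 1 [:: expR (w1 * t); expR (w2 * t + D1 * (w2 - w1))]).
Proof.
move=> w10 w12 w21 D10 D20 hD n0; rewrite /minterms (gtn_eqF n0) !big_cons big_nil.
have -> : 1 = expR 0 :> R by rewrite expR0.
have F1 : w1 * t = w1 * t + D1 * Num.max 0 (w1 - w1) + D2 * Num.max 0 (w1 - w2).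
  by rewrite subrr maxxx mulr0 addr0 max_l ?subr_le0 // mulr0 addr0.
have F2 : w2 * t + D1 * (w2 - w1) =
    w2 * t + D1 * Num.max 0 (w2 - w1) + D2 * Num.max 0 (w2 - w2).
  by rewrite subrr maxxx mulr0 addr0 max_r // subr_ge0.
have F0 : 0 = 0 * t + D1 * Num.max 0 (0 - w1) + D2 * Num.max 0 (0 - w2).
  by rewrite mul0r !max_l ?sub0r ?oppr_le0 ?(le_trans w10) // !mulr0 !addr0.
split.
  have [_|_] := leP (expR (w2 * t + D1 * (w2 - w1))) (expR 0).
    have [_|_] := leP (expR (w1 * t)) (expR (w2 * t + D1 * (w2 - w1))).
      by exists w1; [rewrite w10 (le_trans w12)|rewrite -F1].
    by exists w2; [rewrite w21 (le_trans w10)|rewrite -F2].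
  have [_|_] := leP (expR (w1 * t)) (expR 0).
    by exists w1; [rewrite w10 (le_trans w12)|rewrite -F1].
  by exists 0; [rewrite lexx ler01|rewrite -F0].
move=> mu /andP[mu0 mu1]; rewrite !ge_min !ler_expR.
have [h|/ltW h] := leP mu w1.
  rewrite !max_l ?subr_le0 // ?(le_trans h) // !mulr0 !addr0.
  have [t0'|/ltW t0'] := leP 0 t; first by rewrite mulr_ge0 ?orbT.
  by rewrite ler_wnM2r.
have [h'|/ltW h'] := leP mu w2.
  rewrite max_r ?subr_ge0 // max_l ?subr_le0 // mulr0 addr0.
  have [s0'|/ltW s0'] := leP 0 (t + D1).
    apply/orP; left.
    have : 0 <= (mu - w1) * (t + D1) by rewrite mulr_ge0 // subr_ge0.
    by lra.
  apply/orP; right; apply/orP; left.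
  have : 0 <= (mu - w2) * (t + D1) by rewrite mulr_le0 // subr_le0.
  by lra.
rewrite !max_r ?subr_ge0 //; apply/orP; right; apply/orP; left.
have : 0 <= (mu - w2) * (t + D1 + D2) by rewrite mulr_ge0 // subr_ge0.
by lra.
Qed.

(** For n > 0 each branch lists exp phi at 0 and at the kinks. A coordinate with reciprocal exponent
    at most a (or b) has no kink, its positive part being affine on [0, 1]. *)
Lemma Phi_min (p theta : \bar R) : (1 <= p)%E -> (1 <= theta)%E ->
  phi_min (phi a b lm lk t (rcp p) (rcp theta)) (Phi q sigma m k n p theta).
Proof.
move=> p1 th1; set u := rcp p; set v := rcp theta.
have /andP[u0 u1] := rcp_itv p1; have /andP[v0 v1] := rcp_itv th1.
have two0 : 0 < 2 :> R by [].
rewrite /Phi (lee_rcp q0 p1) (lee_rcp s0 th1) (rcp_lee s0 th1) (rcp_lee q0 p1).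
rewrite (lee_rcp two0 p1) (lee_rcp two0 th1) -/a -/b -/u -/v.
set wp := omega q p; set wt := omega sigma theta.
have phiE mu : phi a b lm lk t u v mu = mu * t +
    lm * Num.max 0 (a + mu * (2^-1 - a) - u) +
    lk * Num.max 0 (b + mu * (2^-1 - b) - v) by [].
(* For n = 0 one has t = 0, so [phi] is nondecreasing and mu = 0 is optimal; this matches the
   omission of the other terms in [minterms]. *)
have n0P : n = 0%N -> forall P : R, P = expR (phi a b lm lk t u v 0) ->
    phi_min (phi a b lm lk t u v) P.
  move=> n0 P ->; split; first by exists 0 => //; rewrite lexx ler01.
  move=> mu /andP[mu0 mu1]; rewrite ler_expR !phiE (t0E n0) !mulr0 !add0r.
  rewrite !mul0r !addr0; apply: lerD; rewrite ler_wpM2l // le_max2 // lerD2r.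
    by rewrite lerDl mulr_ge0 // subr_ge0.
  by rewrite lerDl mulr_ge0 // subr_ge0.
have [ua|au] := leP u a; rewrite /=.
  have [vb|bv] := leP v b; rewrite /=.
    rewrite mE kE -expRD; split.
      exists 0; first by rewrite lexx ler01.
      by rewrite phiE max0_le // max0_le' // !mul0r !addr0 add0r ![lm * _]mulrC
        [lk * _]mulrC.
    move=> mu /andP[mu0 mu1]; rewrite ler_expR phiE max0_le // max0_le' //.
    have : 0 <= mu * (t + A + B) by rewrite mulr_ge0.
    by rewrite /A /B; lra.
  rewrite (ltW bv).
  have [w01 wE _ _] := omega_spec s2 (ltW bv); rewrite -/wt -/b -/v in w01 wE.
  have [n0|n0] := posnP n.
    apply: n0P => //; rewrite /minterms n0 eqxx phiE max0_le // !mul0r !addr0 add0r.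
    by rewrite max_l ?subr_le0 ?(ltW bv) // mulr0 addr0 mE mulrC.
  rewrite nE // !mE !kE -!expRD expP -expRD.
  have := @phi_min_kink ((a - u) * lm) wt (t + A) B w01 B0 tAB n0.
  have -> : (a - u) * lm + wt * (t + A) = (a - u) * lm +
      wt * (t - a * lm - b * lk + 2^-1 * lm + b * lk) by rewrite /A; ring.
  apply: phi_ext_min => mu /andP[mu0 mu1].
  by rewrite phiE max0_le // wE // /A /B; ring.
have [vb|bv] := leP v b; rewrite /=.
  rewrite (ltW au).
  have [w01 wE _ _] := omega_spec q2 (ltW au); rewrite -/wp -/a -/u in w01 wE.
  have [n0|n0] := posnP n.
    apply: n0P => //; rewrite /minterms n0 eqxx phiE [X in lk * X]max0_le' //.
    rewrite !mul0r !addr0 add0r.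
    by rewrite max_l ?subr_le0 ?(ltW au) // mulr0 add0r kE mulrC.
  rewrite nE // !mE !kE -!expRD expP -expRD.
  have tBA : 0 <= t + B + A by rewrite addrAC.
  have := @phi_min_kink ((b - v) * lk) wp (t + B) A w01 A0 tBA n0.
  have -> : (b - v) * lk + wp * (t + B) = (b - v) * lk +
      wp * (t - a * lm - b * lk + a * lm + 2^-1 * lk) by rewrite /B; ring.
  apply: phi_ext_min => mu /andP[mu0 mu1].
  by rewrite phiE [X in lk * X]max0_le' // wE // /A /B; ring.
rewrite (ltW au) (ltW bv) /=.
have [/andP[wp0 wp1] wpE wpu wp1E] := omega_spec q2 (ltW au).
have [/andP[wt0 wt1] wtE wtv wt1E] := omega_spec s2 (ltW bv).
rewrite -/wp -/wt -/a -/b -/u -/v in wp0 wp1 wpE wpu wp1E wt0 wt1 wtE wtv wt1E.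
have [n0|n0] := posnP n.
  apply: n0P => //; rewrite /minterms n0 eqxx phiE !mul0r !addr0 add0r.
  rewrite !max_l ?subr_le0 ?(ltW au) ?(ltW bv) // !mulr0 addr0 expR0.
  by case: ifP => // _; case: ifP.
have Tm : n%:R `^ (- 2^-1) * m%:R `^ a * k%:R `^ b = expR t.
  by rewrite nE // mE kE -!expRD; congr expR; ring.
rewrite Tm.
case: ifP => [/andP[u2 wpt]|].
  rewrite nE // !mE !kE -!expRD !expP -expRD.
  have -> : (a - u) * lm + wt * (t - a * lm - b * lk + 2^-1 * lm + b * lk)
      = wt * t + A * (wt - wp).
    have -> : a - u = - ((2^-1 - a) * wp) by rewrite -wpu //; ring.
    by rewrite /A; ring.
  apply: phi_ext_min (phi_min_kinks wp0 wpt wt1 A0 B0 tAB n0) => mu /andP[mu0 mu1].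
  by rewrite phiE wpE // wtE // /A /B; ring.
move=> /negbT; rewrite negb_and => c4.
case: ifP => [/andP[v2 wtp]|].
  rewrite nE // !mE !kE -!expRD !expP -expRD.
  have -> : (b - v) * lk + wp * (t - a * lm - b * lk + a * lm + 2^-1 * lk)
      = wp * t + B * (wp - wt).
    have -> : b - v = - ((2^-1 - b) * wt) by rewrite -wtv //; ring.
    by rewrite /B; ring.
  have tBA : 0 <= t + B + A by rewrite addrAC.
  apply: phi_ext_min (phi_min_kinks wt0 wtp wp1 B0 A0 tBA n0) => mu /andP[mu0 mu1].
  by rewrite phiE wpE // wtE // /A /B; ring.
move=> /negbT; rewrite negb_and => c5.
(* In the last branch both kinks are at 1: an omega below 1 would make one of the two preceding
   tests succeed. *)
have wpone : wp = 1.
  have [/ltW/wp1E //|u2] := ltP 2^-1 u.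
  move: c4; rewrite u2 /= -ltNge => wtp.
  have [/ltW/wt1E wt1'|v2] := ltP 2^-1 v.
    by move: wtp; rewrite wt1' ltNge wp1.
  by move: c5; rewrite v2 (ltW wtp).
have wtone : wt = 1.
  have [/ltW/wt1E //|v2] := ltP 2^-1 v.
  by move: c5; rewrite v2 wpone wt1.
have w01 : 0 <= (1 : R) <= 1 by rewrite ler01 lexx.
have tS : 0 <= t + (A + B) by rewrite addrA.
have := phi_min_kink 0 w01 (addr_ge0 A0 B0) tS n0; rewrite expR0 add0r mul1r.
apply: phi_ext_min => mu /andP[mu0 mu1].
by rewrite phiE wpE // wtE // wpone wtone /A /B; ring.
Qed.

End PhiMin.

(** * The intersection of balls *)

Local Open Scope classical_set_scope.
Local Open Scope ring_scope.

Lemma lnorm2E (R : realType) (m k : nat) (p theta : \bar R) (x : 'M[R]_(m, k)) :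
  (1 <= p)%E -> (1 <= theta)%E -> lnorm2 p theta x = nrm2 (rcp p) (rcp theta) x.
Proof. by move=> p1 t1; rewrite /nrm2 /nrm !rcpK. Qed.

Lemma mix2_itv (R : realType) (l x y : R) : 0 < l < 1 -> 0 <= x <= 1 ->
  0 <= y <= 1 -> 0 <= mix2 l x y <= 1.
Proof. by rewrite /mix2 => /andP[? ?] /andP[? ?] /andP[? ?]; nra. Qed.

(** Writes a three-point combination as two successive two-point ones, so that [nrm2_interp] applies
    twice. *)
Lemma mix3_eq (R : realType) (ta tb tc x y z : R) : 0 < ta -> 0 < tb ->
  ta + tb + tc = 1 ->
  mix3 ta tb tc x y z =
    (1 - tc) * ((1 - tb / (ta + tb)) * x + tb / (ta + tb) * y) + tc * z.
Proof.
move=> a0 b0 s; have n0 : ta + tb != 0 by rewrite gt_eqF // addr_gt0.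
have -> : 1 - tc = ta + tb by rewrite -s; ring.
by rewrite /mix3; field.
Qed.

Section Family.
Variables (R : realType) (m k : nat) (A : Type) (p theta : A -> \bar R).
Variable nu : A -> R.
Hypotheses (p1 : forall a, (1 <= p a)%E) (theta1 : forall a, (1 <= theta a)%E).
Hypothesis nu0 : forall a, 0 < nu a.
Notation u a := (rcp (p a)).
Notation v a := (rcp (theta a)).

Lemma ball_intersectionP (x : 'M[R]_(m, k)) :
  ball_intersection p theta nu x <-> forall a, nrm2 (u a) (v a) x <= nu a.
Proof.
split=> [Mx a|h a _].
  have [x' hx' <-] := Mx a I.
  move: hx'; rewrite /lball /= lnorm2E // => hx'.
  have -> : nrm2 (u a) (v a) (nu a *: x') = nu a * nrm2 (u a) (v a) x'.
    rewrite -[nu a in RHS]gtr0_norm // -nrm2Z; congr nrm2.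
    by apply/funext => i; apply/funext => j; rewrite mxE.
  by rewrite -[leRHS]mulr1 ler_wpM2l // ltW.
exists ((nu a)^-1 *: x); last by rewrite scalerA mulfV ?scale1r // gt_eqF.
rewrite /lball /= lnorm2E //.
have -> : nrm2 (u a) (v a) ((nu a)^-1 *: x) = (nu a)^-1 * nrm2 (u a) (v a) x.
  rewrite -[_^-1 in RHS]gtr0_norm ?invr_gt0 // -nrm2Z; congr nrm2.
  by apply/funext => i; apply/funext => j; rewrite mxE.
by rewrite mulrC ler_pdivrMr // mul1r.
Qed.

Let u0 a : 0 <= u a. Proof. by have /andP[] := rcp_itv (p1 a). Qed.
Let v0 a : 0 <= v a. Proof. by have /andP[] := rcp_itv (theta1 a). Qed.

Lemma powR_mul_le (x y z w l : R) : 0 < l < 1 -> 0 <= x <= z -> 0 <= y <= w ->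
  x `^ (1 - l) * y `^ l <= z `^ (1 - l) * w `^ l.
Proof.
move=> /andP[l0 l1] /andP[x0 xz] /andP[y0 yw].
apply: ler_pM; rewrite ?powR_ge0 //; apply: ge0_ler_powR; rewrite ?nnegrE //.
- by rewrite subr_ge0 ltW.
- exact: le_trans xz.
- exact: ltW.
- exact: le_trans yw.
Qed.

Lemma interp2 (x : 'M[R]_(m, k)) a b l : 0 < l < 1 ->
  ball_intersection p theta nu x ->
  nrm2 (mix2 l (u a) (u b)) (mix2 l (v a) (v b)) x <=
    nu a `^ (1 - l) * nu b `^ l.
Proof.
move=> l01 /ball_intersectionP Mx.
apply: le_trans (nrm2_interp x (u0 a) (u0 b) (v0 a) (v0 b) l01) _.
by apply: powR_mul_le => //; rewrite nrm2_ge0 Mx.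
Qed.

Lemma interp3 (x : 'M[R]_(m, k)) a b c ta tb tc : 0 < ta -> 0 < tb -> 0 < tc ->
  ta + tb + tc = 1 -> ball_intersection p theta nu x ->
  nrm2 (mix3 ta tb tc (u a) (u b) (u c)) (mix3 ta tb tc (v a) (v b) (v c)) x <=
    nu a `^ ta * nu b `^ tb * nu c `^ tc.
Proof.
move=> a0 b0 c0 s Mx; rewrite !mix3_eq //.
have ab0 : 0 < ta + tb by rewrite addr_gt0.
have c1 : 0 < tc < 1 by rewrite c0 -s ltrDr.
set l := tb / (ta + tb).
have l01 : 0 < l < 1 by rewrite divr_gt0 //= ltr_pdivrMr // mul1r ltrDr.
have h := interp2 a b l01 Mx.
have mu0 : 0 <= mix2 l (u a) (u b).
  by have /andP[] := mix2_itv l01 (rcp_itv (p1 a)) (rcp_itv (p1 b)).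
have mv0 : 0 <= mix2 l (v a) (v b).
  by have /andP[] := mix2_itv l01 (rcp_itv (theta1 a)) (rcp_itv (theta1 b)).
apply: le_trans (nrm2_interp x mu0 (u0 c) mv0 (v0 c) c1) _.
have -> : nu a `^ ta * nu b `^ tb = (nu a `^ (1 - l) * nu b `^ l) `^ (1 - tc).
  have sc : 1 - tc = ta + tb by rewrite -s; ring.
  have n0 : ta + tb != 0 by rewrite gt_eqF.
  rewrite powRM ?powR_ge0 // -!powRrM sc /l; congr (_ `^ _ * _ `^ _); by field.
apply: powR_mul_le => //; first by rewrite nrm2_ge0.
by rewrite nrm2_ge0; move/ball_intersectionP: Mx => ->.
Qed.

End Family.

(** * Comparison of the width with the quantities Psi_j *)

Section Main.
Variables (R : realType) (q sigma : R).
Hypotheses (q2 : 2 <= q) (s2 : 2 <= sigma).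
Let a := q^-1.
Let b := sigma^-1.
Let q0 : 0 < q. Proof. exact: lt_le_trans q2. Qed.
Let s0 : 0 < sigma. Proof. exact: lt_le_trans s2. Qed.
Let ha : 0 < a <= 2^-1. Proof. by rewrite invr_gt0 q0 lef_pV2 ?posrE. Qed.
Let hb : 0 < b <= 2^-1. Proof. by rewrite invr_gt0 s0 lef_pV2 ?posrE. Qed.
Let q1 : (1 <= q%:E)%E. Proof. by rewrite lee_fin (le_trans _ q2) // ler1n. Qed.
Let s1 : (1 <= sigma%:E)%E.
Proof. by rewrite lee_fin (le_trans _ s2) // ler1n. Qed.
Let rq : rcp q%:E = a. Proof. by rewrite rcp_fin // gt_eqF. Qed.
Let rs : rcp sigma%:E = b. Proof. by rewrite rcp_fin // gt_eqF. Qed.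
Let two1 : (1 <= 2%:E :> \bar R)%E. Proof. by rewrite lee_fin ler1n. Qed.
Let r2 : rcp 2%:E = 2^-1 :> R. Proof. by rewrite rcp_fin. Qed.

Variables (m k n : nat) (A : Type) (p theta : A -> \bar R) (nu : A -> R).
Hypotheses (m0 : (0 < m)%N) (k0 : (0 < k)%N).
Hypothesis hn : n%:R <= (m * k)%:R / 2 :> R.
Hypotheses (p1 : forall a, (1 <= p a)%E) (theta1 : forall a, (1 <= theta a)%E).
Hypothesis nu0 : forall a, 0 < nu a.
Notation u a := (rcp (p a)).
Notation v a := (rcp (theta a)).
Let M : set 'M[R]_(m, k) := ball_intersection p theta nu.
Let d := kolmogorov_width (X := 'M[R]_(m, k)) (lnorm2 q%:E sigma%:E) M n.
Let lm : R := ln m%:R.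
Let lk : R := ln k%:R.
Let t : R := ln (base a b m k n).
Let F := Phi q sigma m k n.
Let mixp l a b := ((mix2 l (u a) (u b))%:E^-1)%E.
Let mixt l a b := ((mix2 l (v a) (v b))%:E^-1)%E.

Let mixp_spec l i j : 0 < l < 1 ->
  (1 <= mixp l i j)%E /\ rcp (mixp l i j) = mix2 l (u i) (u j).
Proof.
move=> l01; have h := mix2_itv l01 (rcp_itv (p1 i)) (rcp_itv (p1 j)).
by split; [exact: inve_ge1|rewrite rcp_inve //; case/andP: h].
Qed.

Let mixt_spec l i j : 0 < l < 1 ->
  (1 <= mixt l i j)%E /\ rcp (mixt l i j) = mix2 l (v i) (v j).
Proof.
move=> l01; have h := mix2_itv l01 (rcp_itv (theta1 i)) (rcp_itv (theta1 j)).
by split; [exact: inve_ge1|rewrite rcp_inve //; case/andP: h].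
Qed.

(** Every element of every infimum has the form val * Phi (pp, tt), where M lies in val times the
    corresponding ball by interpolation; the upper bound is thereby reduced to one ball. *)
Lemma Psi_ge (z : \bar R) :
  (forall pp tt (val : R), (1 <= pp)%E -> (1 <= tt)%E ->
    (forall x, M x -> nrm2 (rcp pp) (rcp tt) x <= val) ->
    (z <= (val * F pp tt)%:E)%E) ->
  (z <= minPsi q sigma m k n p theta nu)%E.
Proof.
move=> hz; rewrite /minPsi; elim/big_ind: _ => [|x y hx hy|j _].
- exact: leey.
- by rewrite le_min hx.
have hM i x : M x -> nrm2 (u i) (v i) x <= nu i.
  by move=> /(ball_intersectionP p1 theta1 nu0).
have h2 i j' l x : 0 < l < 1 -> M x ->
    nrm2 (mix2 l (u i) (u j')) (mix2 l (v i) (v j')) x <=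
      nu i `^ (1 - l) * nu j' `^ l by move=> l01; exact: interp2.
case: j => -[|[|[|[|[|[|[|[|//]]]]]]]] hj; rewrite /Psi /=;
  apply: le_ereal_inf_tmp.
- by move=> _ [i ->]; apply: hz => // x; exact: hM.
- move=> _ [i [j [l [[_ l01 E] ->]]]].
  have [t1 tE] := mixt_spec i j l01.
  apply: hz => // x Mx; rewrite rq tE /a E; exact: h2.
- move=> _ [i [j [l [[_ l01 E] ->]]]].
  have [t1 tE] := mixp_spec i j l01.
  apply: hz => // x Mx; rewrite rs tE /b E; exact: h2.
- move=> _ [i [j [l [[_ l01 E] ->]]]].
  have [t1 tE] := mixt_spec i j l01.
  apply: hz => // x Mx; rewrite r2 tE E; exact: h2.
- move=> _ [i [j [l [[_ l01 E] ->]]]].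
  have [t1 tE] := mixp_spec i j l01.
  apply: hz => // x Mx; rewrite r2 tE E; exact: h2.
- move=> _ [i [j [l [pp [tt [[[l01 /andP[pp2 _] /andP[tt2 _]] E1 E2 _ _] ->]]]]]].
  have one2 : 1 <= 2 :> R by rewrite ler1n.
  apply: hz; rewrite ?lee_fin ?(le_trans one2) ?ltW // => x Mx.
  rewrite !rcp_fin ?gt_eqF // ?(lt_trans _ pp2) ?(lt_trans _ tt2) //.
  by rewrite E1 E2; exact: h2.
- move=> _ [i [j [l [ta [tb [tc [[_ [ta0 tb0 tc0] ts E1 E2] ->]]]]]]].
  apply: hz => // x Mx; rewrite rq rs /a /b E1 E2.
  exact: interp3.
- move=> _ [i [j [l [ta [tb [tc [[_ [ta0 tb0 tc0] ts E1 E2] ->]]]]]]].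
  by apply: hz => // x Mx; rewrite r2 {1}E1 E2; exact: interp3.
Qed.

(** The parameter mu is the minimiser supplied by [Phi_min], at which exp phi equals Phi. *)
Lemma width_le_ball (C : R) (L : {vspace 'M[R]_(m, k)}) pp tt (val : R) :
  1 <= C -> (\dim L <= n)%N ->
  (forall u v mu (x : 'M[R]_(m, k)), 0 <= u -> 0 <= v -> 0 <= mu <= 1 ->
      exists2 y, y \in L &
        nrm2 a b (x - y) <= C * expR (phi a b lm lk t u v mu) * nrm2 u v x) ->
  (1 <= pp)%E -> (1 <= tt)%E ->
  (forall x, M x -> nrm2 (rcp pp) (rcp tt) x <= val) ->
  (C^-1%:E * d <= (val * F pp tt)%:E)%E.
Proof.
move=> C1 dL HL pp1 tt1 hM; have C0 : 0 < C by apply: lt_le_trans C1.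
rewrite lee_pdivrMl // -EFinM.
have [[mu mu01 PE] _] := Phi_min q2 s2 m0 k0 hn pp1 tt1.
have /andP[up0 _] := rcp_itv pp1; have /andP[vt0 _] := rcp_itv tt1.
apply: (@le_trans _ _ (ereal_sup [set ereal_inf
   [set (lnorm2 q%:E sigma%:E (x - y))%:E | y in [set y | y \in L]] | x in M])).
  by apply: ereal_inf_lbound; exists L.
apply: ge_ereal_sup => _ [x Mx <-].
have [y yL hy] := HL _ _ mu x up0 vt0 mu01.
apply: (@le_trans _ _ (lnorm2 q%:E sigma%:E (x - y))%:E).
  by apply: ereal_inf_lbound; exists y.
rewrite lee_fin lnorm2E // rq rs; apply: le_trans hy _.
rewrite [F pp tt]PE -mulrA ler_wpM2l ?(ltW C0) // mulrC.
by rewrite ler_wpM2r ?expR_ge0 // hM.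
Qed.

Lemma ln_le_phi (y w mu : R) pp tt val : 0 < y -> (1 <= pp)%E -> (1 <= tt)%E ->
  val = expR w -> 0 <= mu <= 1 -> (y%:E <= (val * F pp tt)%:E)%E ->
  0 <= w - ln y + phi a b lm lk t (rcp pp) (rcp tt) mu.
Proof.
move=> y0 pp1 tt1 -> mu01; rewrite lee_fin => h.
have [_ /(_ mu mu01) hP] := Phi_min q2 s2 m0 k0 hn pp1 tt1.
have : y <= expR (w + phi a b lm lk t (rcp pp) (rcp tt) mu).
  by rewrite expRD; apply: le_trans h _; rewrite ler_wpM2l ?expR_ge0.
by rewrite -{1}(lnK y0) ler_expR; lra.
Qed.

Let nu_exp i : nu i = expR (ln (nu i)). Proof. by rewrite lnK // posrE. Qed.

Let nu2_exp i j l : nu i `^ (1 - l) * nu j `^ l =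
  expR ((1 - l) * ln (nu i) + l * ln (nu j)).
Proof. by rewrite expRD !powR_expR. Qed.

Let nu3_exp i j l x y z : nu i `^ x * nu j `^ y * nu l `^ z =
  expR (x * ln (nu i) + y * ln (nu j) + z * ln (nu l)).
Proof. by rewrite !expRD !powR_expR. Qed.

Lemma Psi_elem (y : \bar R) (j : 'I_8) :
  (y <= minPsi q sigma m k n p theta nu)%E ->
  (y <= Psi q sigma m k n p theta nu j)%E.
Proof.
move=> /le_trans; apply; rewrite /minPsi (bigD1 j) //=.
by rewrite ge_min lexx.
Qed.

Lemma on_line_collinear (x1 y1 x2 y2 x3 y3 : R) :
  on_one_line (x1, y1) (x2, y2) (x3, y3) -> collinear x1 y1 x2 y2 x3 y3.
Proof.
move=> [c1 [c2 [c3 [c12 [/= e1 e2 e3]]]]]; rewrite /collinear.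
have [c10|c1n] := eqVneq c1 0.
  have c2n : c2 != 0 by apply/eqP => c20; apply: c12; rewrite c10 c20.
  apply: (mulfI c2n); rewrite c10 !mul0r !add0r in e1 e2 e3.
  have h1 : c2 * (y3 - y1) = 0 by rewrite mulrBr e1 e3 subrr.
  have h2 : c2 * (y2 - y1) = 0 by rewrite mulrBr e1 e2 subrr.
  by rewrite mulrCA h1 mulrCA h2 !mulr0.
apply: (mulfI c1n).
have h2 : c1 * (x2 - x1) = - (c2 * (y2 - y1)) by move: e1 e2; lra.
have h3 : c1 * (x3 - x1) = - (c2 * (y3 - y1)) by move: e1 e3; lra.
by rewrite !mulrA h2 h3; ring.
Qed.

Lemma minPsi_feasible (y : R) : 0 < y ->
  (y%:E <= minPsi q sigma m k n p theta nu)%E ->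
  feasible (fun i => u i) (fun i => v i) (fun i => ln (nu i) - ln y) a b lm lk t.
Proof.
move=> y0 hy.
have el (j : 'I_8) z : (exists2 S, Psi q sigma m k n p theta nu j = ereal_inf S & S z) ->
    (y%:E <= z)%E.
  move=> [S SE Sz]; apply: le_trans (Psi_elem j hy) _; rewrite SE.
  exact: ereal_inf_lbound.
have mm l i j : mix2 l i j = (1 - l) * i + l * j :> R by [].
have neq r pp : r != 0 -> rcp pp != r^-1 -> pp <> r%:E :> \bar R.
  by move=> r0 /eqP h E; apply: h; rewrite E rcp_fin.
have qn : q != 0 by rewrite gt_eqF.
have sn : sigma != 0 by rewrite gt_eqF.
have tn : 2 != 0 :> R by rewrite pnatr_eq0.
split.
- move=> i mu mu01; apply: (ln_le_phi y0 (p1 i) (theta1 i) (nu_exp i) mu01).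
  by apply: (el (inord 0)); rewrite inordK //=; eexists; [reflexivity|exists i].
- move=> i j l xi mu l01 mu01 hxi ui E.
  have [t1 tE] := mixt_spec i j l01.
  have goalE w : w + phi a b lm lk t xi ((1 - l) * v i + l * v j) mu =
    w + phi a b lm lk t xi (rcp (mixt l i j)) mu by rewrite tE.
  have -> : (1 - l) * (ln (nu i) - ln y) + l * (ln (nu j) - ln y) =
    (1 - l) * ln (nu i) + l * ln (nu j) - ln y by ring.
  rewrite goalE; case: hxi => xiE.
    rewrite xiE.
    have := ln_le_phi y0 q1 t1 (nu2_exp i j l) mu01; rewrite rq; apply.
    apply: (el (inord 1)); rewrite inordK //=; eexists; first reflexivity.
    exists i, j, l; split => //; split => //.
      by apply: neq => //; rewrite -/a -xiE.
    by rewrite mm -/a -xiE -E.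
  rewrite xiE.
  have := ln_le_phi y0 two1 t1 (nu2_exp i j l) mu01; rewrite r2; apply.
  apply: (el (inord 3)); rewrite inordK //=; eexists; first reflexivity.
  exists i, j, l; split => //; split => //.
    by apply: neq => //; rewrite -xiE.
  by rewrite mm -xiE -E.
- move=> i j l xi mu l01 mu01 hxi ui E.
  have [t1 tE] := mixp_spec i j l01.
  have goalE w : w + phi a b lm lk t ((1 - l) * u i + l * u j) xi mu =
    w + phi a b lm lk t (rcp (mixp l i j)) xi mu by rewrite tE.
  have -> : (1 - l) * (ln (nu i) - ln y) + l * (ln (nu j) - ln y) =
    (1 - l) * ln (nu i) + l * ln (nu j) - ln y by ring.
  rewrite goalE; case: hxi => xiE.
    rewrite xiE.
    have := ln_le_phi y0 t1 s1 (nu2_exp i j l) mu01; rewrite rs; apply.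
    apply: (el (inord 2)); rewrite inordK //=; eexists; first reflexivity.
    exists i, j, l; split => //; split => //.
      by apply: neq => //; rewrite -/b -xiE.
    by rewrite mm -/b -xiE -E.
  rewrite xiE.
  have := ln_le_phi y0 t1 two1 (nu2_exp i j l) mu01; rewrite r2; apply.
  apply: (el (inord 4)); rewrite inordK //=; eexists; first reflexivity.
  exists i, j, l; split => //; split => //.
    by apply: neq => //; rewrite -xiE.
  by rewrite mm -xiE -E.
- move=> i j l mu l01 /andP[mu0 mu1] a2 b2 Eu Ev nd.
  have -> : (1 - l) * (ln (nu i) - ln y) + l * (ln (nu j) - ln y) =
    (1 - l) * ln (nu i) + l * ln (nu j) - ln y by ring.
  rewrite Eu Ev.
  (* An interior mu gives exponents strictly between 2 and q, respectively sigma, as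
     [crosses_diagonal] requires. *)
  have inn c : 0 < c -> c < 2^-1 ->
      [/\ c + mu * (2^-1 - c) != 0, 2 < (c + mu * (2^-1 - c))^-1 &
          (c + mu * (2^-1 - c))^-1 < c^-1].
    move=> c0 c2; have c20 : 0 < 2^-1 - c by rewrite subr_gt0.
    have h1 : 0 < mu * (2^-1 - c) by rewrite mulr_gt0.
    have h2 : 0 < c + mu * (2^-1 - c) by rewrite addr_gt0.
    have h3 : 0 < (1 - mu) * (2^-1 - c) by rewrite mulr_gt0 // subr_gt0.
    split; first by rewrite gt_eqF.
      by rewrite -[ltLHS]invrK ltf_pV2 ?posrE ?invr_gt0 //; lra.
    by rewrite ltf_pV2 ?posrE //; lra.
  have [xn x2 xa] := inn a (proj1 (andP ha)) a2.
  have [zn z2 zb] := inn b (proj1 (andP hb)) b2.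
  set xi := a + _ in Eu xn x2 xa *; set eta := b + _ in Ev zn z2 zb *.
  have one2 : 1 <= 2 :> R by rewrite ler1n.
  have X1 : (1 <= (xi^-1)%:E)%E by rewrite lee_fin (le_trans one2) // ltW.
  have Z1 : (1 <= (eta^-1)%:E)%E by rewrite lee_fin (le_trans one2) // ltW.
  have XE : rcp (xi^-1)%:E = xi by rewrite rcp_fin ?invr_eq0 // invrK.
  have ZE : rcp (eta^-1)%:E = eta by rewrite rcp_fin ?invr_eq0 // invrK.
    have mu01 : 0 <= mu <= 1 by rewrite !ltW.
  have := ln_le_phi y0 X1 Z1 (nu2_exp i j l) mu01; rewrite XE ZE; apply.
  apply: (el (inord 5)); rewrite inordK //=; eexists; first reflexivity.
  exists i, j, l, xi^-1, eta^-1; split => //.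
  have an : 2^-1 - a != 0 by rewrite subr_eq0 gt_eqF.
  have bn : 2^-1 - b != 0 by rewrite subr_eq0 gt_eqF.
  split.
  + by rewrite l01 x2 z2; move: xa zb; rewrite !invrK => -> ->.
  + by rewrite invrK mm Eu.
  + by rewrite invrK mm Ev.
  + by rewrite !invrK -/a -/b /xi /eta ![_ + _ - _]addrAC !subrr !add0r !mulfK.
  + move=> E; move/eqP: nd; apply; rewrite -/a -/b in E.
    have := congr1 (fun r => r * (2^-1 - a) * (2^-1 - b)) E.
    by rewrite /= divfK // mulrAC divfK.
- move=> i j l x z w xi eta mu x0 z0 w0 s mu01 hv ncol Eu Ev.
  have -> : x * (ln (nu i) - ln y) + z * (ln (nu j) - ln y) + w * (ln (nu l) - ln y)
     = x * ln (nu i) + z * ln (nu j) + w * ln (nu l) - (x + z + w) * ln y by ring.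
  rewrite s mul1r.
  have gp : in_general_position p theta i j l by move=> /on_line_collinear.
  case: hv => -[xiE etaE]; rewrite xiE etaE.
    have := ln_le_phi y0 q1 s1 (nu3_exp i j l x z w) mu01; rewrite rq rs; apply.
    apply: (el (inord 6)); rewrite inordK //=; eexists; first reflexivity.
    exists i, j, l, x, z, w; split => //; split => //.
      by rewrite /mix3 Eu xiE.
    by rewrite /mix3 Ev etaE.
  have := ln_le_phi y0 two1 two1 (nu3_exp i j l x z w) mu01.
  rewrite r2; apply.
  apply: (el (inord 7)); rewrite inordK //=; eexists; first reflexivity.
  exists i, j, l, x, z, w; split => //; split => //.
    by rewrite /mix3 Eu xiE.
  by rewrite /mix3 Ev etaE.
Qed.

(** The sides of the rectangle are exp X and exp Y rounded down. Each rounding loses at most a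
    factor 2, which gives 1/4 for the product, and [width_lower_rect] contributes the other 1/4. *)
Lemma width_ge (y : R) : inhabited A -> 0 < y ->
  (y%:E <= minPsi q sigma m k n p theta nu)%E -> ((16^-1 * y)%:E <= d)%E.
Proof.
move=> iA y0 hy; have F0 := minPsi_feasible y0 hy.
have mR : 0 < m%:R :> R by rewrite ltr0n.
have kR : 0 < k%:R :> R by rewrite ltr0n.
have lm0 : 0 <= lm by apply: ln_ge0; rewrite ler1n.
have lk0 : 0 <= lk by apply: ln_ge0; rewrite ler1n.
have [a0 a2] := andP ha; have [b0 b2] := andP hb.
have u0 i : 0 <= u i by have /andP[] := rcp_itv (p1 i).
have v0 i : 0 <= v i by have /andP[] := rcp_itv (theta1 i).
have u1 i : u i <= 1 by have /andP[] := rcp_itv (p1 i).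
have v1 i : v i <= 1 by have /andP[] := rcp_itv (theta1 i).
have ha' : 0 <= a <= 2^-1 by rewrite ltW.
have hb' : 0 <= b <= 2^-1 by rewrite ltW.
have [X [Y [/andP[X0 Xm] /andP[Y0 Yk] HXY]]] :=
  feasible_box_point iA u0 v0 ha' hb' lm0 lk0 F0.
set Z := Num.min _ _ in HXY.
have tr (W : R) N : 0 <= W -> W <= ln N%:R -> (0 < N)%N ->
    [/\ (0 < Num.truncn (expR W) <= N)%N, (Num.truncn (expR W))%:R <= expR W &
      expR W / 2 <= (Num.truncn (expR W))%:R].
  move=> W0 WN N0; have e1 : 1 <= expR W by rewrite -expR0 ler_expR.
  have tl : (Num.truncn (expR W))%:R <= expR W by rewrite truncn_le // expR_ge0.
  have tg := truncnS_gt (expR W).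
  have t1 : (0 < Num.truncn (expR W))%N by rewrite truncn_gt0.
  split => //.
    rewrite t1 -(@ler_nat R) (le_trans tl) // -[leRHS]lnK ?posrE ?ltr0n //.
    by rewrite ler_expR.
  have : 1 <= (Num.truncn (expR W))%:R :> R by rewrite ler1n.
  by move: tg; rewrite -addn1 natrD; lra.
have [hl lX Xl] := tr X m X0 Xm m0.
have [hr rY Yr] := tr Y k Y0 Yk k0.
set l := Num.truncn (expR X) in hl lX Xl; set r := Num.truncn (expR Y) in hr rY Yr.
have lower (W c : R) N : expR W / 2 <= N%:R -> 0 <= c <= 1 ->
    expR (c * W) / 2 <= N%:R `^ c.
  move=> hW /andP[c0 c1].
  apply: (@le_trans _ _ ((expR W / 2) `^ c)); last first.
    by apply: ge0_ler_powR; rewrite ?nnegrE ?ler0n // divr_ge0 ?expR_ge0.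
  rewrite powRM ?expR_ge0 ?invr_ge0 // powR_expR ?expR_gt0 // expRK.
  rewrite ler_wpM2l ?expR_ge0 // ger1_powR //; first by apply/andP; split; lra.
rewrite /d /kolmogorov_width; apply: le_ereal_inf_tmp => _ [L dL <-].
have [x [xn xL]] := width_lower_rect ha hb m0 k0 hl hr hn dL.
(* By [HXY], tau times an exp X by exp Y rectangle has every norm of the family within its radius,
   while tau exp Z = y is the desired distance. *)
pose tau := expR (ln y - Z); have tau0 : 0 < tau by exact: expR_gt0.
have nZ c u' v' (w : 'M[R]_(m, k)) : 0 < c ->
    nrm2 u' v' (c *: w) = c * nrm2 u' v' w.
  move=> c0; rewrite -[c in RHS]gtr0_norm // -nrm2Z; congr nrm2.
  by apply/funext => i; apply/funext => j; rewrite mxE.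
have Mx : M (tau *: x).
  apply/(ball_intersectionP p1 theta1 nu0) => i.
  rewrite nZ // xn //.
  apply: (@le_trans _ _ (tau * (expR (u i * X) * expR (v i * Y)))).
    rewrite ler_wpM2l ?(ltW tau0) //.
    have up (W c : R) N : N%:R <= expR W -> 0 <= c -> N%:R `^ c <= expR (c * W).
      move=> hN c0; rewrite -[expR (c * W)](_ : expR W `^ c = _).
        by apply: ge0_ler_powR; rewrite ?nnegrE ?ler0n ?expR_ge0.
      by rewrite powR_expR ?expR_gt0 // expRK.
    by apply: ler_pM; rewrite ?powR_ge0 // up.
  rewrite /tau -!expRD (nu_exp i) ler_expR.
  by have := HXY i; lra.
apply: (@le_trans _ _ (ereal_inf [set (lnorm2 q%:E sigma%:E (tau *: x - y'))%:E
   | y' in [set y' | y' \in L]])); last first.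
  by apply: ereal_sup_ubound; exists (tau *: x).
apply: le_ereal_inf_tmp => _ [y' y'L <-].
rewrite lee_fin lnorm2E // rq rs.
have -> : tau *: x - y' = tau *: (x - tau^-1 *: y').
  by rewrite scalerBr scalerA mulfV ?scale1r // gt_eqF.
rewrite nZ //.
have y'L' : tau^-1 *: y' \in L by rewrite memvZ.
apply: (@le_trans _ _ (tau * (4^-1 * (expR Z / 4)))); last first.
  rewrite ler_wpM2l ?(ltW tau0) //; apply: le_trans (xL _ y'L').
  rewrite ler_wpM2l ?invr_ge0 //.
  have a1 : 0 <= a <= 1 by lra.
  have b1 : 0 <= b <= 1 by lra.
  have h1 : 0 <= (2^-1 : R) <= 1 by lra.
  have e1 := lower _ _ _ Xl a1; have e2 := lower _ _ _ Yr b1.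
  have e3 := lower _ _ _ Xl h1; have e4 := lower _ _ _ Yr h1.
  have eh (W : R) : 0 <= expR W / 2 by rewrite divr_ge0 ?expR_ge0.
  rewrite le_min; apply/andP; split.
    apply: (@le_trans _ _ (expR (a * X) / 2 * (expR (b * Y) / 2))).
      rewrite mulrACA -expRD -invfM -natrM ler_wpM2r ?invr_ge0 // ler_expR.
      by rewrite /Z ge_min lexx.
    exact: ler_pM (eh _) (eh _) e1 e2.
  have T0 : 0 < base a b m k n by exact: base_gt0.
  apply: (@le_trans _ _ (base a b m k n * (expR (2^-1 * X) / 2 *
      (expR (2^-1 * Y) / 2)))).
    rewrite mulrACA -expRD -invfM -natrM mulrA ler_wpM2r ?invr_ge0 //.
    rewrite -{1}[base a b m k n]lnK ?posrE // -expRD ler_expR /Z ge_min.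
    apply/orP; right; rewrite /t -addrA le_eqVlt; apply/orP; left; apply/eqP.
    by ring.
  rewrite -[leRHS]mulrA ler_wpM2l ?(ltW T0) //.
  exact: ler_pM (eh _) (eh _) e3 e4.
rewrite /tau expRD expRN lnK ?posrE // le_eqVlt; apply/orP; left; apply/eqP.
by field; rewrite gt_eqF ?expR_gt0.
Qed.

End Main.

Theorem theorem1 (R : realType) (q sigma : R) (hq : 2 <= q)
    (hsigma : 2 <= sigma) :
  exists c C : R, [/\ 0 < c, c <= C &
    forall (m k n : nat), (0 < m)%N -> (0 < k)%N ->
      n%:R <= (m * k)%:R / 2 :> R ->
    forall (A : Type) (p theta : A -> \bar R) (nu : A -> R),
      inhabited A ->
      (forall a, (1 <= p a)%E) ->
      (forall a, (1 <= theta a)%E) ->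
      (forall a, 0 < nu a) ->
      (forall a b, a <> b -> (p a, theta a) <> (p b, theta b)) ->
    let d := kolmogorov_width (X := 'M[R]_(m, k))
               (lnorm2 q%:E sigma%:E) (ball_intersection p theta nu) n in
    (c%:E * minPsi q sigma m k n p theta nu <= d)%E /\
    (d <= C%:E * minPsi q sigma m k n p theta nu)%E].
Proof.
have q0 : 0 < q by apply: lt_le_trans hq.
have s0 : 0 < sigma by apply: lt_le_trans hsigma.
have ha : 0 < q^-1 <= 2^-1 by rewrite invr_gt0 q0 lef_pV2 ?posrE.
have hb : 0 < sigma^-1 <= 2^-1 by rewrite invr_gt0 s0 lef_pV2 ?posrE.
have [C [C1 HC]] := width_ball ha hb.
have C0 : 0 < C by apply: lt_le_trans C1.
exists 16^-1, C; split; first by rewrite invr_gt0.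
  by apply: le_trans C1; rewrite invf_le1 // ler1n.
move=> m k n m0 k0 hn A p theta nu iA p1 theta1 nu0 _ d.
have up : (C^-1%:E * d <= minPsi q sigma m k n p theta nu)%E.
  have [L [dL HL]] := HC m k n m0 k0.
  by apply: Psi_ge => // pp tt val; exact: width_le_ball HL.
split; last by rewrite -lee_pdivrMl.
have d0 : (0 <= d)%E.
  apply: le_ereal_inf_tmp => _ [L dL <-].
  apply: (@le_trans _ _ (ereal_inf [set (lnorm2 q%:E sigma%:E (0 - y))%:E
     | y in [set y | y \in L]])).
    apply: le_ereal_inf_tmp => _ [y yL <-].
    by rewrite lee_fin lnorm2E ?nrm2_ge0 // lee_fin; [move: hq|move: hsigma]; lra.
  apply: ereal_sup_ubound; exists 0 => //.
  apply/(ball_intersectionP p1 theta1 nu0) => i.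
  by rewrite nrm2_zero ?(ltW (nu0 i)) // => i' j'; rewrite mxE.
set P := minPsi q sigma m k n p theta nu in up *.
have P0 : (0 <= P)%E.
  by apply: le_trans up; rewrite mule_ge0 // lee_fin invr_ge0 ltW.
(* [width_ge] takes a positive real bound. [P] is finite because the family has a member, and for P
   = 0 the lower bound is just d >= 0. *)
have Pfin : (P < +oo)%E.
  have [i] := iA.
  apply: (@le_lt_trans _ _ (nu i * Phi q sigma m k n (p i) (theta i))%:E); last exact: ltry.
  apply: (le_trans (@Psi_elem R q sigma m k n A p theta nu P 0 (lexx _))).
  by apply: ereal_inf_lbound; exists i.
have : P \is a fin_num by rewrite ge0_fin_numE.
move=> /fineK PE; rewrite -PE -EFinM.
have [y0|yn] := eqVneq (fine P) 0; first by rewrite y0 mulr0.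
apply: width_ge => //.
  by rewrite lt0r yn fine_ge0.
by rewrite PE.
Qed.
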